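(* Let $k\ge1$ and $n\ge 2k$ be integers, let $Y_{n,k}$ be the circle quotient Stiefel manifold, let $$J=\min\Bigl\{\, r \ \Big|\ \tbinom{k+r-1}{k-1}\text{ is odd and } n-2k\le 2r-1\le n-1\,\Bigr\},$$ and let $$m=\max\Bigl\{\, j\ \Big|\ \tbinom{nk+j-1}{nk-1}\not\equiv 0 \pmod 2,\ 0\le j\le J-1\,\Bigr\}.$$ Then $Y_{n,k}$ does not admit an immersion in $\mathbb{R}^{\dim(Y_{n,k})+2m-1}$, and it does not admit a skew embedding in $\mathbb{R}^{2\dim(Y_{n,k})+4m}$.
   Context: $V_{n,2k}$ is the real Stiefel manifold of orthonormal $2k$-tuples of vectors in $\mathbb{R}^n$. Regard $S^1=SO(2)$ as a subgroup of $SO(2k)$ via the diagonal map into the block-diagonal maximal torus $SO(2)^k\subset SO(2k)$. $SO(2k)$ acts on $V_{n,2k}$ from the right by matrix multiplication, and $Y_{n,k}=V_{n,2k}/S^1$ is the orbit space of the restricted action of $S^1$. An embedding of a smooth manifold $M$ in $\mathbb{R}^d$ is called totally skew (or a skew embedding) if for any two distinct points of $M$ the affine tangent subspaces of $\mathbb{R}^d$ at these points are skew, i.e. they do not intersect and contain no parallel lines. *)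

(* Defs.v *)
From HB Require Import structures.
From mathcomp Require Import all_boot all_order all_algebra.
From mathcomp Require Import all_classical all_reals all_analysis.

Set Implicit Arguments.
Unset Strict Implicit.
Unset Printing Implicit Defensive.

Import Order.TTheory GRing.Theory Num.Theory.
Import numFieldNormedType.Exports.

Local Open Scope classical_set_scope.
Local Open Scope quotient_scope.
Local Open Scope ring_scope.

(* Only meant for open U, and for finite-dimensional E, where f is C^(r+1) iff
   it is differentiable and all its directional derivatives are C^r. *)
Fixpoint Cr_on (R : realType) (E F : normedModType R) (r : nat) (U : set E)
    (f : E -> F) : Prop :=
  match r with
  | 0 => forall x, U x -> {for x, continuous f}
  | r'.+1 => (forall x, U x -> differentiable f x) /\
             (forall v : E, Cr_on r' U ('D_v f))
  end.

Definition smooth_on (R : realType) (E F : normedModType R) (U : set E)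
    (f : E -> F) : Prop := forall r, Cr_on r U f.

(* Velocities at x of the smooth curves of E that stay in S; this is the usual
   tangent space when S is an embedded submanifold of E. *)
Definition tangent_vectors (R : realType) (E : normedModType R) (S : set E)
    (x : E) : set E :=
  [set v | exists c : R^o -> E,
     [/\ smooth_on setT c, c 0 = x, forall t, S (c t) & v = derive1 c 0]].

(* g is defined on the submanifold S and W is open in S: smooth means that g
   extends locally to a smooth map of the ambient space E. *)
Definition smooth_submersion_on (R : realType) (E F : normedModType R)
    (S : set E) (W : set S) (g : S -> F) : Prop :=
  forall x : S, W x -> exists (U : set E) (G : E -> F),
    [/\ open U, U (\val x), smooth_on U G,
        forall z : S, W z -> U (\val z) -> g z = G (\val z) &
        'd G (\val x) @` tangent_vectors S (\val x) = setT].

(* The values of cmap outside of cdom, and of cinv outside of cmap @` cdom,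
   are irrelevant. *)
Record chart (R : realType) (d : nat) (M : topologicalType) := Chart {
  cdom : set M ;
  cmap : M -> 'rV[R]_d ;
  cinv : 'rV[R]_d -> M }.

Definition crange (R : realType) (d : nat) (M : topologicalType)
  (c : chart R d M) : set 'rV[R]_d := cmap c @` cdom c.

Definition chart_homeo (R : realType) (d : nat) (M : topologicalType)
    (c : chart R d M) : Prop :=
  [/\ open (cdom c), open (crange c),
      (forall y, cdom c y -> cinv c (cmap c y) = y),
      {within cdom c, continuous (cmap c)} &
      {within crange c, continuous (cinv c)}].

(* The maximal atlas of the unique smooth structure of dimension d on the
   quotient space Q of the submanifold S for which the projection S -> Q is a
   smooth submersion (if there is one). *)
Definition quotient_atlas (R : realType) (E : normedModType R) (S : set E)
    (Q : quotType S) (d : nat) : set (chart R d (quotient_topology Q)) :=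
  [set c | chart_homeo c /\
     smooth_submersion_on
       (\pi_(quotient_topology Q) @^-1` cdom c)
       (cmap c \o \pi_(quotient_topology Q))].

Arguments quotient_atlas {R E S} Q d _.

Section MapsToEuclideanSpace.
Variables (R : realType) (d : nat) (M : topologicalType).
Variables (A : set (chart R d M)) (N : nat).
Implicit Types (f : M -> 'rV[R]_N) (y : M).

Definition immersion f : Prop :=
  forall c, A c ->
    smooth_on (crange c) (f \o cinv c) /\
    (forall y, cdom c y -> injective ('d (f \o cinv c) (cmap c y))).

Definition embedding f : Prop :=
  [/\ immersion f, injective f, continuous f &
      forall U : set M, open U ->
        exists2 W : set 'rV[R]_N, open W & f @^-1` W = U].

Definition affine_tangent f y : set 'rV[R]_N :=
  [set z | exists c, [/\ A c, cdom c y &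
     exists v, z = f y + 'd (f \o cinv c) (cmap c y) v]].

Definition skew (P Q : set 'rV[R]_N) : Prop :=
  P `&` Q = set0 /\
  ~ (exists p q u : 'rV[R]_N, [/\ u != 0,
       forall t : R, P (p + t *: u) & forall t : R, Q (q + t *: u)]).

Definition skew_embedding f : Prop :=
  embedding f /\
  (forall y1 y2, y1 <> y2 -> skew (affine_tangent f y1) (affine_tangent f y2)).

End MapsToEuclideanSpace.

(* Row i of a matrix in V_{n,2k} lists the i-th coordinates of the 2k vectors,
   which are the columns. *)
Definition stiefel (R : realType) (n l : nat) : set 'M[R]_(n, l) :=
  [set X | X^T *m X = 1%:M].
Arguments stiefel : clear implicits.

Definition SO (R : realType) (l : nat) : set 'M[R]_l :=
  [set A | A^T *m A = 1%:M /\ \det A = 1].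
Arguments SO : clear implicits.

Definition diagSO2 (R : realType) (k : nat) (A : 'M[R]_2) : 'M[R]_(2 * k) :=
  \matrix_(i, j) if (i %/ 2 == j %/ 2)%N
                 then A (inord (i %% 2)) (inord (j %% 2)) else 0.
Arguments diagSO2 {R} k A.

Section CircleQuotient.
Variables (R : realType) (n k : nat).

Definition circle_rel (X Z : stiefel R n (2 * k)) : bool :=
  `[< exists2 A, SO R 2 A & \val Z = \val X *m diagSO2 k A >].

Lemma diagSO2_1 : diagSO2 k 1%:M = 1%:M :> 'M[R]_(2 * k).
Proof.
apply/matrixP => i j; rewrite !mxE.
have h (a : nat) : (a %% 2 < 2)%N by rewrite ltn_mod.
rewrite -!val_eqE /= !inordK //.
case: eqP => [q|q]; last by case: eqP => // e; case: q; rewrite e.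
congr (_%:R); apply/f_equal.
apply/eqP/eqP => [e|->//].
by rewrite (divn_eq i 2) (divn_eq j 2) q e.
Qed.

Lemma diagSO2M (A B : 'M[R]_2) :
  diagSO2 k A *m diagSO2 k B = diagSO2 k (A *m B).
Proof.
apply/matrixP => i j; rewrite !mxE.
have lt (b : 'I_2) : (2 * (i %/ 2) + b < 2 * k)%N.
  have hb := ltn_ord b; have hk := ltn_ord i.
  have : (i %/ 2 < k)%N by rewrite ltn_divLR // [leqRHS]mulnC.
  by rewrite -(leq_pmul2l (m:=2)) // mulnS; apply: leq_trans; rewrite addnC ltn_add2r.
pose h (b : 'I_2) := Ordinal (lt b).
have hdiv b : (h b %/ 2 = i %/ 2)%N.
  by rewrite /= [(2 * _)%N]mulnC divnMDl // [(b %/ 2)%N]divn_small ?ltn_ord // addn0.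
have hmod b : inord (h b %% 2) = b.
  by rewrite /= [(2 * _)%N]mulnC modnMDl modn_small ?ltn_ord // inord_val.
pose p (l : 'I_(2 * k)) := (l %/ 2 == i %/ 2)%N.
rewrite (bigID p) /= [X in _ + X]big1 ?addr0 => [|l /negPf pl]; last first.
  by rewrite !mxE eq_sym -/(p l) pl mul0r.
have hK : {on p, bijective h}.
  exists (fun l : 'I_(2 * k) => inord (l %% 2)) => [b _|l pl]; first exact: hmod.
  have {}pl : (l %/ 2 = i %/ 2)%N by apply/eqP; exact: pl.
  apply: val_inj.
  by rewrite /= inordK ?ltn_mod // -pl [(2 * _)%N]mulnC -divn_eq.
rewrite (reindex h) //=.
under eq_bigl => b do rewrite /p hdiv eqxx.
under eq_bigr => b _ do rewrite !mxE hdiv eqxx hmod.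
by case: ifP => // _; rewrite big1 // => b _; rewrite mulr0.
Qed.

Lemma SO_tr l (A : 'M[R]_l) : SO R l A -> SO R l A^T /\ A *m A^T = 1%:M.
Proof.
by move=> [AA dA]; have AA' := mulmx1C AA; split=> //; split; rewrite ?trmxK ?det_tr.
Qed.

Lemma circle_rel_refl : reflexive circle_rel.
Proof.
move=> X; apply/asboolP; exists 1%:M; last by rewrite diagSO2_1 mulmx1.
by split; rewrite ?trmx1 ?mulmx1 ?det1.
Qed.

Lemma circle_rel_sym : symmetric circle_rel.
Proof.
have sub X Z : circle_rel X Z -> circle_rel Z X.
  move=> /asboolP[A /SO_tr[At AAt] e]; apply/asboolP; exists A^T => //.
  by rewrite e -mulmxA diagSO2M AAt diagSO2_1 mulmx1.
by move=> X Z; apply/idP/idP; exact: sub.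
Qed.

Lemma circle_rel_trans : transitive circle_rel.
Proof.
move=> Z X T /asboolP[A [AA dA] e] /asboolP[B [BB dB] e'].
apply/asboolP; exists (A *m B); last by rewrite e' e -mulmxA diagSO2M.
split; last by rewrite det_mulmx dA dB mulr1.
by rewrite trmx_mul -mulmxA [A^T *m _]mulmxA AA mul1mx.
Qed.

Canonical circle_equiv :=
  EquivRel circle_rel circle_rel_refl circle_rel_sym circle_rel_trans.

Definition circleStiefel : topologicalType :=
  quotient_topology {eq_quot circle_equiv}.

(* dim V_{n,2k} = 2kn - 2k(2k+1)/2 *)
Definition dimY : nat := (2 * k * n - k * (2 * k + 1) - 1)%N.

Definition circleStiefel_atlas : set (chart R dimY circleStiefel) :=
  quotient_atlas {eq_quot circle_equiv} dimY.

End CircleQuotient.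
Arguments circleStiefel : clear implicits.
Arguments circleStiefel_atlas : clear implicits.

Definition is_min (P : nat -> Prop) (a : nat) : Prop :=
  P a /\ forall b, P b -> (a <= b)%N.

Definition is_max (P : nat -> Prop) (a : nat) : Prop :=
  P a /\ forall b, P b -> (b <= a)%N.

(* Main.v *)
(* Restrict the circle action to {1, -1}. Writing J for the complex structure on
   the columns, an immersion f of Y makes the triple of the derivative of f
   along the projection of U to the tangent space at X, the inner product
   <U, XJ> and the symmetric part of X^T U into a map Phi_X(U), linear and
   injective in the n x 2k matrix U, odd in X, with values in a space of
   dimension 2nk + 2m - 1.  Such a map contradicts a Borsuk-Ulam theorem on a
   product of a test space over the Stiefel manifold (an iterated join of spheres
   S^0, of dimension 2m, that maps to V_{n,2k} equivariantly by the Hopf-Stiefel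
   sums of orthogonal designs) with the sphere of the U's: the relevant power of
   w_1 is the mod 2 binomial coefficient that is assumed odd.
   For a skew embedding the same is done on the join of two such products and a
   point: cos a (f y1 - f y2) + sin a (cos b df_1 U1 + sin b df_2 U2) cannot
   vanish if the tangent spaces at y1 and y2 are skew.  The second frame is
   multiplied by diag(1, -1, 1, ..., 1): all the test frames X, X' have a conformal
   leading 2 x 2 block in X^T X', so that y1 and y2 then differ.
   All test spaces are cubes [0, pi]^C with pairs of opposite faces identified
   up to reflections, and Borsuk-Ulam for these is proved by mod 2 cup products
   of cubical cochains on a grid, hence without any homology theory. *)

From HB Require Import structures.
Require Import Defs.
From mathcomp Require Import all_boot all_order all_algebra all_fingroup.
From mathcomp Require Import zify ring lra.
From mathcomp Require Import all_classical all_reals all_analysis.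

Set Implicit Arguments.
Unset Strict Implicit.
Unset Printing Implicit Defensive.

Import Order.TTheory GRing.Theory Num.Theory.
Import numFieldNormedType.Exports.

Local Open Scope classical_set_scope.
Local Open Scope ring_scope.

(** * Cup products on cubical grids *)

(** The three parts of [Phi] fit together because the symmetric part, with [k(2k+1)] entries, and
    [<U, XJ>] are the normal and the orbit components of [U]: they make up the codimension of Y in
    the n x 2k matrices. Hence [Phi] has exactly as many components as the test space has
    dimensions. The number [J] enters only through the size of the orthogonal designs. They give
    frames in dimension [2k + j] with [j <= 2m] and [C(2k - 1 + j, j)] odd; [m < J] and the
    minimality of [J] force [2k + j <= n]. Cup products appear because the sign of an equivariant
    function is a mod 2 function on the cube that jumps across prescribed faces, so its coboundary
    descends to the glued cube. A nonzero product of such coboundaries exhibits a cell on which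
    every function changes sign. As only 1-cochains are multiplied, the product on a cell is a sum
    over monotone edge paths. Faces are glued by reflections, which reverse order but keep parity on
    a grid of even length; therefore edges run from even to odd coordinates instead of upwards. *)

Lemma addbb0 (p : bool) : p + p = 0.
Proof. by case: p. Qed.

Lemma sum_symmetric0 (I : finType) (F : I -> I -> bool) :
  (forall i j, F i j = F j i) -> (forall i, F i i = 0) ->
  \sum_i \sum_j F i j = 0.
Proof.
move=> Fsym F0; rewrite pair_big /=.
pose r (p : I * I) := (enum_rank p.1 < enum_rank p.2)%N.
rewrite (bigID r) /= [X in _ + X](bigID (fun p => p.1 == p.2)) /=.
rewrite [X in _ + (X + _)]big1 ?add0r; last first.
  by case=> i j /= /andP[_ /eqP->].
have swap_inj : injective (fun p : I * I => (p.2, p.1)).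
  by move=> [a b] [c d] [-> ->].
rewrite [X in _ + X](reindex_inj swap_inj) /=.
rewrite [X in _ + X](_ : _ = \sum_(p | r p) F p.1 p.2) ?addbb0 //.
apply: eq_big => [[i j]|[i j] _] /=; last by rewrite Fsym.
by rewrite /r /= -leqNgt ltn_neqAle (inj_eq val_inj) (inj_eq enum_rank_inj) eq_sym andbC.
Qed.

(* The cube [0, pi]^C whose faces z_v = 0 and z_v = pi are identified after
   z_u -> pi - z_u for all u with [refl v u]; [sgn v] says whether the associated
   double cover exchanges its sheets along this face. *)
Record gluing := Gluing { coords :> finType; refl : rel coords; sgn : pred coords }.

Section Grid.
Variables (C : finType).
Implicit Types (x b : C -> nat) (s t phi : (C -> nat) -> bool).

Definition upd x v (y : nat) : C -> nat := fun w => if w == v then y else x w.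
(* Cochains live on a cubical grid, booleans being the field with two elements.
   A cell is spanned by its corner [x] and the opposite corner [b]; [odd_end] and
   [even_end] are the corners of a cell all of whose coordinates are odd,
   respectively even, so that a coordinate of x not yet moved is even. *)
Definition sweep b phi x : bool := \sum_(v | ~~ odd (x v)) phi (upd x v (b v)).
Definition edge b s phi x : bool :=
  \sum_(v | ~~ odd (x v)) (s x + s (upd x v (b v))) * phi (upd x v (b v)).
Definition walk b ss : (C -> nat) -> bool := foldr (edge b) (fun _ => 1) ss.

Definition vertex L x := forall v, (x v <= L.*2)%N.
Definition odd_end L (c : {ffun C -> 'I_L * bool}) v := ((c v).1).*2.+1.
Definition even_end L (c : {ffun C -> 'I_L * bool}) v := ((c v).1 + (c v).2).*2.

(* The cup product of the coboundaries of the (multivalued) functions in [ss],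
   evaluated on the fundamental class. *)
Definition cup L ss : bool := \sum_c walk (@odd_end L c) ss (even_end c).

Lemma eq_sweep b phi phi' x : phi =1 phi' -> sweep b phi x = sweep b phi' x.
Proof. by move=> e; apply: eq_bigr => v _; rewrite e. Qed.

Lemma eq_edge b s phi phi' x : phi =1 phi' -> edge b s phi x = edge b s phi' x.
Proof. by move=> e; apply: eq_bigr => v _; rewrite e. Qed.

Lemma eq_foldr_edge b phi phi' ss x :
  phi =1 phi' -> foldr (edge b) phi ss x = foldr (edge b) phi' ss x.
Proof. by move=> e; elim: ss x => [|s ss IH] x //=; apply: eq_edge. Qed.

(** Mod 2, [edge b s] is the commutator of [sweep b] with the multiplication by [s]. In this form a
    coboundary factor can be shifted to either end of a walk. *)
Lemma edgeE b s phi x :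
  edge b s phi x = s x * sweep b phi x + sweep b (fun y => s y * phi y) x.
Proof.
rewrite /edge /sweep mulr_sumr -big_split /=.
by apply: eq_bigr => v _; rewrite mulrDl.
Qed.

Lemma sweepD b phi phi' x :
  sweep b (fun y => phi y + phi' y) x = sweep b phi x + sweep b phi' x.
Proof. by rewrite /sweep big_split. Qed.

Lemma edgeD b s phi phi' x :
  edge b s (fun y => phi y + phi' y) x = edge b s phi x + edge b s phi' x.
Proof. by rewrite /edge -big_split; apply: eq_bigr => v _; rewrite mulrDr. Qed.

Lemma edge_sum (I : finType) (P : pred I) b s (F : I -> (C -> nat) -> bool) x :
  edge b s (fun y => \sum_(i | P i) F i y) x = \sum_(i | P i) edge b s (F i) x.
Proof.
rewrite /edge exchange_big /=; apply: eq_bigr => v _.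
by rewrite mulr_sumr.
Qed.

Lemma foldr_edgeD b phi phi' ss x :
  foldr (edge b) (fun y => phi y + phi' y) ss x =
  foldr (edge b) phi ss x + foldr (edge b) phi' ss x.
Proof. by elim: ss x => //= s ss IH x; rewrite -edgeD; apply: eq_edge. Qed.

Lemma foldr_edge_sum (I : finType) (F : I -> (C -> nat) -> bool) b ss x :
  foldr (edge b) (fun y => \sum_i F i y) ss x = \sum_i foldr (edge b) (F i) ss x.
Proof. by elim: ss x => //= s ss IH x; rewrite -edge_sum; apply: eq_edge. Qed.

Section Odd.
Variables (b : C -> nat) (b_odd : forall v, odd (b v)).

(** Moving [v] and then [w], or [w] and then [v], leads to the same vertex, so the terms cancel in
    pairs. A moved coordinate is odd by [b_odd] and cannot move again. *)
Lemma sweep_sweep phi x : sweep b (sweep b phi) x = 0.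
Proof.
rewrite /sweep big_mkcond /=.
under eq_bigr => v _ do rewrite big_mkcond /=.
rewrite (eq_bigr (fun v => \sum_w
   if [&& v != w, ~~ odd (x v) & ~~ odd (x w)]
   then phi (upd (upd x v (b v)) w (b w)) else 0)) => [|v _]; last first.
  case: ifP => xv; last by rewrite big1 // => w _; rewrite andbF.
  apply: eq_bigr => w _; rewrite {1}/upd eq_sym.
  by case: eqVneq => //= _; rewrite b_odd.
apply: sum_symmetric0 => [v w|v]; last by rewrite eqxx.
rewrite eq_sym [X in _ && X]andbC; case: eqVneq => //= vw; case: ifP => // _.
congr phi; apply/funext => u; rewrite /upd.
case: (eqVneq u v) => [uv|//]; case: (eqVneq u w) => [uw|//].
by move: vw; rewrite -uv -uw eqxx.
Qed.

Lemma sweep_edge s phi x : sweep b (edge b s phi) x = edge b s (sweep b phi) x.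
Proof.
rewrite edgeE sweep_sweep mulr0 add0r (eq_sweep _ _ (edgeE b s phi)) sweepD.
by rewrite sweep_sweep addr0.
Qed.

Lemma sweep_foldr_edge ss phi x :
  sweep b (foldr (edge b) phi ss) x = foldr (edge b) (sweep b phi) ss x.
Proof.
elim: ss x => //= s ss IH x; rewrite sweep_edge.
exact: eq_edge.
Qed.

Definition edge_off v s phi x : bool :=
  \sum_(w | ~~ odd (x w) && (w != v))
    (s x + s (upd x w (b w))) * phi (upd x w (b w)).

(** When [phi] vanishes as soon as [v] has moved, only paths inside the even face of the cell across
    [v] survive, and the value no longer involves [b v]. *)
Lemma foldr_edge_off v phi phi' ss x :
  (forall y, phi y = if odd (y v) then 0 else phi' y) ->
  foldr (edge b) phi ss x =
  if odd (x v) then 0 else foldr (edge_off v) phi' ss x.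
Proof.
move=> phiE; elim: ss x => [|s ss IH] x /=.
  exact: phiE.
case: ifP => xv.
  rewrite /edge big1 // => w xw; rewrite IH.
  have -> : odd (upd x w (b w) v) by rewrite /upd; case: eqP => [<-|].
  by rewrite mulr0.
have updv : odd (upd x v (b v) v) by rewrite /upd eqxx b_odd.
rewrite /edge (bigD1 v) ?xv //= IH updv mulr0 add0r.
apply: eq_bigr => w /andP[_ wv]; rewrite IH.
by have /negbTE-> : ~~ odd (upd x w (b w) v) by rewrite /upd eq_sym (negPf wv) xv.
Qed.

End Odd.

Lemma eq_edge_off b b' v phi phi' ss x :
  (forall u, u != v -> b u = b' u) -> phi =1 phi' ->
  foldr (edge_off b v) phi ss x = foldr (edge_off b' v) phi' ss x.
Proof.
move=> bb' phi_eq; elim: ss x => //= s ss IH x.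
by apply: eq_bigr => w /andP[_ wv]; rewrite bb' // IH.
Qed.

Lemma sum_cells0 L v (F : {ffun C -> 'I_L * bool} -> bool)
    (f : {ffun C -> 'I_L * bool} -> {ffun C -> 'I_L * bool}) :
  involutive f -> (forall c, (f c v).2 = ~~ (c v).2) ->
  (forall c, F (f c) = F c) -> \sum_c F c = 0.
Proof.
move=> fK fv Ff; pose d (c : {ffun C -> 'I_L * bool}) := (c v).2.
rewrite (bigID d) /= [X in _ + X](reindex_inj (inv_inj fK)) /=.
rewrite [X in _ + X](_ : _ = \sum_(c | d c) F c) ?addbb0 //.
by apply: eq_big => c *; rewrite ?Ff // /d fv negbK.
Qed.

End Grid.

(** * Glued faces and Stokes' formula mod 2 *)

Section Gluing.
Variables (O : gluing) (L : nat).
Implicit Types (x b : O -> nat) (s t phi : (O -> nat) -> bool).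

Definition flip v x : O -> nat := fun u =>
  if u == v then L.*2 else if refl v u then (L.*2 - x u)%N else x u.

(* s jumps by [e v] across the face v, so that its coboundary descends to the quotient. *)
Definition character s (e : pred O) :=
  forall v x, vertex L x -> x v = 0%N -> s (flip v x) = s x + e v.

Definition has_character s := exists e, character s e.

(** The reflection [y -> 2L - y] keeps parity, so that it maps paths of a cell to paths of the
    reflected cell. *)
Lemma odd_flip v x u : vertex L x -> u != v -> odd (flip v x u) = odd (x u).
Proof.
move=> xL uv; rewrite /flip (negPf uv); case: ifP => // _.
by rewrite oddB // odd_double.
Qed.

Lemma flip_upd v x u y : u != v ->
  flip v (upd x u y) = upd (flip v x) u (if refl v u then L.*2 - y else y)%N.
Proof.
move=> uv; apply/funext => w; rewrite /flip /upd; case: (eqVneq w u) => // ->.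
by rewrite (negPf uv).
Qed.

Lemma edge_off_flip b v phi phi' ss x :
  vertex L b -> (forall y, vertex L y -> y v = 0%N -> phi' (flip v y) = phi y) ->
  (forall s, List.In s ss -> has_character s) -> vertex L x -> x v = 0%N ->
  foldr (edge_off (flip v b) v) phi' ss (flip v x) = foldr (edge_off b v) phi ss x.
Proof.
move=> bL phi_eq; elim: ss x => [|s ss IH] x ss_char xL xv /=; first exact: phi_eq.
apply: eq_big => [w|w /andP[_ wv]].
  by case: eqVneq; rewrite ?andbF // !andbT => wv; rewrite odd_flip.
have [e se] := ss_char s (or_introl erefl).
have updL : vertex L (upd x w (b w)) by move=> u; rewrite /upd; case: ifP.
have updv : upd x w (b w) v = 0%N by rewrite /upd eq_sym (negPf wv).
rewrite -(_ : flip v (upd x w (b w)) = upd (flip v x) w (flip v b w)); last first.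
  by rewrite flip_upd // /flip (negPf wv).
rewrite IH // => [|s' s'ss]; last by apply: ss_char; right.
rewrite !se //; congr (_ * _).
by rewrite addrACA addbb0 addr0.
Qed.

Definition toggle v (c : {ffun O -> 'I_L * bool}) : {ffun O -> 'I_L * bool} :=
  [ffun u => if u == v then ((c u).1, ~~ (c u).2) else c u].

(** The neighbour beyond the even end of an interval: [(i, true)] and [(i + 1, false)] share the
    vertex [2i + 2]. Since [ordS] and [ord_pred] are cyclic, the ends [0] and [2L] also become
    neighbours; [glue] adds the reflections of the other coordinates in that case. *)
Definition jump (p : 'I_L * bool) : 'I_L * bool :=
  if p.2 then (ordS p.1, false) else (ord_pred p.1, true).

Definition wraps (p : 'I_L * bool) :=
  if p.2 then p.1.+1 == L else nat_of_ord p.1 == 0%N.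

Definition glue v (c : {ffun O -> 'I_L * bool}) : {ffun O -> 'I_L * bool} :=
  [ffun u => if u == v then jump (c u)
             else if wraps (c v) && refl v u then (rev_ord (c u).1, ~~ (c u).2)
             else c u].

Lemma toggleK v : involutive (toggle v).
Proof.
by move=> c; apply/ffunP => u; rewrite !ffunE; case: eqVneq => //= _; rewrite negbK; case: (c u).
Qed.

Lemma jumpK : involutive jump.
Proof. by case=> i [] /=; rewrite /jump /= ?ordSK ?ord_predK. Qed.

Lemma wraps_jump p : wraps (jump p) = wraps p.
Proof.
case: p => [[i iL]] []; rewrite /jump /wraps /=.
  case: (ltngtP i.+1 L) iL => // [iL _|e _]; first by rewrite modn_small.
  by rewrite e modnn.
case: i iL => [|i] iL /=; first by rewrite modn_small ?prednK ?eqxx.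
by rewrite modnDr modn_small 1?ltnW //; apply/negbTE; rewrite neq_ltn iL.
Qed.

Lemma glueK v : involutive (glue v).
Proof.
move=> c; apply/ffunP => u; rewrite !ffunE eqxx wraps_jump.
case: eqVneq => [->|uv]; first by rewrite jumpK.
case: (wraps (c v) && refl v u) => //=.
by rewrite (rev_ordK (c u).1) negbK; case: (c u).
Qed.

Lemma even_end_vertex (c : {ffun O -> 'I_L * bool}) : vertex L (even_end c).
Proof.
move=> v; rewrite /even_end leq_double.
by case: (c v) => [[i iL] []] /=; rewrite ?addn1 ?addn0 // ltnW.
Qed.

Lemma odd_end_vertex (c : {ffun O -> 'I_L * bool}) : vertex L (odd_end c).
Proof. by move=> v; rewrite /odd_end ltn_double. Qed.

Lemma ends_glue v (c : {ffun O -> 'I_L * bool}) : wraps (c v) -> ~~ (c v).2 ->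
  [/\ even_end c v = 0%N, even_end (glue v c) = flip v (even_end c) &
      forall u, u != v -> odd_end (glue v c) u = flip v (odd_end c) u].
Proof.
move=> wv dv.
have cv0 : c v = (Ordinal (leq_ltn_trans (leq0n _) (ltn_ord (c v).1)), false).
  by move: wv dv; rewrite /wraps; case: (c v) => [i []] //= /eqP i0 _; congr (_, _); exact: val_inj.
split.
- by rewrite /even_end cv0.
- apply/funext => u; rewrite /even_end /flip !ffunE wv /=.
  case: (eqVneq u v) => [->|uv].
    rewrite cv0 /jump /= modn_small ?addn1 ?prednK //; have := ltn_ord (c v).1; lia.
  case: ifP => // _; case: (c u) => [[i iL] d] /=; case: d => /=; lia.
- move=> u uv; rewrite /odd_end /flip !ffunE wv (negPf uv) /=.
  case: ifP => // _; case: (c u) => [[i iL] d] /=; lia.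
Qed.

Lemma ends_glue_inner v (c : {ffun O -> 'I_L * bool}) : ~~ wraps (c v) ->
  even_end (glue v c) = even_end c /\
  forall u, u != v -> odd_end (glue v c) u = odd_end c u.
Proof.
move=> wv; split=> [|u uv]; last by rewrite /odd_end ffunE (negPf uv) (negPf wv).
apply/funext => u; rewrite /even_end ffunE (negPf wv) /=.
case: eqVneq => // ->; move: wv; rewrite /wraps /jump.
case: (c v) => [[i iL] []] /= iN.
  rewrite modn_small; lia.
rewrite -[X in (X %% _)%N]/(i + L).-1 (_ : (i + L).-1 = i.-1 + L)%N; last by lia.
rewrite modnDr modn_small; lia.
Qed.

(** By [edgeE] the factor of [t] splits into two terms with a [sweep]. Pushed to the end of the
    walk, the sweep singles out a coordinate that never moves; pulled to the front, it moves a
    coordinate at once. The first kind of term depends only on an even face of the cell and the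
    second only on an odd face, and every face belongs to two cells, thanks to the gluing. *)
Lemma cup_coboundary ss1 t ss2 :
  (forall s, List.In s (ss1 ++ ss2) -> has_character s) -> character t pred0 ->
  cup L (ss1 ++ t :: ss2) = 0.
Proof.
move=> ss_char t_char.
(* In [K] the function [t] acts as a weight at its position in the walk, without an edge. *)
pose K b phi := foldr (edge b) (fun y => t y * foldr (edge b) phi ss2 y) ss1.
have walkE (c : {ffun O -> 'I_L * bool}) x : walk (odd_end c) (ss1 ++ t :: ss2) x =
    \sum_v K (odd_end c) (fun y => ~~ odd (y v)) x +
    \sum_(v | ~~ odd (x v)) K (odd_end c) (fun=> 1) (upd x v (odd_end c v)).
  have odd_b v : odd (odd_end c v) by rewrite /odd_end /= odd_double.
  rewrite /walk foldr_cat /= (eq_foldr_edge _ _ _ (edgeE _ _ _)) foldr_edgeD.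
  congr (_ + _); last by rewrite -(sweep_foldr_edge odd_b).
  rewrite /K -foldr_edge_sum; apply: eq_foldr_edge => y.
  rewrite (sweep_foldr_edge odd_b) -mulr_sumr -foldr_edge_sum; congr (_ * _).
  apply: eq_foldr_edge => z; rewrite /sweep big_mkcond; apply: eq_bigr => v _.
  by case: odd.
have K_off v (c : {ffun O -> 'I_L * bool}) x :
    K (odd_end c) (fun y => ~~ odd (y v)) x =
    if odd (x v) then 0 else foldr (edge_off (odd_end c) v) (fun y =>
      t y * if odd (y v) then 0 else foldr (edge_off (odd_end c) v) (fun=> 1) ss2 y) ss1 x.
  have odd_b u : odd (odd_end c u) by rewrite /odd_end /= odd_double.
  apply: foldr_edge_off => // y.
  rewrite (foldr_edge_off odd_b (v := v) (phi' := fun=> 1)) => [|z]; last by case: ifP.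
  by case: ifP; rewrite ?mulr0.
have K_wrap v (c : {ffun O -> 'I_L * bool}) : wraps (c v) -> ~~ (c v).2 ->
    K (odd_end (glue v c)) (fun y => ~~ odd (y v)) (even_end (glue v c)) =
    K (odd_end c) (fun y => ~~ odd (y v)) (even_end c).
  move=> wv dv; have [av -> bE] := ends_glue wv dv.
  rewrite !K_off av [flip v _ v]/flip eqxx odd_double /=.
  rewrite (eq_edge_off (b' := flip v (odd_end c)) (phi' := fun y =>
      t y * if odd (y v) then 0 else foldr (edge_off (flip v (odd_end c)) v) (fun=> 1) ss2 y)) //.
    apply: edge_off_flip => //.
    - exact: odd_end_vertex.
    - move=> y yL yv; rewrite t_char // addr0 yv [flip v _ v]/flip eqxx odd_double /=.
      congr (_ * _); apply: edge_off_flip => //; first exact: odd_end_vertex.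
      by move=> s ss; apply: ss_char; apply: List.in_or_app; right.
    - by move=> s ss; apply: ss_char; apply: List.in_or_app; left.
    - exact: even_end_vertex.
  by move=> y; congr (_ * _); case: ifP => // _; apply: eq_edge_off.
have K_glue v (c : {ffun O -> 'I_L * bool}) :
    K (odd_end (glue v c)) (fun y => ~~ odd (y v)) (even_end (glue v c)) =
    K (odd_end c) (fun y => ~~ odd (y v)) (even_end c).
  have [wv|wv] := boolP (wraps (c v)).
    have [dv|dv] := boolP (c v).2; last exact: K_wrap.
    have := K_wrap v (glue v c); rewrite glueK ffunE eqxx wraps_jump => H.
    by symmetry; apply: H; rewrite // /jump dv.
  have [-> bE] := ends_glue_inner wv; rewrite !K_off; case: ifP => // _.
  by apply: eq_edge_off => // y; congr (_ * _); case: ifP => // _; exact: eq_edge_off.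
rewrite /cup (eq_bigr _ (fun c _ => walkE c _)) big_split /=.
(* For a coordinate [v] that stays in place, [glue v] pairs the two cells that share the even face
   across [v]. *)
rewrite [X in X + _]exchange_big /= [X in X + _]big1 ?add0r; last first.
  move=> v _; apply: (@sum_cells0 _ _ v _ (glue v) (glueK v)) => c.
    by rewrite ffunE eqxx /jump; case: ifP.
  exact: K_glue.
under eq_bigr do rewrite big_mkcond /=.
rewrite exchange_big big1 //= => v _.
(* [toggle v] changes only the even end in the coordinate [v], which these terms have already
   left. *)
apply: (@sum_cells0 _ _ v _ (toggle v) (toggleK v)) => c.
  by rewrite ffunE eqxx.
have -> : odd_end (toggle v c) = odd_end c.
  by apply/funext => u; rewrite /odd_end ffunE; case: ifP.
rewrite /even_end !odd_double /=; congr (K _ _ _); apply/funext => u.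
by rewrite /upd; case: eqVneq => // uv; rewrite ffunE (negPf uv).
Qed.

Lemma walk_cat1D b ss1 s t ss2 x :
  walk b (ss1 ++ (fun y => s y + t y) :: ss2) x =
  walk b (ss1 ++ s :: ss2) x + walk b (ss1 ++ t :: ss2) x.
Proof.
rewrite /walk !foldr_cat -foldr_edgeD; apply: eq_foldr_edge => y /=.
rewrite /edge -big_split; apply: eq_bigr => v _ /=; rewrite -mulrDl.
by congr (_ * _); rewrite addrACA.
Qed.

Lemma cup_cat1 ss1 s s' e ss2 :
  (forall r, List.In r (ss1 ++ ss2) -> has_character r) ->
  character s e -> character s' e -> cup L (ss1 ++ s :: ss2) = cup L (ss1 ++ s' :: ss2).
Proof.
move=> ss_char se s'e; apply/eqP; rewrite -subr_eq0 oppr_char2 //; apply/eqP.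
rewrite /cup -big_split -[RHS](@cup_coboundary ss1 (fun y => s y + s' y) ss2) //.
  by apply: eq_bigr => c _; rewrite walk_cat1D.
by move=> v x xL xv; rewrite se // s'e // addrACA addbb0 addr0.
Qed.

(** Two functions with the same jumps differ by one without jumps, so [cup_coboundary] allows
    exchanging the factors one by one; [pre] collects those already exchanged. *)
Lemma cup_character (e : pred O) ss ss' :
  (forall s, List.In s ss -> character s e) ->
  (forall s, List.In s ss' -> character s e) -> size ss = size ss' ->
  cup L ss = cup L ss'.
Proof.
suff H pre : (forall s, List.In s pre -> character s e) ->
  (forall s, List.In s ss -> character s e) ->
  (forall s, List.In s ss' -> character s e) -> size ss = size ss' ->
  cup L (pre ++ ss) = cup L (pre ++ ss') by exact: (H [::]).
elim: ss ss' pre => [|s ss IH] [|s' ss'] pre //= pe se s'e [sz].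
have allE r : List.In r (pre ++ ss) -> has_character r.
  move=> /(@List.in_app_or _ _ _ _)[] rr; exists e; first exact: pe.
  by apply: se; right.
rewrite (cup_cat1 (e := e) (s' := s')) //; [|by apply: se; left|by apply: s'e; left].
rewrite -!cat_rcons; apply: IH => // r.
- by rewrite -cats1 => /(@List.in_app_or _ _ _ _)[/pe //|[<-|//]]; apply: s'e; left.
- by move=> ?; apply: se; right.
- by move=> ?; apply: s'e; right.
Qed.

(** This is all that Borsuk-Ulam takes from a nonzero product: a nonzero path term uses each factor
    on some edge of the cell, where that factor must change. *)
Lemma walk_neq0 b ss x : walk b ss x ->
  forall s, List.In s ss -> exists y z, [/\ s y != s z,
    forall u, y u \in [:: x u; b u] & forall u, z u \in [:: x u; b u]].
Proof.
elim: ss x => [//|s ss IH] x /= W r.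
have [v xv] : exists v, ~~ odd (x v) && (s x + s (upd x v (b v))) && walk b ss (upd x v (b v)).
  apply/existsP; apply: contraT => /existsPn H; move: W.
  rewrite /edge big1 // => v xv; apply/negbTE; move: (H v); rewrite xv /=.
  by case: (s x + _).
case/andP: xv => /andP[xv sx] W'.
have up u : upd x v (b v) u \in [:: x u; b u].
  by rewrite /upd !inE; case: (eqVneq u v) => [->|_]; rewrite eqxx ?orbT.
case=> [<-|rss].
  exists x, (upd x v (b v)); split=> // [|u]; last by rewrite mem_head.
  by move: sx; case: (s x); case: (s _).
have [y [z [yz yu zu]]] := IH _ W' r rss.
have upb u : upd x v (b v) u = x u \/ upd x v (b v) u = b u.
  by have := up u; rewrite !inE => /orP[]/eqP; [left|right].
exists y, z; split=> // u.
  by have := yu u; case: (upb u) => -> //; rewrite !inE orbb => ->; rewrite orbT.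
by have := zu u; case: (upb u) => -> //; rewrite !inE orbb => ->; rewrite orbT.
Qed.

End Gluing.

(** * Top powers of w_1 on products *)

Definition evens (C : finType) (x : C -> nat) := #|[pred v | ~~ odd (x v)]|.

Lemma evens_upd (C : finType) (x : C -> nat) v y :
  ~~ odd (x v) -> odd y -> evens x = (evens (upd x v y)).+1.
Proof.
move=> xv yo; rewrite /evens (cardD1 v) inE xv add1n; congr _.+1.
apply: eq_card => u; rewrite !inE /upd; case: eqVneq => //= _.
by rewrite yo.
Qed.

Lemma evens_gt0 (C : finType) (x : C -> nat) v : ~~ odd (x v) -> (0 < evens x)%N.
Proof. by move=> xv; apply/card_gt0P; exists v; rewrite inE. Qed.

Lemma evens_even_end (C : finType) L (c : {ffun C -> 'I_L * bool}) :
  evens (even_end c) = #|C|.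
Proof. by apply: eq_card => v; rewrite !inE /even_end odd_double. Qed.

Section SumCoords.
Variables (A B : finType).
Implicit Types (x b : A + B -> nat).

Lemma upd_inl_l x v y : upd x (inl v) y \o inl = upd (x \o inl) v y.
Proof. by apply/funext => u; rewrite /upd /= (inj_eq inl_inj). Qed.
Lemma upd_inl_r x v y : upd x (inl v) y \o inr = x \o inr.
Proof. by apply/funext => u; rewrite /upd. Qed.
Lemma upd_inr_r x v y : upd x (inr v) y \o inr = upd (x \o inr) v y.
Proof. by apply/funext => u; rewrite /upd /= (inj_eq inr_inj). Qed.
Lemma upd_inr_l x v y : upd x (inr v) y \o inl = x \o inl.
Proof. by apply/funext => u; rewrite /upd. Qed.

Definition join_cells T (c : {ffun A -> T}) (d : {ffun B -> T}) : {ffun A + B -> T} :=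
  [ffun v => match v with inl a => c a | inr b => d b end].

Lemma big_cells_sum (T : finType) (F : {ffun A + B -> T} -> bool) :
  \sum_c F c = \sum_c \sum_d F (join_cells c d).
Proof.
rewrite pair_big /= (reindex (fun p => join_cells p.1 p.2)) //.
exists (fun c : {ffun A + B -> T} => ([ffun a => c (inl a)], [ffun b => c (inr b)])) => [[c d]|c] _ /=.
  by congr (_, _); apply/ffunP => a; rewrite !ffunE.
by apply/ffunP => -[a|b]; rewrite !ffunE.
Qed.

Lemma even_end_join_l L (c : {ffun A -> 'I_L * bool}) (d : {ffun B -> 'I_L * bool}) :
  even_end (join_cells c d) \o inl = even_end c.
Proof. by apply/funext => a; rewrite /even_end /= ffunE. Qed.
Lemma even_end_join_r L (c : {ffun A -> 'I_L * bool}) (d : {ffun B -> 'I_L * bool}) :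
  even_end (join_cells c d) \o inr = even_end d.
Proof. by apply/funext => a; rewrite /even_end /= ffunE. Qed.
Lemma odd_end_join_l L (c : {ffun A -> 'I_L * bool}) (d : {ffun B -> 'I_L * bool}) :
  odd_end (join_cells c d) \o inl = odd_end c.
Proof. by apply/funext => a; rewrite /odd_end /= ffunE. Qed.
Lemma odd_end_join_r L (c : {ffun A -> 'I_L * bool}) (d : {ffun B -> 'I_L * bool}) :
  odd_end (join_cells c d) \o inr = odd_end d.
Proof. by apply/funext => a; rewrite /odd_end /= ffunE. Qed.

Lemma edge_sumType b s phi x : edge b s phi x =
  \sum_(v | ~~ odd (x (inl v))) (s x + s (upd x (inl v) (b (inl v)))) *
    phi (upd x (inl v) (b (inl v))) +
  \sum_(v | ~~ odd (x (inr v))) (s x + s (upd x (inr v) (b (inr v)))) *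
    phi (upd x (inr v) (b (inr v))).
Proof. exact: big_sumType. Qed.

(** A path in a product of cells is a shuffle of two paths. Steps in [A] see only [s1], steps in [B]
    only [s2], so all [C(e1 + e2, e1)] shuffles of a given pair contribute the same value. *)
Lemma walk_sumD b (s1 : (A -> nat) -> bool) (s2 : (B -> nat) -> bool) x e1 e2 :
  (forall v, odd (b v)) -> evens (x \o inl) = e1 -> evens (x \o inr) = e2 ->
  walk b (nseq (e1 + e2) (fun y => s1 (y \o inl) + s2 (y \o inr))) x
  = odd 'C(e1 + e2, e1) * (walk (b \o inl) (nseq e1 s1) (x \o inl) *
                           walk (b \o inr) (nseq e2 s2) (x \o inr)).
Proof.
move=> b_odd; set s := (fun y => _).
move En : (e1 + e2)%N => n; elim: n x e1 e2 En => [|n IH] x e1 e2 En xe1 xe2.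
  by move/eqP: En; rewrite addn_eq0 => /andP[/eqP-> /eqP->]; rewrite bin0.
rewrite -[LHS]/(edge b s (walk b (nseq n s)) x) edge_sumType.
have left_part p : e1 = p.+1 ->
    \sum_(v | ~~ odd (x (inl v))) (s x + s (upd x (inl v) (b (inl v)))) *
      walk b (nseq n s) (upd x (inl v) (b (inl v))) =
    odd 'C(n, p) * (walk (b \o inl) (nseq e1 s1) (x \o inl) *
                    walk (b \o inr) (nseq e2 s2) (x \o inr)).
  move=> e1p; rewrite e1p /= /edge mulr_suml mulr_sumr; apply: eq_bigr => v xv.
  have e := @evens_upd _ (x \o inl) v _ xv (b_odd (inl v)).
  rewrite (IH _ p e2) ?upd_inl_l ?upd_inl_r //; try lia.
  rewrite /s upd_inl_l upd_inl_r addrACA addbb0 addr0 mulrCA; congr (_ * _).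
  exact: mulrA.
have right_part p : e2 = p.+1 ->
    \sum_(v | ~~ odd (x (inr v))) (s x + s (upd x (inr v) (b (inr v)))) *
      walk b (nseq n s) (upd x (inr v) (b (inr v))) =
    odd 'C(n, e1) * (walk (b \o inl) (nseq e1 s1) (x \o inl) *
                     walk (b \o inr) (nseq e2 s2) (x \o inr)).
  move=> e2p; rewrite e2p /= /edge !mulr_sumr; apply: eq_bigr => v xv.
  have e := @evens_upd _ (x \o inr) v _ xv (b_odd (inr v)).
  rewrite (IH _ e1 p) ?upd_inr_l ?upd_inr_r //; try lia.
  rewrite /s upd_inr_l upd_inr_r addrACA addbb0 add0r mulrCA; congr (_ * _).
  by rewrite mulrCA.
have no_left : e1 = 0%N -> \sum_(v | ~~ odd (x (inl v))) (s x + s (upd x (inl v) (b (inl v)))) *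
      walk b (nseq n s) (upd x (inl v) (b (inl v))) = 0.
  by move=> e10; rewrite big1 // => v xv; have := @evens_gt0 _ (x \o inl) v xv; rewrite xe1 e10.
have no_right : e2 = 0%N -> \sum_(v | ~~ odd (x (inr v))) (s x + s (upd x (inr v) (b (inr v)))) *
      walk b (nseq n s) (upd x (inr v) (b (inr v))) = 0.
  by move=> e20; rewrite big1 // => v xv; have := @evens_gt0 _ (x \o inr) v xv; rewrite xe2 e20.
case: e1 En xe1 left_part right_part no_left => [|p] En xe1 left_part right_part no_left.
  by rewrite no_left // add0r (right_part n) // !bin0.
rewrite (left_part p) //; case: e2 En xe2 {IH left_part} right_part no_right => [|q] En xe2 right_part no_right.
  by rewrite no_right // addr0; move: En; rewrite addn0 => -[->]; rewrite !binn.
by rewrite (right_part q) // -mulrDl binS oddD addrC.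
Qed.

End SumCoords.

(* The top power of w_1 of the double cover [sgn] is nonzero. *)
Definition good (O : gluing) := forall K, (0 < K)%N ->
  exists2 s, character K.*2 s (@sgn O) & cup K.*2 (nseq #|O| s).

Definition leaf := @Gluing void (fun _ _ => false) (fun _ => false).

Definition tensor (O1 O2 : gluing) := @Gluing (O1 + O2)%type
  (fun v u => match v, u with
    | inl v, inl u | inr v, inr u => refl v u
    | _, _ => false end)
  (fun v => match v with inl v | inr v => sgn v end).

(* The projectivized join of the double covers of O1 and O2, whose points are
   (cos t u, sin t w), with nothing collapsed where cos t = 0 or sin t = 0. *)
Definition node (O1 O2 : gluing) := @Gluing (unit + (O1 + O2))%type
  (fun v u => match v, u with
    | inr (inl v), inl _ | inr (inr v), inl _ => sgn v
    | inr (inl v), inr (inl u) | inr (inr v), inr (inr u) => refl v u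
    | _, _ => false end)
  (fun v => match v with
    | inl _ => true | inr (inl _) => false | inr (inr v) => sgn v end).

Lemma good_leaf : good leaf.
Proof.
move=> K K0; exists (fun _ => 0) => [[]|] //; rewrite card_void /cup /=.
rewrite (big_pred1 [ffun v : void => match v with end]) // => c.
by apply/esym/eqP/ffunP; case.
Qed.

Lemma In_cat T (s t : seq T) y : List.In y (s ++ t) -> List.In y s \/ List.In y t.
Proof. by elim: s => [|x s IH] /=; [right|case=> [->|/IH[]]; auto]. Qed.

Lemma In_nseq T n (x y : T) : List.In y (nseq n x) -> y = x.
Proof. by elim: n => //= n IH [->|]. Qed.

Lemma flip_tensor (O1 O2 : gluing) L (v : tensor O1 O2) (x : O1 + O2 -> nat) :
  @flip (tensor O1 O2) L v x \o inl = (if v is inl v then flip L v (x \o inl) else x \o inl) /\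
  @flip (tensor O1 O2) L v x \o inr = (if v is inr v then flip L v (x \o inr) else x \o inr).
Proof. by case: v => v; split; apply/funext => u; rewrite /flip /=. Qed.

Lemma good_tensor (O1 O2 : gluing) : odd 'C(#|O1| + #|O2|, #|O1|) ->
  good O1 -> good O2 -> good (tensor O1 O2).
Proof.
move=> oddC g1 g2 K K0; have [s1 s1c I1] := g1 K K0; have [s2 s2c I2] := g2 K K0.
exists (fun y => s1 (y \o inl) + s2 (y \o inr)).
  move=> v x xL xv; have [-> ->] := flip_tensor K.*2 v x.
  case: v xv => v xv; first by rewrite s1c // => [|u]; rewrite 1?addrAC //; exact: xL.
  by rewrite s2c // => [|u]; rewrite 1?addrA //; exact: xL.
rewrite /cup card_sum big_cells_sum /=.
rewrite (eq_bigr (fun c => walk (odd_end c) (nseq #|O1| s1) (even_end c) * cup K.*2 (nseq #|O2| s2))).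
  by rewrite -mulr_suml -/(cup K.*2 (nseq #|O1| s1)) I1 I2.
move=> c _; rewrite /cup mulr_sumr; apply: eq_bigr => d _.
rewrite walk_sumD ?even_end_join_l ?even_end_join_r ?evens_even_end //; last first.
  by move=> v; rewrite /odd_end /= odd_double.
by rewrite oddC mul1r odd_end_join_l odd_end_join_r.
Qed.

(** * Top powers of w_1 on joins *)

Section Node.
Variables (O1 O2 : gluing) (K : nat).
Variables (s1 : (O1 -> nat) -> bool) (s2 : (O2 -> nat) -> bool).
Local Notation O := (unit + (O1 + O2))%type.
Implicit Types (x b : O -> nat).

Definition root x := x (inl tt).
Definition left x := (x \o inr) \o inl.
Definition right x := (x \o inr) \o inr.

(* signs of (cos t * u, sin t * w) with ties broken in favour of the first,
   resp. the second, block *)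
Definition cos_sign x := if (root x < K.*2)%N then s1 (left x)
  else if root x == K.*2 then s2 (right x) else 1 + s1 (left x).
Definition sin_sign x := if root x == 0%N then s1 (left x)
  else if (root x < K.*2.*2)%N then s2 (right x) else 1 + s1 (left x).

Lemma root_upd x v y : root (upd x v y) = if v is inl _ then y else root x.
Proof. by case: v => [[]|[]]. Qed.
Lemma left_upd x v y : left (upd x v y) = if v is inr (inl v) then upd (left x) v y else left x.
Proof. by case: v => [[]|[v|v]] //; apply/funext. Qed.
Lemma right_upd x v y : right (upd x v y) = if v is inr (inr v) then upd (right x) v y else right x.
Proof. by case: v => [[]|[v|v]] //; apply/funext. Qed.

Lemma edge_node b s phi x : edge b s phi x =
  (if odd (root x) then 0 else
     (s x + s (upd x (inl tt) (root b))) * phi (upd x (inl tt) (root b))) +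
  (\sum_(v | ~~ odd (left x v)) (s x + s (upd x (inr (inl v)) (left b v))) *
     phi (upd x (inr (inl v)) (left b v)) +
   \sum_(v | ~~ odd (right x v)) (s x + s (upd x (inr (inr v)) (right b v))) *
     phi (upd x (inr (inr v)) (right b v))).
Proof.
rewrite /edge big_sumType big_sumType /=; congr (_ + _).
rewrite big_mkcond (big_pred1 tt) /=; last by case.
by rewrite /root; case: odd.
Qed.

Section Steps.
Variables (b : O -> nat) (b_odd : forall v, odd (b v)).
Let rb_odd : odd (root b). Proof. exact: b_odd. Qed.
Let lb_odd v : odd (left b v). Proof. exact: b_odd. Qed.
Let rtb_odd v : odd (right b v). Proof. exact: b_odd. Qed.

Definition off_cos x :=
  ((root x < K.*2) && (root b < K.*2) || (K.*2 < root x) && (K.*2 < root b))%N.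

(** On one side of the wall [cos t = 0], [cos_sign] is [s1] up to a constant. Each of the [m]
    factors then has to use up a left coordinate, and there are fewer than [m] of them. *)
Lemma walk_off_cos ss m x : off_cos x -> (evens (left x) < m)%N ->
  walk b (nseq m cos_sign ++ ss) x = 0.
Proof.
have cos_off y : off_cos y -> cos_sign y = s1 (left y) + (K.*2 < root b)%N.
  rewrite /cos_sign; case/orP => /andP[y1 y2].
    by rewrite y1 ltnNge ltnW // addr0.
  by rewrite ltnNge ltnW //= gtn_eqF // y2 addrC.
elim: m x => // m IH x xo xm.
rewrite -[LHS]/(edge b cos_sign (walk b (nseq m cos_sign ++ ss)) x) edge_node.
rewrite [X in X + _](_ : _ = 0) ?add0r; last first.
  case: ifP => // _; rewrite !cos_off ?left_upd ?addbb0 ?mul0r //.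
  by move: xo; rewrite /off_cos root_upd; case/orP => /andP[_ ->]; rewrite ?orbT.
rewrite [X in X + _]big1 ?add0r => [|v xv]; last first.
  rewrite IH ?mulr0 //.
  by rewrite left_upd -ltnS (leq_trans _ xm) // (evens_upd xv (lb_odd v)).
rewrite big1 // => v xv; rewrite !cos_off ?left_upd ?addbb0 ?mul0r //.
Qed.

(** Strictly between the two ends of the root interval [sin_sign] depends on the right coordinates
    only, and the factors in [pre] can only reduce the number of those still to be moved. *)
Lemma walk_off_sin pre m x : (0 < root x < K.*2.*2)%N -> (0 < root b < K.*2.*2)%N ->
  (evens (right x) < m)%N -> walk b (pre ++ nseq m sin_sign) x = 0.
Proof.
have sin_mid y : (0 < root y < K.*2.*2)%N -> sin_sign y = s2 (right y).
  by case/andP; rewrite /sin_sign; case: (root y) => //= n _ ->.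
elim: pre m x => [|s pre IH] m x xr br xm /=; last first.
  rewrite /edge big1 // => v xv; rewrite IH ?mulr0 //.
    by rewrite root_upd; case: v {xv} => [[]|].
  rewrite right_upd; case: v xv => [//|[//|v xv]].
  by apply: leq_ltn_trans xm; rewrite (@evens_upd _ (right x) v _ xv (rtb_odd v)).
elim: m x xr xm => // m IH x xr xm.
rewrite -[LHS]/(edge b sin_sign (walk b (nseq m sin_sign)) x) edge_node.
rewrite [X in X + _](_ : _ = 0) ?add0r; last first.
  by case: ifP => // _; rewrite !sin_mid ?root_upd // right_upd addbb0 mul0r.
rewrite big1 ?add0r => [|v xv]; last by rewrite !sin_mid ?root_upd // right_upd addbb0 mul0r.
rewrite big1 // => v xv; rewrite IH ?mulr0 ?root_upd //.
by rewrite right_upd -ltnS (leq_trans _ xm) // (evens_upd xv (rtb_odd v)).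
Qed.

Lemma walk_on_sin m x : root x = root b -> (0 < root b < K.*2.*2)%N ->
  walk b (nseq m sin_sign) x = walk (right b) (nseq m s2) (right x).
Proof.
have sin_mid y : (0 < root y < K.*2.*2)%N -> sin_sign y = s2 (right y).
  by case/andP; rewrite /sin_sign; case: (root y) => //= n _ ->.
elim: m x => // m IH x xr br.
rewrite -[LHS]/(edge b sin_sign (walk b (nseq m sin_sign)) x) edge_node.
rewrite xr rb_odd add0r big1 ?add0r => [|v xv]; last first.
  by rewrite !sin_mid ?root_upd ?xr // right_upd addbb0 mul0r.
apply: eq_bigr => v xv; rewrite IH ?root_upd // !sin_mid ?root_upd ?xr //.
Qed.

Lemma walk_on_cos m1 m2 x : root x = root b -> (0 < root b < K.*2.*2)%N ->
  walk b (nseq m1 cos_sign ++ nseq m2 sin_sign) x =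
  walk (left b) (nseq m1 s1) (left x) * walk (right b) (nseq m2 s2) (right x).
Proof.
have rbK : root b != K.*2 by apply: contraTneq rb_odd => ->; rewrite odd_double.
elim: m1 x => [|m IH] x xr br; first by rewrite mul1r walk_on_sin.
rewrite -[LHS]/(edge b cos_sign (walk b (nseq m cos_sign ++ nseq m2 sin_sign)) x) edge_node.
rewrite xr rb_odd add0r [X in _ + X]big1 ?addr0 => [|v xv]; last first.
  rewrite /cos_sign !root_upd !left_upd xr (negPf rbK).
  by case: ifP => _; rewrite addbb0 mul0r.
rewrite /= /edge mulr_suml; apply: eq_bigr => v xv.
rewrite IH ?root_upd // left_upd right_upd /cos_sign !root_upd !left_upd xr (negPf rbK) mulrA.
case: ifP => _ //; do 2!congr (_ * _); rewrite addrACA addbb0 add0r //.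
Qed.

(** Starting on the wall, the first factor has to move the root: a left move does not change
    [cos_sign] there, and a right move leaves too few right coordinates for the [m2] sine
    factors. *)
Lemma walk_center m1 m2 x : root x = K.*2 -> (0 < root b < K.*2.*2)%N ->
  evens (right x) = m2 ->
  walk b (nseq m1.+1 cos_sign ++ nseq m2 sin_sign) x =
  (s2 (right x) + s1 (left x) + (K.*2 < root b)%N) *
  (walk (left b) (nseq m1 s1) (left x) * walk (right b) (nseq m2 s2) (right x)).
Proof.
move=> xr br xm.
have rbK : root b != K.*2 by apply: contraTneq rb_odd => ->; rewrite odd_double.
rewrite -[LHS]/(edge b cos_sign (walk b (nseq m1 cos_sign ++ nseq m2 sin_sign)) x) edge_node.
rewrite xr odd_double /=.
rewrite [X in _ + (X + _)]big1 ?add0r => [|v xv]; last first.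
  by rewrite /cos_sign !root_upd !right_upd xr ltnn eqxx addbb0 mul0r.
rewrite [X in _ + X]big1 ?addr0 => [|v xv]; last first.
  rewrite walk_off_sin ?mulr0 ?root_upd //; first by rewrite xr; lia.
  by rewrite right_upd -xm (evens_upd xv (rtb_odd v)).
rewrite walk_on_cos ?root_upd // left_upd right_upd; congr (_ * _).
rewrite /cos_sign root_upd left_upd xr ltnn eqxx (negPf rbK).
case: (ltngtP (root b) K.*2) rbK => //= _ _; rewrite ?addr0 //.
by rewrite -addrA [1 + _]addrC.
Qed.
End Steps.

Lemma flip_node v x : vertex K.*2 x ->
  [/\ root (@flip (node O1 O2) K.*2 v x) =
        match v with inl _ => K.*2.*2
        | inr (inl v) => if sgn v then K.*2.*2 - root x else root x
        | inr (inr v) => if sgn v then K.*2.*2 - root x else root x end,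
      left (@flip (node O1 O2) K.*2 v x) =
        (if v is inr (inl v) then flip K.*2 v (left x) else left x) &
      right (@flip (node O1 O2) K.*2 v x) =
        if v is inr (inr v) then flip K.*2 v (right x) else right x]%N.
Proof.
move=> xL; case: v => [[]|[v|v]]; split=> //; apply/funext => u;
  by rewrite /left /right /flip /= ?(inj_eq inr_inj) ?(inj_eq inl_inj).
Qed.

Hypothesis K_gt0 : (0 < K)%N.
Hypotheses (s1_char : character K.*2 s1 (@sgn O1)) (s2_char : character K.*2 s2 (@sgn O2)).

Lemma cos_sign_character : @character (node O1 O2) K.*2 cos_sign (@sgn (node O1 O2)).
Proof.
move=> v x xL xv; have [rE lE rtE] := flip_node v xL.
have rL : (root x <= K.*2.*2)%N by exact: xL.
have lL : vertex K.*2 (left x) by move=> u; exact: xL.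
have rtL : vertex K.*2 (right x) by move=> u; exact: xL.
have c1 : (K.*2.*2 - root x < K.*2)%N = (K.*2 < root x)%N by lia.
have c2 : (K.*2.*2 - root x == K.*2)%N = (root x == K.*2)%N by lia.
rewrite /cos_sign rE lE rtE; case: v xv {rE lE rtE} => [[]|[v|v]] xv /=.
- have -> : root x = 0%N by exact: xv.
  have d1 : (K.*2.*2 < K.*2)%N = false by lia.
  have d2 : (K.*2.*2 == K.*2) = false by lia.
  by rewrite d1 d2 double_gt0 K_gt0 addrC.
- have xv' : left x v = 0%N by exact: xv.
  rewrite (s1_char lL xv') addr0; case: (sgn v); last by rewrite addr0.
  rewrite c1 c2; case: (ltngtP (root x) K.*2) => _ //; last by rewrite addrC.
  by rewrite addrCA addbb0 addr0.
- have xv' : right x v = 0%N by exact: xv.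
  rewrite (s2_char rtL xv'); case: (sgn v); last by rewrite !addr0.
  rewrite c1 c2; case: (ltngtP (root x) K.*2) => _ //; first by rewrite addrC.
  by rewrite addrAC addbb0 add0r.
Qed.

Lemma sin_sign_character : @character (node O1 O2) K.*2 sin_sign (@sgn (node O1 O2)).
Proof.
move=> v x xL xv; have [rE lE rtE] := flip_node v xL.
have rL : (root x <= K.*2.*2)%N by exact: xL.
have lL : vertex K.*2 (left x) by move=> u; exact: xL.
have rtL : vertex K.*2 (right x) by move=> u; exact: xL.
have KK : (0 < K.*2.*2)%N by rewrite !double_gt0.
have c1 : (K.*2.*2 - root x == 0)%N = (K.*2.*2 <= root x)%N by lia.
have c2 : (K.*2.*2 - root x < K.*2.*2)%N = (root x != 0)%N by lia.
rewrite /sin_sign rE lE rtE; case: v xv {rE lE rtE} => [[]|[v|v]] xv /=.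
- have -> : root x = 0%N by exact: xv.
  by rewrite gtn_eqF // ltnn /= addrC.
- have xv' : left x v = 0%N by exact: xv.
  rewrite (s1_char lL xv') addr0; case: (sgn v); last by rewrite addr0.
  rewrite c1 c2; have [r0|r0] := eqVneq (root x) 0%N.
    by rewrite r0 leqNgt KK /= addrCA addbb0 addr0.
  by case: (ltnP (root x) K.*2.*2) => _ //; rewrite addrC.
- have xv' : right x v = 0%N by exact: xv.
  rewrite (s2_char rtL xv'); case: (sgn v); last by rewrite !addr0.
  rewrite c1 c2; have [r0|r0] := eqVneq (root x) 0%N.
    by rewrite r0 leqNgt KK /= addrC.
  by case: (ltnP (root x) K.*2.*2) => _ //; rewrite addrAC addbb0 add0r.
Qed.

(** The extra cosine factor restricts the sum to the root intervals that meet the wall, one on each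
    side. Their first jumps differ by 1, so that together they contribute 1 times the product.
    Subdividing with [L = K.*2] makes the wall an even vertex. *)
Lemma cup_node : @cup (node O1 O2) K.*2 (nseq #|O1|.+1 cos_sign ++ nseq #|O2| sin_sign) =
  cup K.*2 (nseq #|O1| s1) * cup K.*2 (nseq #|O2| s2).
Proof.
rewrite /cup [LHS]big_cells_sum; under eq_bigr do rewrite big_cells_sum.
have walkE (p : {ffun unit -> 'I_(K.*2) * bool}) c d :
   walk (odd_end (join_cells p (join_cells c d))) (nseq #|O1|.+1 cos_sign ++ nseq #|O2| sin_sign)
     (even_end (join_cells p (join_cells c d))) =
   (even_end p tt == K.*2) * ((s2 (even_end d) + s1 (even_end c) + (K.*2 < odd_end p tt)%N) *
   (walk (odd_end c) (nseq #|O1| s1) (even_end c) * walk (odd_end d) (nseq #|O2| s2) (even_end d))).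
  have b_odd v : odd (odd_end (join_cells p (join_cells c d)) v) by rewrite /odd_end /= odd_double.
  have rE : root (even_end (join_cells p (join_cells c d))) = even_end p tt.
    by rewrite /root /even_end ffunE.
  have rbE : root (odd_end (join_cells p (join_cells c d))) = odd_end p tt.
    by rewrite /root /odd_end ffunE.
  have lE : left (even_end (join_cells p (join_cells c d))) = even_end c.
    by rewrite /left even_end_join_r even_end_join_l.
  have lbE : left (odd_end (join_cells p (join_cells c d))) = odd_end c.
    by rewrite /left odd_end_join_r odd_end_join_l.
  have rtE : right (even_end (join_cells p (join_cells c d))) = even_end d.
    by rewrite /right !even_end_join_r.
  have rtbE : right (odd_end (join_cells p (join_cells c d))) = odd_end d.
    by rewrite /right !odd_end_join_r.
  have pL := @odd_end_vertex (@Gluing unit (fun _ _ => true) (fun=> true)) _ p tt.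
  have [pK|pK] := eqVneq (even_end p tt) K.*2.
    rewrite mul1r walk_center ?rE ?rbE ?lE ?lbE ?rtE ?rtbE ?evens_even_end //.
    have podd : odd (odd_end p tt) by rewrite /odd_end /= odd_double.
    apply/andP; split=> //; rewrite ltn_neqAle pL andbT.
    by apply: contraTneq podd => ->; rewrite odd_double.
  rewrite mul0r walk_off_cos //; last by rewrite lE evens_even_end.
  rewrite /off_cos rE rbE; move: pK; rewrite /even_end /odd_end; case: (p tt) => i [] /=; lia.
under eq_bigr do under eq_bigr do under eq_bigr do rewrite walkE.
rewrite exchange_big mulr_suml /=; apply: eq_bigr => c _.
rewrite exchange_big mulr_sumr /=; apply: eq_bigr => d _.
set q := _ + s1 _; set w := _ * _.
rewrite (reindex (fun t : 'I_(K.*2) * bool => [ffun _ : unit => t])) /=; last first.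
  exists (fun p : {ffun unit -> 'I_(K.*2) * bool} => p tt) => [t|p] _; first by rewrite ffunE.
  by apply/ffunP => -[]; rewrite ffunE.
under eq_bigr do rewrite /even_end /odd_end ffunE.
rewrite -(pair_bigA _ (fun (i : 'I_(K.*2)) (d : bool) => ((i + d).*2 == K.*2)%N * ((q + (K.*2 < i.*2.+1)%N) * w))) /=.
under eq_bigr do rewrite big_bool /= addn1 addn0.
rewrite big_split /=.
(* The even end of a root interval is the wall for the index [K - 1] with flag [true] and for the
   index [K] with flag [false]. *)
have iK : (K.-1 < K.*2)%N by lia.
have jK : (K < K.*2)%N by lia.
rewrite (bigD1 (Ordinal iK)) //= big1 ?addr0 => [|i iN]; last first.
  rewrite (_ : (_ == _) = false) ?mul0r //; apply/negbTE; apply: contra iN => /eqP e.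
  by apply/eqP/val_inj => /=; lia.
rewrite (bigD1 (Ordinal jK)) //= big1 ?addr0 => [|i iN]; last first.
  rewrite (_ : (_ == _) = false) ?mul0r //; apply/negbTE; apply: contra iN => /eqP e.
  by apply/eqP/val_inj => /=; lia.
rewrite prednK // !eqxx !mul1r (_ : (K.*2 < (K.-1).*2.+1)%N = false); last by lia.
by rewrite ltnS leqnn addr0 -mulrDl addrA addbb0 add0r.
Qed.
End Node.

Lemma card_node (O1 O2 : gluing) : #|node O1 O2| = (#|O1| + #|O2|).+1.
Proof. by rewrite !card_sum card_unit. Qed.

(** [cos_sign] and [sin_sign] have the same jumps, hence represent the same class. The power is
    computed with [|O1| + 1] factors of the one kind and [|O2|] of the other, a choice for which
    everything concentrates at the wall. *)
Lemma good_node (O1 O2 : gluing) : good O1 -> good O2 -> good (node O1 O2).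
Proof.
move=> g1 g2 K K0; have [s1 s1c I1] := g1 K K0; have [s2 s2c I2] := g2 K K0.
exists (cos_sign K s1 s2); first exact: cos_sign_character.
have := @cup_node _ _ _ s1 s2 K0; rewrite I1 I2 => e.
rewrite (@cup_character (node O1 O2) _ (@sgn (node O1 O2)) _
  (nseq #|O1|.+1 (cos_sign K s1 s2) ++ nseq #|O2| (sin_sign K s1 s2))) ?e //.
- by move=> s s_in; rewrite (In_nseq s_in); exact: cos_sign_character.
- move=> s s_in; have [s_in'|s_in'] := In_cat s_in.
    by rewrite (In_nseq s_in'); exact: cos_sign_character.
  by rewrite (In_nseq s_in'); exact: sin_sign_character.
- by rewrite size_cat !size_nseq card_node.
Qed.

(** * Borsuk-Ulam for gluings *)

Section BorsukUlam.
Variable R : realType.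

Definition rflip (O : gluing) v (z : O -> R) : O -> R := fun u =>
  if u == v then pi else if refl v u then pi - z u else z u.

Definition equivariant (O : gluing) (V : lmodType R) (h : (O -> R) -> V) :=
  forall v z, z v = 0 -> h (rflip v z) = (-1) ^+ sgn v *: h z.

Definition angle (O : gluing) L (x : O -> nat) : O -> R :=
  fun v => pi * (x v)%:R / (L.*2)%:R.

Lemma angle_flip (O : gluing) L v (x : O -> nat) : (0 < L)%N -> vertex L x ->
  angle L (flip L v x) = rflip v (angle L x).
Proof.
move=> L0 xL; have L2 : (L.*2)%:R != 0 :> R by rewrite pnatr_eq0 double_eq0 -lt0n.
apply/funext => u; rewrite /angle /flip /rflip.
case: ifP => _; first by rewrite mulfK.
by case: ifP => // _; rewrite natrB // mulrBr mulrBl mulfK.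
Qed.

(** The excluded situation is the absence of a common zero in uniform form: around every point some
    function keeps a strict sign at scale [d]. On a grid of mesh at most [d] no cell then sees all
    functions change sign, against [walk_neq0]. *)
Theorem borsuk_ulam (O : gluing) (hs : seq ((O -> R) -> R^o)) (d : R) :
  good O -> size hs = #|O| -> (forall h, List.In h hs -> equivariant h) -> 0 < d ->
  ~ (forall z, exists2 h, List.In h hs & forall q q' : O -> R,
       (forall v, `|q v - z v| <= d) -> (forall v, `|q' v - z v| <= d) ->
       0 < h q * h q').
Proof.
move=> gO sz heq d0 H.
(* The grid has [4K] steps on [[0, pi]]; this [K] makes them at most [d] long. *)
pose K := (Num.bound (pi / d)).+1.
have [s sc I1] := gO K isT.
have K2 : 0 < (K.*2.*2)%:R :> R by rewrite ltr0n.
have mesh : pi / (K.*2.*2)%:R <= d.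
  rewrite ler_pdivrMr // mulrC -ler_pdivrMr //; apply: ltW.
  apply: lt_le_trans (archi_boundP _) _; first by rewrite divr_ge0 ?pi_ge0 ?ltW.
  by rewrite ler_nat /K; move: (Num.bound _) => b; lia.
(* At zeros of [h] the reference function [s] breaks the tie, so that [sg h] has the prescribed
   jumps everywhere. *)
pose sg (h : (O -> R) -> R^o) x := if 0 < h (angle K.*2 x) then true
   else if h (angle K.*2 x) < 0 then false else s x.
have sgc h : List.In h hs -> character K.*2 (sg h) (@sgn O).
  move=> hin v x xL xv; rewrite /sg angle_flip // heq //; last first.
    by rewrite /angle xv mulr0 mul0r.
  rewrite sc //; case: (sgn v); rewrite ?expr1 ?expr0 ?scaleN1r ?scale1r ?oppr_gt0 ?oppr_lt0.
    by case: (ltgtP 0 (h _)).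
  by case: (ltgtP 0 (h _)) => //; rewrite addr0.
have : cup K.*2 (map sg hs) = 1.
  rewrite (cup_character (e := @sgn O) (ss' := nseq #|O| s)) ?size_nseq ?size_map //.
    by move=> r /(@List.in_map_iff _ _ sg)[h [<- hin]]; exact: sgc.
  by move=> r r_in; rewrite (In_nseq r_in).
rewrite /cup => cup1.
have [c Wc] : exists c, walk (@odd_end O K.*2 c) (map sg hs) (even_end c).
  apply/existsP; apply: contraT => /existsPn W; move: cup1.
  by rewrite big1 // => c _; exact/negbTE.
have [h hin hpos] := H (angle K.*2 (even_end c)).
have [y [y' [yy' yc yc']]] := walk_neq0 Wc (@List.in_map _ _ sg _ _ hin).
have near (w : O -> nat) : (forall u, w u \in [:: even_end c u; odd_end c u]) ->
    forall v, `|angle K.*2 w v - angle K.*2 (even_end c) v| <= d.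
  move=> wc v; have := wc v; rewrite !inE /angle => /orP[]/eqP->.
    by rewrite subrr normr0 ltW.
  rewrite -mulrBl -mulrBr normrM normfV normrM.
  rewrite (ger0_norm (pi_ge0 R)) (gtr0_norm K2) -mulrA [_ / _]mulrC mulrA.
  apply: le_trans mesh; rewrite ler_piMr ?divr_ge0 ?pi_ge0 ?(ltW K2) //.
  rewrite /even_end /odd_end; case: (c v) => i [] /=.
    rewrite addn1 doubleS -[in X in _ - X]natr1 opprD addrA subrr sub0r normrN normr1 //.
  by rewrite addn0 -natr1 addrAC subrr add0r normr1.
have := hpos _ _ (near _ yc) (near _ yc').
move: yy'; rewrite /sg.
case: (ltgtP 0 (h (angle _ y))) => hy; case: (ltgtP 0 (h (angle _ y'))) => hy' //= _.
- by rewrite pmulr_rgt0 // ltNge ltW.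
- by rewrite -hy' mulr0 ltxx.
- by rewrite nmulr_rgt0 // ltNge ltW.
- by rewrite -hy' mulr0 ltxx.
- by rewrite -hy mul0r ltxx.
- by rewrite -hy mul0r ltxx.
- by rewrite -hy mul0r ltxx.
Qed.
End BorsukUlam.

(** * Equivariant families of orthonormal frames *)

Section BoundedLipschitz.
Variable R : realType.
Implicit Types O C : Type.

(* Bounded Lipschitz for the sup norm on the coordinates. *)
Definition blip O (f : (O -> R) -> R) := exists k, [/\ 0 <= k, forall z, `|f z| <= k &
  forall z z' e, 0 <= e -> (forall v, `|z v - z' v| <= e) -> `|f z - f z'| <= k * e].

Lemma mvt_lipschitz (f df : R -> R) : (forall x : R, is_derive x 1 f (df x)) ->
  (forall x, `|df x| <= 1) -> forall x y, `|f x - f y| <= `|x - y|.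
Proof.
move=> fdf df1 x y; wlog xy : x y / y <= x => [H|].
  have [|/ltW] := leP y x; first exact: H.
  by move=> yx; rewrite distrC [leRHS]distrC; exact: H.
have fc : {within `[y, x], continuous f}.
  by apply: derivable_within_continuous => z _; have [] := fdf z.
have [c _ ->] := MVT_segment xy (fun z _ => fdf z) fc.
by rewrite normrM ler_piMl.
Qed.

Lemma cos_lipschitz (x y : R) : `|cos x - cos y| <= `|x - y|.
Proof. by apply: mvt_lipschitz => z; rewrite normrN sin_max. Qed.

Lemma sin_lipschitz (x y : R) : `|sin x - sin y| <= `|x - y|.
Proof. by apply: mvt_lipschitz => z; exact: cos_max. Qed.

Lemma cos_piB (x : R) : cos (pi - x) = - cos x.
Proof. by rewrite cosB cospi sinpi mul0r addr0 mulN1r. Qed.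

Lemma sin_piB (x : R) : sin (pi - x) = sin x.
Proof. by rewrite sinB cospi sinpi mul0r sub0r mulN1r opprK. Qed.

Lemma blip_cst O (c : R) : blip (fun _ : O -> R => c).
Proof.
exists `|c|; split=> // z z' e e0 _.
by rewrite subrr normr0 mulr_ge0.
Qed.

Lemma blip_cos O v : blip (fun z : O -> R => cos (z v)).
Proof.
exists 1; split=> // [z|z z' e e0 zz']; first exact: cos_max.
by rewrite mul1r (le_trans (cos_lipschitz _ _)).
Qed.

Lemma blip_sin O v : blip (fun z : O -> R => sin (z v)).
Proof.
exists 1; split=> // [z|z z' e e0 zz']; first exact: sin_max.
by rewrite mul1r (le_trans (sin_lipschitz _ _)).
Qed.

Lemma blipD O (f g : (O -> R) -> R) : blip f -> blip g -> blip (fun z => f z + g z).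
Proof.
move=> [k [k0 fk fl]] [l [l0 gl gl']]; exists (k + l); split=> [|z|z z' e e0 zz'].
- exact: addr_ge0.
- by rewrite (le_trans (ler_normD _ _)) ?lerD.
- rewrite opprD addrACA mulrDl (le_trans (ler_normD _ _)) ?lerD //; first exact: fl.
  exact: gl'.
Qed.

Lemma blipM O (f g : (O -> R) -> R) : blip f -> blip g -> blip (fun z => f z * g z).
Proof.
move=> [k [k0 fk fl]] [l [l0 gl gl']]; exists (k * l *+ 2); split=> [|z|z z' e e0 zz'].
- by rewrite mulrn_wge0 ?mulr_ge0.
- by rewrite normrM (le_trans (ler_pM _ _ (fk z) (gl z))) // mulr2n lerDl mulr_ge0.
- rewrite (_ : f z * g z - f z' * g z' = f z * (g z - g z') + (f z - f z') * g z'); last by ring.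
  rewrite (le_trans (ler_normD _ _)) // !normrM mulr2n mulrDl lerD //.
    by rewrite -mulrA ler_pM // gl'.
  by rewrite mulrAC ler_pM // fl.
Qed.

Lemma blip_sum O (I : Type) (r : seq I) (F : I -> (O -> R) -> R) :
  (forall i, blip (F i)) -> blip (fun z => \sum_(i <- r) F i z).
Proof.
move=> Fb; elim: r => [|i r IH].
  by rewrite (_ : (fun _ => _) = fun=> 0) ?funeqE => [|z]; [exact: blip_cst|rewrite big_nil].
rewrite (_ : (fun _ => _) = fun z => F i z + \sum_(j <- r) F j z) ?funeqE => [|z].
  exact: blipD.
by rewrite big_cons.
Qed.

Lemma blip_comp O C (i : C -> O) (f : (C -> R) -> R) : blip f -> blip (fun z => f (z \o i)).
Proof.
by move=> [k [k0 fk fl]]; exists k; split=> // z z' e e0 zz'; apply: fl => // v; exact: zz'.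
Qed.

Definition mblip O m n (A : (O -> R) -> 'M[R]_(m, n)) := forall i j, blip (fun z => A z i j).

Lemma mblip_cst O m n (A : 'M[R]_(m, n)) : mblip (fun _ : O -> R => A).
Proof. by move=> i j; exact: blip_cst. Qed.

Lemma mblip_comp O C (i : C -> O) m n (A : (C -> R) -> 'M[R]_(m, n)) :
  mblip A -> mblip (fun z => A (z \o i)).
Proof. by move=> bA a b; exact: (blip_comp i (bA a b)). Qed.

Lemma mblipM O m n p (A : (O -> R) -> 'M[R]_(m, n)) (B : (O -> R) -> 'M[R]_(n, p)) :
  mblip A -> mblip B -> mblip (fun z => A z *m B z).
Proof.
move=> bA bB i j; rewrite (_ : (fun _ => _) = fun z => \sum_k A z i k * B z k j).
  by apply: blip_sum => k; exact: blipM.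
by apply/funext => z; rewrite mxE.
Qed.

Lemma mblipZ O m n f (A : (O -> R) -> 'M[R]_(m, n)) :
  blip f -> mblip A -> mblip (fun z => f z *: A z).
Proof.
move=> bf bA i j; rewrite (_ : (fun _ => _) = fun z => f z * A z i j) ?funeqE => [|z].
  exact: blipM.
by rewrite mxE.
Qed.

Lemma mblip_tr O m n (A : (O -> R) -> 'M[R]_(m, n)) : mblip A -> mblip (fun z => (A z)^T).
Proof.
by move=> bA i j; rewrite (_ : (fun _ => _) = fun z => A z j i) ?funeqE => [|z]; rewrite ?mxE //; exact: bA.
Qed.

Lemma mblip_col O m1 m2 n (A : (O -> R) -> 'M[R]_(m1, n)) (B : (O -> R) -> 'M[R]_(m2, n)) :
  mblip A -> mblip B -> mblip (fun z => col_mx (A z) (B z)).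
Proof.
move=> bA bB i j; case: (split_ordP i) => k ->.
  by rewrite (_ : (fun _ => _) = fun z => A z k j) ?funeqE => [|z]; rewrite ?col_mxEu //; exact: bA.
by rewrite (_ : (fun _ => _) = fun z => B z k j) ?funeqE => [|z]; rewrite ?col_mxEd //; exact: bB.
Qed.

Lemma mblip_row O m n1 n2 (A : (O -> R) -> 'M[R]_(m, n1)) (B : (O -> R) -> 'M[R]_(m, n2)) :
  mblip A -> mblip B -> mblip (fun z => row_mx (A z) (B z)).
Proof.
move=> bA bB i j; case: (split_ordP j) => k ->.
  by rewrite (_ : (fun _ => _) = fun z => A z i k) ?funeqE => [|z]; rewrite ?row_mxEl //; exact: bA.
by rewrite (_ : (fun _ => _) = fun z => B z i k) ?funeqE => [|z]; rewrite ?row_mxEr //; exact: bB.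
Qed.

End BoundedLipschitz.

Section Families.
Variable R : realType.

(* commutation of the leading 2 x 2 block with a rotation by a right angle *)
Definition conformal l (B : 'M[R]_l) := forall i j : 'I_l, i = 0%N :> nat -> j = 1%N :> nat ->
  B i i = B j j /\ B i j = - B j i.

Record family (O : gluing) n l (A : (O -> R) -> 'M[R]_(n, l)) := Family {
  family_orthonormal : forall z, (A z)^T *m A z = 1%:M;
  family_blip : mblip A;
  family_equivariant : equivariant A;
  family_conformal : forall z z', conformal ((A z)^T *m A z') }.

Definition has_family (O : gluing) n l := exists A, @family O n l A.

Lemma conformal1 l : conformal (1%:M : 'M[R]_l).
Proof. by move=> i j i0 j1; rewrite !mxE !eqxx -!val_eqE /= i0 j1 oppr0. Qed.

Lemma conformalD l (a b : R) (B B' : 'M[R]_l) :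
  conformal B -> conformal B' -> conformal (a *: B + b *: B').
Proof.
move=> cB cB' i j i0 j1; have [e f] := cB i j i0 j1; have [e' f'] := cB' i j i0 j1.
by rewrite !mxE e e' f f' opprD !mulrN.
Qed.

Lemma trmx_scale_mul m n p (a b : R) (A : 'M[R]_(m, n)) (B : 'M[R]_(m, p)) :
  (a *: A)^T *m (b *: B) = (a * b) *: (A^T *m B).
Proof. by rewrite [(a *: A)^T]linearZ /= -scalemxAl -scalemxAr scalerA. Qed.

Lemma has_family_leaf l : has_family leaf l l.
Proof.
exists (fun _ => 1%:M); split.
- by move=> z; rewrite trmx1 mulmx1.
- exact: mblip_cst.
- by case.
- by move=> z z'; rewrite trmx1 mulmx1; exact: conformal1.
Qed.

Lemma has_family_pad O n p l : has_family O n l -> has_family O (n + p) l.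
Proof.
move=> [A [A1 A2 A3 A4]]; exists (fun z => col_mx (A z) 0); split.
- by move=> z; rewrite tr_col_mx mul_row_col mulmx0 addr0.
- by apply: mblip_col => //; exact: mblip_cst.
- by move=> v z zv; rewrite A3 // scale_col_mx scaler0.
- by move=> z z'; rewrite tr_col_mx mul_row_col mulmx0 addr0.
Qed.

Lemma has_family_le O n n' l : (n <= n')%N -> has_family O n l -> has_family O n' l.
Proof. by move=> /subnKC <-; exact: has_family_pad. Qed.

Lemma has_family_cols O n l1 l2 : has_family O n (l1 + l2) -> has_family O n l1.
Proof.
move=> [A [A1 A2 A3 A4]]; pose E : 'M[R]_(l1 + l2, l1) := col_mx 1%:M 0.
have AE z z' : (A z *m E)^T *m (A z' *m E) = ulsubmx ((A z)^T *m A z').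
  rewrite trmx_mul -mulmxA (mulmxA (A z)^T); move: (_ *m A z') => B.
  by rewrite /E tr_col_mx -[B in LHS]submxK mul_block_col trmx1 trmx0 mul_row_col !mulmx1 !mulmx0 !addr0 mul1mx mul0mx addr0.
exists (fun z => A z *m E); split.
- by move=> z; rewrite AE A1 scalar_mx_block block_mxKul.
- by apply: mblipM => //; exact: mblip_cst.
- by move=> v z zv; rewrite A3 // scalemxAl.
- move=> z z' i j i0 j1; rewrite AE.
  have U (B : 'M[R]_(l1 + l2)) a b : ulsubmx B a b = B (lshift _ a) (lshift _ b) by rewrite !mxE.
  rewrite !U.
  exact: (A4 z z' (lshift _ i) (lshift _ j)).
Qed.

Lemma has_family_cols_le O n l l' : (l <= l')%N -> has_family O n l' -> has_family O n l.
Proof. by move=> /subnKC <-; exact: has_family_cols. Qed.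

Section Node.
Variables (O1 O2 : gluing).
Let O := node O1 O2.
Definition rroot (z : O -> R) : R := z (inl tt).
Definition rleft (z : O -> R) : O1 -> R := z \o (inr \o inl).
Definition rright (z : O -> R) : O2 -> R := z \o (inr \o inr).

Lemma rflip_node (v : O) (z : O -> R) :
  [/\ rroot (rflip v z) = match v with inl _ => pi
        | inr (inl v) => if sgn v then pi - rroot z else rroot z
        | inr (inr v) => if sgn v then pi - rroot z else rroot z end,
      rleft (rflip v z) = (if v is inr (inl v) then rflip v (rleft z) else rleft z) &
      rright (rflip v z) = if v is inr (inr v) then rflip v (rright z) else rright z].
Proof. by case: v => [[]|[v|v]]; split=> //; apply/funext. Qed.

(** One sign rule covers the three kinds of faces: both [cos t * A1] and [sin t * A2] change by the
    sign [f + e1], which is what allows them to be stacked into one equivariant vector. *)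
Lemma node_equivariant (V1 V2 : lmodType R) (A1 : (O1 -> R) -> V1) (A2 : (O2 -> R) -> V2)
    (v : O) (z : O -> R) : equivariant A1 -> equivariant A2 -> z v = 0 ->
  exists e1 e2 f : bool,
   [/\ cos (rroot (rflip v z)) = (-1) ^+ f * cos (rroot z),
       sin (rroot (rflip v z)) = (-1) ^+ (f (+) e1 (+) e2) * sin (rroot z),
       A1 (rleft (rflip v z)) = (-1) ^+ e1 *: A1 (rleft z),
       A2 (rright (rflip v z)) = (-1) ^+ e2 *: A2 (rright z) &
       sgn v = f (+) e1].
Proof.
move=> q1 q2; have [-> -> ->] := rflip_node v z; case: v => [[]|[v|v]] zv.
- exists false, false, true; rewrite /rroot zv cos0 cospi sin0 sinpi mulr0.
  by rewrite !expr0 !scale1r mulr1 expr1.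
- exists (sgn v), false, (sgn v); rewrite q1 // expr0 scale1r addbb addFb.
  by case: (sgn v); rewrite !expr0 !mul1r // expr1 mulN1r cos_piB sin_piB.
- exists false, (sgn v), (sgn v); rewrite q2 // expr0 scale1r addbF addbb.
  rewrite -[@sgn O _]/(sgn v).
  by case: (sgn v); rewrite ?expr0 ?expr1 ?mul1r ?mulN1r ?cos_piB ?sin_piB.
Qed.

Lemma has_family_join n1 n2 l :
  has_family O1 n1 l -> has_family O2 n2 l -> has_family O (n1 + n2) l.
Proof.
move=> [A [A1 A2 A3 A4]] [B [B1 B2 B3 B4]].
exists (fun z => col_mx (cos (rroot z) *: A (rleft z)) (sin (rroot z) *: B (rright z))).
have E z z' : (col_mx (cos (rroot z) *: A (rleft z)) (sin (rroot z) *: B (rright z)))^T *m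
    (col_mx (cos (rroot z') *: A (rleft z')) (sin (rroot z') *: B (rright z'))) =
    (cos (rroot z) * cos (rroot z')) *: ((A (rleft z))^T *m A (rleft z')) +
    (sin (rroot z) * sin (rroot z')) *: ((B (rright z))^T *m B (rright z')).
  by rewrite tr_col_mx mul_row_col !trmx_scale_mul.
split.
- by move=> z; rewrite E A1 B1 -scalerDl -!expr2 cos2Dsin2 scale1r.
- apply: mblip_col; apply: mblipZ; [exact: blip_cos|exact: mblip_comp|exact: blip_sin|exact: mblip_comp].
- move=> v z zv; have [e1 [e2 [f [-> -> -> -> ->]]]] := node_equivariant A3 B3 zv.
  rewrite scale_col_mx !scalerA; congr col_mx; congr (_ *: _).
    by rewrite mulrAC -signr_addb.
  by rewrite mulrAC -signr_addb -addbA addbb addbF.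
- by move=> z z'; rewrite E; exact: conformalD.
Qed.
End Node.
End Families.

Section MoreFamilies.
Variable R : realType.

Lemma mulmx_block_diag (n1 n2 l1 l2 m1 m2 : nat) (A : 'M[R]_(n1, l1)) (A' : 'M[R]_(n1, m1))
   (B : 'M[R]_(n2, l2)) (B' : 'M[R]_(n2, m2)) :
  (block_mx A 0 0 B)^T *m block_mx A' 0 0 B' = block_mx (A^T *m A') 0 0 (B^T *m B').
Proof.
by rewrite tr_block_mx mulmx_block !trmx0 !mulmx0 !mul0mx !addr0 !add0r.
Qed.

(** The condition [1 < l1] keeps the leading 2 x 2 block, which must stay conformal, inside the
    block of [A]. *)
Lemma has_family_diag O n1 n2 l1 l2 : (1 < l1)%N ->
  has_family R O n1 l1 -> has_family R O n2 l2 -> has_family R O (n1 + n2) (l1 + l2).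
Proof.
move=> l11 [A [A1 A2 A3 A4]] [B [B1 B2 B3 B4]].
exists (fun z => block_mx (A z) 0 0 (B z)); split.
- by move=> z; rewrite mulmx_block_diag A1 B1 -scalar_mx_block.
- by apply: mblip_col; apply: mblip_row => //; exact: mblip_cst.
- by move=> v z zv; rewrite A3 // B3 // scale_block_mx !scaler0.
- move=> z z' i j i0 j1; rewrite mulmx_block_diag.
  have l10 := ltnW l11.
  have -> : i = lshift l2 (Ordinal l10) by exact: val_inj.
  have -> : j = lshift l2 (Ordinal l11) by exact: val_inj.
  by rewrite !block_mxEul; exact: A4.
Qed.

(** The doubling step for orthogonal designs. With the other three blocks given, the corner
    [-cos t * B A^T B^T] is what makes the two block columns orthogonal; as [B] occurs in it twice,
    it changes sign like [A]. *)
Lemma has_family_double O1 O2 p :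
  has_family R O1 p p -> has_family R O2 p p -> has_family R (node O1 O2) (p + p) (p + p).
Proof.
move=> [A [A1 A2 A3 A4]] [B [B1 B2 B3 B4]].
have A1' z := mulmx1C (A1 z); have B1' z := mulmx1C (B1 z).
pose D z := B (rright z) *m ((A (rleft z))^T *m (B (rright z))^T).
pose M (z : node O1 O2 -> R) := block_mx
  (cos (rroot z) *: A (rleft z)) (sin (rroot z) *: (B (rright z))^T)
  (sin (rroot z) *: B (rright z)) (- cos (rroot z) *: D z).
exists M; split.
- move=> z; rewrite /M; move: (cos2Dsin2 (rroot z)); move: (cos _) (sin _) => c s.
  rewrite !expr2 => cs.
  have DD : (D z)^T *m D z = 1%:M.
    rewrite /D !trmx_mul !trmxK -!mulmxA (mulmxA (B _)^T) B1 mul1mx (mulmxA (A _)) A1'.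
    by rewrite mul1mx B1'.
  rewrite tr_block_mx mulmx_block !trmx_scale_mul trmxK A1 B1 B1' DD -!scalerDl.
  rewrite mulrNN cs [s * s + _]addrC cs scalar_mx_block /D.
  rewrite (mulmxA (B _)^T) B1 mul1mx mulrN scaleNr [s * c]mulrC subrr.
  rewrite !trmx_mul !trmxK -!mulmxA B1 mulmx1 mulNr scaleNr [c * s in X in _ - X]mulrC.
  by rewrite [s * c]mulrC subrr !scale1r.
- apply: mblip_col; apply: mblip_row; apply: mblipZ; try exact: blip_cos; try exact: blip_sin.
  + exact: mblip_comp.
  + by apply: mblip_tr; exact: mblip_comp.
  + exact: mblip_comp.
  + rewrite (_ : (fun z => _) = fun z => -1 * cos (rroot z)); last by apply/funext=> z; rewrite mulN1r.
    by apply: blipM; [exact: blip_cst|exact: blip_cos].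
  + apply: mblipM; first exact: mblip_comp.
    by apply: mblipM; apply: mblip_tr; exact: mblip_comp.
- move=> v z zv; have [e1 [e2 [f [cE sE aE bE ->]]]] := node_equivariant A3 B3 zv.
  rewrite /M /D cE sE aE bE scale_block_mx; congr block_mx.
  + by rewrite !scalerA mulrAC -signr_addb.
  + rewrite [(_ *: _)^T]linearZ /= !scalerA mulrAC -signr_addb.
    by rewrite -addbA addbb addbF.
  + by rewrite !scalerA mulrAC -signr_addb -addbA addbb addbF.
  + rewrite ![(_ *: _)^T]linearZ /= -!scalemxAl -!scalemxAr !scalerA.
    rewrite -mulrN; congr (_ *: _); rewrite !mulrA.
    case: e1 e2 f {cE sE aE bE} => [] [] []; rewrite /= ?expr0 ?expr1; ring.
- move=> z z' i j i0 j1; rewrite /M; set c := cos _; set s := sin _; set c' := cos _; set s' := sin _.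
  (* For [p = 1] the leading 2 x 2 block involves all four blocks, whose matrices are then signs;
     for larger [p] it lies in the upper left one. *)
  case: p => [|[|p]] in A A1 A2 A3 A4 B B1 B2 B3 B4 A1' B1' D M i j i0 j1 *.
  + by case: i i0.
  + have -> : i = lshift 1 ord0 by exact: val_inj.
    have -> : j = rshift 1 ord0 by exact: val_inj.
    have E (x y : R) (P Q P' Q' : 'M[R]_1) :
        (x *: (P^T *m Q) + y *: (P'^T *m Q')) ord0 ord0 =
        x * (P 0 0 * Q 0 0) + y * (P' 0 0 * Q' 0 0).
      by rewrite !mxE !big_ord1 !mxE.
    have m00 (P Q : 'M[R]_1) : (P *m Q) 0 0 = P 0 0 * Q 0 0 by rewrite mxE big_ord1.
    have t00 (P : 'M[R]_1) : P^T 0 0 = P 0 0 by rewrite mxE.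
    rewrite tr_block_mx mulmx_block !trmx_scale_mul.
    rewrite block_mxEul block_mxEdr block_mxEur block_mxEdl !E /D !m00 !t00.
    have sq (F : 'M[R]_1) : F^T *m F = 1%:M -> F 0 0 * F 0 0 = 1.
      by move=> /(congr1 (fun Q : 'M[R]_1 => Q 0 0)); rewrite m00 t00 mxE.
    have := sq _ (A1 (rleft z)); have := sq _ (B1 (rright z)).
    have := sq _ (A1 (rleft z')); have := sq _ (B1 (rright z')).
    move: (A _ 0 0) (A (rleft z') 0 0) (B _ 0 0) (B (rright z') 0 0) => a a' b b'.
    move=> bb' aa' bb aa; split.
      rewrite (_ : - c * - c' * _ = (c * c') * (a * a') * (b * b) * (b' * b')); last by ring.
      by rewrite bb bb'; ring.
    have -> : b * (b' * (a' * b')) = (b' * b') * (b * a') by ring.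
    have -> : b * (a * b) * b' = (b * b) * (a * b') by ring.
    by rewrite bb bb'; ring.
  + have -> : i = lshift p.+2 ord0 by exact: val_inj.
    have -> : j = lshift p.+2 (lift ord0 ord0) by exact: val_inj.
    rewrite tr_block_mx mulmx_block !trmx_scale_mul !block_mxEul.
    exact: conformalD.
Qed.
End MoreFamilies.

(** * Binomial coefficients mod 2, from [(1 + x)^(2^s) = 1 + x^(2^s)] *)

Lemma odd_bin_pow2 s a :
  (forall b, (b < 2 ^ s)%N -> odd 'C(2 ^ s + a, b) = odd 'C(a, b)) /\
  (forall b, odd 'C(2 ^ s + a, 2 ^ s + b) = odd 'C(a, 2 ^ s + b) (+) odd 'C(a, b)).
Proof.
elim: s a => [|s IH] a.
  split=> b; first by rewrite ltnS leqn0 => /eqP->; rewrite !bin0.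
  by rewrite expn0 !add1n binS oddD.
rewrite expnS mul2n -addnn; move: IH; move: (2 ^ s)%N => q IH.
have [l1 l2] := IH (q + a)%N; have [r1 r2] := IH a.
split=> b => [bq|]; last first.
  by rewrite -!addnA l2 [in X in X (+) _]r2 r2; do 3!case: odd.
have [bq'|qb] := ltnP b q; first by rewrite -addnA l1 // r1.
by rewrite -(subnKC qb) -addnA l2 r2 r1 ?ltn_subLR // -addbA addbb addbF.
Qed.

Lemma odd_bin_pow2D s a b : (b < 2 ^ s)%N -> odd 'C(2 ^ s + a, b) = odd 'C(a, b).
Proof. by have [H _] := odd_bin_pow2 s a; exact: H. Qed.

Lemma odd_bin_pow2_pred t j : (j < 2 ^ t)%N -> odd 'C((2 ^ t).-1, j).
Proof.
elim: j => [|j IH] jt; first by rewrite bin0.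
have := odd_bin_pow2D 0 jt; rewrite addn0 bin0n /=.
by rewrite -(prednK (expn_gt0 2 t)) binS oddD IH ?(ltnW jt) //; case: odd.
Qed.

(** Lucas' rule for the last binary digit. *)
Lemma odd_bin_double a b : [/\ odd 'C(a.*2, b.*2) = odd 'C(a, b), odd 'C(a.*2, b.*2.+1) = false &
   odd 'C(a.*2.+1, b.*2) = odd 'C(a, b)].
Proof.
have step c : odd 'C(c.*2, b.*2) = odd 'C(c, b) -> (forall b', odd 'C(c.*2, b'.*2.+1) = false) ->
    odd 'C(c.*2.+1, b.*2) = odd 'C(c, b).
  by case: b => [|b'] H H'; rewrite ?bin0 // doubleS binS oddD -doubleS H H' addbF.
suff H : forall b, odd 'C(a.*2, b.*2) = odd 'C(a, b) /\ odd 'C(a.*2, b.*2.+1) = false.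
  by have [H1 H2] := H b; split=> //; apply: step => // b'; have [] := H b'.
elim: a {b step} => [|a IH] b; first by split; rewrite ?bin0n // -?muln2; case: b.
rewrite doubleS; split; last first.
  rewrite binS oddD; case: b => [|b].
    by rewrite bin0 bin1 /= odd_double.
  have [_ H2] := IH b.+1; have [_ H2'] := IH b.
  by rewrite !doubleS !binS !oddD -doubleS H2 H2' addFb addbF addbb.
case: b => [|b]; first by rewrite !bin0.
rewrite doubleS !binS !oddD.
have [] := IH b.+1; rewrite doubleS => -> _; have [-> ->] := IH b.
by rewrite addbF addFb.
Qed.

(** * Hopf-Stiefel sizes of equivariant frames *)

Section HopfStiefel.
Local Open Scope nat_scope.

(* A join of N points, its double cover being S^(N-1) up to collapsing; the
   recursion along powers of 2 is the one of the Hopf-Stiefel function. *)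
Fixpoint shape t N : gluing := if t is t'.+1 then
    if (N <= 2 ^ t')%N then shape t' N else node (shape t' (2 ^ t')) (shape t' (N - 2 ^ t'))
  else leaf.

Lemma good_shape t N : good (shape t N).
Proof.
elim: t N => [|t IH] N /=; first exact: good_leaf.
by case: ifP => _; [exact: IH|exact: good_node].
Qed.

Lemma card_shape t N : (0 < N <= 2 ^ t)%N -> #|shape t N| = N.-1.
Proof.
elim: t N => [|t IH] N /=; first by rewrite card_void expn0; case: N => [|[]].
case/andP=> N0; rewrite expnS mul2n -addnn => Nt; case: leqP => tN; first by rewrite IH // N0.
have t0 : (0 < 2 ^ t)%N by rewrite expn_gt0.
rewrite card_node !IH; [|by rewrite subn_gt0 tN leq_subLR|by rewrite t0 leqnn].
by move: Nt tN t0; move: (2 ^ t)%N => q; lia.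
Qed.

Variable R : realType.

Lemma has_family_square t N : (0 < N <= 2 ^ t)%N -> has_family R (shape t N) (2 ^ t) (2 ^ t).
Proof.
elim: t N => [|t IH] N /=; first by move=> _; exact: has_family_leaf.
case/andP=> N0; rewrite expnS mul2n -addnn => Nt; case: leqP => tN.
  case: t IH Nt tN => [|t] IH Nt tN; first exact: has_family_leaf.
  have IHN := IH N (introT andP (conj N0 tN)).
  by apply: has_family_diag => //; rewrite -[X in (X < _)%N](expn0 2) ltn_exp2l.
apply: has_family_double; apply: IH; first by rewrite expn_gt0 leqnn.
by rewrite subn_gt0 tN leq_subLR.
Qed.

(** Cutting at [2 ^ t] follows the recursion of the Hopf-Stiefel function: if only [l] is large the
    columns are split block-diagonally, if only [N] is large the rows are split as in a join, and if
    both are large the square family of order [2 ^ t.+1] is cut down. The odd binomial coefficient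
    is carried along since it is what [stiefel_family] compares with the definition of [J]. *)
Lemma has_family_hopf t l N : (0 < l <= 2 ^ t)%N -> (0 < N <= 2 ^ t)%N ->
  exists2 j, (j < N)%N && odd 'C(l.-1 + j, j) & has_family R (shape t N) (l + j) l.
Proof.
elim: t l N => [|t IH] l N /=.
  rewrite expn0; case: l => [|[|]] //; case: N => [|[|]] // _ _.
  by exists 0%N; rewrite ?bin0 // addn0; exact: has_family_leaf.
case/andP=> l0 lt /andP[N0 Nt]; have q0 : (0 < 2 ^ t)%N by rewrite expn_gt0.
have qq : (2 ^ t.+1 = 2 ^ t + 2 ^ t)%N by rewrite expnS mul2n addnn.
rewrite qq in lt Nt; case: (leqP N) => tN; case: (leqP l (2 ^ t)) => tl.
- by apply: IH; rewrite ?l0 ?N0.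
- have [j /andP[jN oj] F] : exists2 j, (j < N)%N && odd 'C((l - 2 ^ t).-1 + j, j) &
      has_family R (shape t N) (l - 2 ^ t + j) (l - 2 ^ t).
    by apply: IH; rewrite ?N0 // subn_gt0 tl leq_subLR.
  exists j; first rewrite jN /=.
    rewrite (_ : l.-1 + j = 2 ^ t + ((l - 2 ^ t).-1 + j))%N ?odd_bin_pow2D ?(leq_trans jN) //.
    by move: tl q0; move: (2 ^ t)%N => q; lia.
  (* For [t = 0] the leading block would be 1 x 1, too small for [has_family_diag]; here [l = 2],
     the test space is a point, and the identity matrix serves. *)
  have [t0|t0] := posnP t.
    have -> : (l = 2)%N by move: tl lt; rewrite t0 expn0; lia.
    rewrite t0 /=; apply: has_family_le (has_family_leaf _ _); exact: leq_addr.
  rewrite -{1 2}(subnKC (ltnW tl)) -addnA; apply: has_family_diag => //.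
    by rewrite -[X in (X < _)%N](expn0 2) ltn_exp2l.
  by apply: has_family_square; rewrite N0.
- have [j /andP[jN oj] F] : exists2 j, (j < N - 2 ^ t)%N && odd 'C(l.-1 + j, j) &
      has_family R (shape t (N - 2 ^ t)) (l + j) l.
    by apply: IH; rewrite ?l0 // subn_gt0 tN leq_subLR.
  exists (2 ^ t + j)%N.
    have binC a b : 'C(a + b, b) = 'C(a + b, a) by rewrite -[in RHS]bin_sub ?leq_addr // addKn.
    rewrite -ltn_subRL jN /= binC addnCA odd_bin_pow2D ?prednK //.
    by rewrite -binC.
  rewrite addnCA; apply: has_family_join => //.
  apply: has_family_cols_le tl _; apply: has_family_square.
  by rewrite q0 leqnn.
(* Then [l + j] is [2 ^ t.+1], and all entries of the row [2 ^ t.+1 - 1] of Pascal's triangle are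
   odd. *)
- exists (2 ^ t.+1 - l)%N.
    apply/andP; split; first by rewrite qq; move: tN tl; move: (2 ^ t)%N => q; lia.
    rewrite (_ : l.-1 + _ = (2 ^ t.+1).-1)%N; last by rewrite qq; move: lt l0; move: (2 ^ t)%N => q; lia.
    by apply: odd_bin_pow2_pred; rewrite ltn_subrL l0 qq addn_gt0 q0.
  rewrite subnKC ?qq // -qq; apply: (has_family_cols_le (l' := 2 ^ t.+1)%N); first by rewrite qq.
  have -> : node (shape t (2 ^ t)) (shape t (N - 2 ^ t)) = shape t.+1 N.
    by rewrite /= [N <= _]leqNgt tN.
  by apply: has_family_square; rewrite N0 qq.
Qed.

Lemma sphere_family q : (0 < q)%N -> exists O, [/\ good O, #|O| = q.-1 & has_family R O q 1].
Proof.
elim: q => // -[|q] IH _; first by exists leaf; split; [exact: good_leaf|rewrite card_void|exact: has_family_leaf].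
have [U [gO cO fO]] := IH isT; exists (node leaf U); split.
- exact: good_node good_leaf gO.
- by rewrite card_node card_void cO.
- by rewrite -(add1n q.+1); apply: has_family_join fO; exact: has_family_leaf.
Qed.

(** If the Hopf-Stiefel size [2k + j] exceeded [n], then [j = 2r] with [r <= m] would satisfy both
    conditions that define [J], whence [J <= r <= m <= J - 1]. The subtraction is not truncated,
    because [n - 2k <= 2J - 1] makes [J] positive. *)
Lemma stiefel_family n k J m : 1 <= k -> 2 * k <= n ->
  is_min (fun r => odd 'C(k + r - 1, k - 1) /\
          (n%:Z - 2 * k%:Z <= 2 * r%:Z - 1 <= n%:Z - 1)%R) J ->
  (0 <= m <= J - 1) -> exists Z, [/\ good Z, #|Z| = 2 * m & has_family R Z n (2 * k)].
Proof.
move=> k0 kn [[_ J1] Jmin] mJ; pose t := 2 * k + 2 * m.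
have t1 : (2 * k <= 2 ^ t)%N by apply: leq_trans (ltnW (ltn_expl t _)) => //; lia.
have t2 : (2 * m).+1 <= 2 ^ t by apply: leq_ltn_trans (ltn_expl t _) => //; lia.
have [||j /andP[jm oj] F] := @has_family_hopf t (2 * k) (2 * m).+1.
- by rewrite t1 andbT; lia.
- by rewrite t2.
exists (shape t (2 * m).+1); split; [exact: good_shape|by rewrite card_shape ?t2|].
apply: has_family_le F; rewrite leqNgt; apply/negP => nj.
(* An odd [j] would make [2k - 1 + j] even, and [C(2a, 2b + 1)] is even. *)
have [r jr] : exists r, j = r.*2.
  exists j./2; rewrite -[LHS]odd_double_half; case oj' : (odd j) => //; exfalso; move: oj.
  have -> : (2 * k).-1 + j = (k.-1 + j./2).+1.*2 by lia.
  have -> : j = j./2.*2.+1 by lia.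
  have -> : (j./2.*2.+1)./2 = j./2 by lia.
  by have [_ ->] := odd_bin_double (k.-1 + j./2).+1 j./2.
move: oj; rewrite jr (_ : (2 * k).-1 + r.*2 = (k.-1 + r).*2.+1); last by lia.
have [_ _ ->] := odd_bin_double (k.-1 + r) r => oj.
have : J <= r; last by lia.
apply: Jmin; split; last by lia.
rewrite (_ : k + r - 1 = k.-1 + r); last by lia.
by rewrite subn1 -[in X in odd X]bin_sub ?leq_addr // addKn.
Qed.

(** The frames contribute a test space of dimension [2m] and the directions a sphere of dimension
    [2nk - 1]; Lucas' rule halves both arguments of the resulting coefficient. *)
Lemma odd_bin_tensor n k m : 1 <= k -> 1 <= n ->
  'C(n * k + m - 1, n * k - 1) <> 0 %[mod 2] ->
  odd 'C(2 * m + (n * (2 * k)).-1, 2 * m).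
Proof.
move=> k0 n0; have nk : 0 < n * k by rewrite muln_gt0 n0.
rewrite mod0n modn2 => oC.
rewrite (_ : _ + _ = (n * k - 1 + m).*2.+1); last by rewrite mulnCA; lia.
rewrite mul2n; have [_ _ ->] := odd_bin_double (n * k - 1 + m) m.
rewrite -bin_sub ?leq_addl // addnK (_ : _ + m = n * k + m - 1); last by lia.
by apply: contra_notT oC => /negbTE->.
Qed.

End HopfStiefel.

HB.instance Definition _ (R : realType) m n :=
  Uniform_isComplete.Build 'M[R]_(m, n) (@mx_complete R m n).

(** * Smooth maps between spaces of matrices *)

Section Smooth.
Variable R : realType.
Implicit Types E F : normedModType R.

Lemma near0_is_diff E F (e : E -> F) (x : E) : (\forall y \near x, e y = 0) ->
  is_diff x e 0.
Proof.
move=> e0; have ex : e x = 0 := nbhs_singleton e0.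
have e1 : \forall h \near (0 : E), e (h + x) = 0.
  by move: e0; rewrite (near_shift 0 x) subr0.
have H : e \o shift x = cst (e x) + (\0 : {linear E -> F}) +o_ 0 id.
  apply/eqaddoP => _/posnumP[eps]; apply: filterS e1 => h eh.
  by rewrite /= !fctE /= ex eh addr0 subrr normr0 mulr_ge0.
have c0 : continuous (\0 : {linear E -> F}) by exact: cst_continuous.
have d0 : 'd e x = (\0 : {linear E -> F}) :> (E -> F) by exact: diff_unique.
by split; rewrite ?d0 //; apply/diff_locallyP; rewrite d0.
Qed.

Lemma near_differentiable E F (f g : E -> F) (x : E) :
  (\forall y \near x, f y = g y) -> differentiable f x -> differentiable g x.
Proof.
move=> fg df; have gf0 : \forall y \near x, (g - f) y = 0.
  by apply: filterS fg => y fgy; rewrite !fctE /= fgy subrr.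
have [dgf _] := near0_is_diff gf0.
rewrite (_ : g = f + (g - f)); last by rewrite addrC subrK.
exact: differentiableD.
Qed.

Lemma Cr_on_eq E F r (U : set E) (f g : E -> F) : open U ->
  (forall x, U x -> f x = g x) -> Cr_on r U f -> Cr_on r U g.
Proof.
move=> oU; elim: r f g => [|r IH] f g fg /=.
  move=> fc x Ux; have fgx : \forall y \near x, f y = g y.
    by apply: filterS (open_nbhs_nbhs (conj oU Ux)).
  rewrite /prop_for /continuous_at -(fg _ Ux); apply: cvg_trans (fc x Ux).
  by apply: near_eq_cvg.
move=> [df Df]; split=> [x Ux|v].
  by apply: near_differentiable (df x Ux); apply: filterS (open_nbhs_nbhs (conj oU Ux)).
apply: IH (Df v) => x Ux; apply: near_eq_derive.
by apply: filterS (open_nbhs_nbhs (conj oU Ux)).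
Qed.

Lemma Cr_on_sub E F r (U W : set E) (f : E -> F) : (forall x, W x -> U x) ->
  Cr_on r U f -> Cr_on r W f.
Proof.
move=> WU; elim: r f => [|r IH] f /=; first by move=> fc x /WU/fc.
by move=> [df Df]; split=> [x /WU/df|v] //; exact: IH.
Qed.

Lemma Cr_onW E F r (U : set E) (f : E -> F) : Cr_on r.+1 U f -> Cr_on r U f.
Proof.
elim: r f => [|r IH] f [df Df]; first by move=> x /df; exact: differentiable_continuous.
by split=> // v; exact: IH.
Qed.

Lemma Cr_on_cst E F r (U : set E) (a : F) : Cr_on r U (cst a).
Proof.
elim: r a => [|r IH] a /=; first by move=> x _; exact: cst_continuous.
split=> [x _|v]; first exact: differentiable_cst.
rewrite (_ : 'D_v (cst a) = cst 0); first exact: IH.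
by apply/funext => x; exact: derive_cst.
Qed.

Lemma Cr_on_linear E F r (U : set E) (f : {linear E -> F}) : continuous f -> Cr_on r U f.
Proof.
case: r => [|r] cf /=; first by move=> x _; exact: cf.
split=> [x _|v]; first exact: linear_differentiable.
rewrite (_ : 'D_v f = cst (f v)); first exact: Cr_on_cst.
apply/funext => x; rewrite deriveE ?diff_lin //; exact: linear_differentiable.
Qed.

Lemma Cr_onD E F r (U : set E) (f g : E -> F) : open U ->
  Cr_on r U f -> Cr_on r U g -> Cr_on r U (f + g).
Proof.
move=> oU; elim: r f g => [|r IH] f g /=.
  by move=> fc gc x Ux; apply: continuousD; [exact: fc|exact: gc].
move=> [df Df] [dg Dg]; split=> [x Ux|v].
  by apply: differentiableD; [exact: df|exact: dg].
apply: (Cr_on_eq (f := 'D_v f + 'D_v g)) => // [x Ux|]; last exact: IH.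
by rewrite deriveD //; apply: diff_derivable; [exact: df|exact: dg].
Qed.

Lemma Cr_onM E r (U : set E) (f g : E -> R^o) : open U ->
  Cr_on r U f -> Cr_on r U g -> Cr_on r U (f * g).
Proof.
move=> oU; elim: r f g => [|r IH] f g.
  by move=> fc gc x Ux; apply: continuousM; [exact: fc|exact: gc].
move=> fC gC; have [df Df] := fC; have [dg Dg] := gC; split=> [x Ux|v].
  by apply: differentiableM; [exact: df|exact: dg].
apply: (Cr_on_eq (f := f * 'D_v g + g * 'D_v f)) => // [x Ux|].
  by rewrite deriveM //; apply: diff_derivable; [exact: df|exact: dg].
by apply: Cr_onD; [exact: oU|exact: IH (Cr_onW fC) (Dg v)|exact: IH (Cr_onW gC) (Df v)].
Qed.

Lemma Cr_onV E r (U : set E) (f : E -> R^o) : open U -> (forall x, U x -> f x != 0) ->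
  Cr_on r U f -> Cr_on r U (fun x => (f x)^-1 : R^o).
Proof.
move=> oU f0; elim: r => [|r IH] fC.
  by move=> x Ux; apply: continuousV; [exact: f0|exact: fC].
have [df Df] := fC; have iC := IH (Cr_onW fC); split=> [x Ux|v].
  by apply: differentiableV; [exact: df|exact: f0].
apply: (Cr_on_eq (f := cst (-1) * ((fun x => (f x)^-1) * (fun x => (f x)^-1)) * 'D_v f)) => // [x Ux|].
  rewrite deriveV ?f0 //; last by apply: diff_derivable; exact: df.
  by rewrite !fctE /= mulN1r -invfM -expr2.
have iiC := Cr_onM oU iC iC.
by apply: Cr_onM; [exact: oU| |exact: Df]; apply: Cr_onM; [exact: oU|exact: Cr_on_cst|exact: iiC].
Qed.

Lemma sqrt_diff (y : R) : 0 < y -> differentiable (@Num.sqrt R : R^o -> R^o) y.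
Proof. by move=> y0; apply/derivable1_diffP; have [] := is_derive1_sqrt y0. Qed.

Lemma Cr_on_sqrt E r (U : set E) (f : E -> R^o) : open U -> (forall x, U x -> 0 < f x) ->
  Cr_on r U f -> Cr_on r U (fun x => Num.sqrt (f x) : R^o).
Proof.
move=> oU f0; elim: r => [|r IH] fC.
  by move=> x Ux; apply: (continuous_comp (fC x Ux)); exact: sqrt_continuous.
have [df Df] := fC; have sC := IH (Cr_onW fC); split=> [x Ux|v].
  by apply: differentiable_comp; [exact: df|apply: sqrt_diff; exact: f0].
apply: (Cr_on_eq (f := (fun x => (Num.sqrt (f x))^-1) * (cst (2^-1) * 'D_v f))) => // [x Ux|]; last first.
  apply: Cr_onM; first exact: oU.
    by apply: Cr_onV; [exact: oU|move=> x /f0; rewrite sqrtr_eq0 -ltNge|exact: sC].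
  by apply: Cr_onM; [exact: oU|exact: Cr_on_cst|exact: Df].
have dfx := df x Ux; have ds := sqrt_diff (f0 x Ux).
rewrite [RHS]deriveE; last by apply: differentiable_comp.
rewrite (diff_comp dfx ds) /= -['d f x v]deriveE // deriv1E; last by apply/derivable1_diffP.
rewrite derive1E derive_sqrt ?f0 // !fctE /= invfM mulrA mulrC; congr (_ * _).
by rewrite mulrC.
Qed.

Lemma Cr_on_sum E r (U : set E) (I : Type) (s : seq I) (F : I -> E -> R^o) : open U ->
  (forall i, Cr_on r U (F i)) -> Cr_on r U (fun x => \sum_(i <- s) F i x : R^o).
Proof.
move=> oU FC; elim: s => [|i s IH].
  rewrite (_ : (fun _ => _) = cst 0); first exact: Cr_on_cst.
  by apply/funext => x; rewrite big_nil.
rewrite (_ : (fun _ => _) = F i + (fun x => \sum_(j <- s) F j x)); first exact: Cr_onD.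
by apply/funext => x; rewrite big_cons.
Qed.

Lemma Cr_on_prod E r (U : set E) (I : Type) (s : seq I) (F : I -> E -> R^o) : open U ->
  (forall i, Cr_on r U (F i)) -> Cr_on r U (fun x => \prod_(i <- s) F i x : R^o).
Proof.
move=> oU FC; elim: s => [|i s IH].
  rewrite (_ : (fun _ => _) = cst 1); first exact: Cr_on_cst.
  by apply/funext => x; rewrite big_nil.
rewrite (_ : (fun _ => _) = F i * (fun x => \prod_(j <- s) F j x)); first exact: Cr_onM.
by apply/funext => x; rewrite big_cons.
Qed.

Lemma Cr_on_det E r (U : set E) m (A : E -> 'M[R]_m) : open U ->
  (forall i j, Cr_on r U (fun x => A x i j : R^o)) -> Cr_on r U (fun x => \det (A x) : R^o).
Proof.
move=> oU AC; apply: Cr_on_sum => // s.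
have pC : Cr_on r U (fun x => \prod_i A x i (s i) : R^o) by exact: Cr_on_prod.
apply: (Cr_on_eq oU _ (Cr_onM oU (@Cr_on_cst _ R^o r U ((-1) ^+ s)) pC)) => x _.
by rewrite !fctE.
Qed.

Lemma mx_norm_lt m n (A : 'M[R]_(m, n)) (e : R) : 0 < e ->
  (forall i j, `|A i j| < e) -> `|A| < e.
Proof. by move=> e0 Ae; rewrite [`|A|]mx_normrE; apply: bigmax_lt => // -[i j] _; exact: Ae. Qed.

Lemma mx_norm_le m n (A : 'M[R]_(m, n)) (e : R) : 0 <= e ->
  (forall i j, `|A i j| <= e) -> `|A| <= e.
Proof. by move=> e0 Ae; rewrite [`|A|]mx_normrE; apply: bigmax_le => // -[i j] _; exact: Ae. Qed.

Lemma entry_le_norm m n (A : 'M[R]_(m, n)) i j : `|A i j| <= `|A|.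
Proof. by rewrite [`|A|]mx_normrE; exact: (le_bigmax _ (fun p : 'I_m * 'I_n => `|A p.1 p.2|) (i, j)). Qed.

Lemma mulmx_norm m n p (A : 'M[R]_(m, n)) (B : 'M[R]_(n, p)) : `|A *m B| <= n%:R * `|A| * `|B|.
Proof.
apply: mx_norm_le => [|i j]; first by rewrite !mulr_ge0.
rewrite mxE (le_trans (ler_norm_sum _ _ _)) //.
rewrite -mulrA mulr_natl -[X in _ *+ X]card_ord -sumr_const ler_sum // => k _.
by rewrite normrM ler_pM // entry_le_norm.
Qed.

Lemma trmx_norm m n (A : 'M[R]_(m, n)) : `|A^T| = `|A|.
Proof.
apply/eqP; rewrite eq_le; apply/andP; split; apply: mx_norm_le => // i j.
  by rewrite mxE entry_le_norm.
by have := entry_le_norm A^T j i; rewrite mxE.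
Qed.

Lemma cvg_mx (T : Type) (F : set_system T) (FF : Filter F) m n (f : T -> 'M[R]_(m, n)) (A : 'M[R]_(m, n)) :
  (forall i j, (fun x => f x i j) @ F --> A i j) -> f @ F --> A.
Proof.
move=> fA; apply/cvgrPdist_lt => e e0.
have H : \forall x \near F, forall p : 'I_m * 'I_n, `|A p.1 p.2 - f x p.1 p.2| < e.
  by apply: filter_forall => p; apply: (cvgrPdist_lt _ _).1 e0; exact: fA.
apply: filterS H => x H; apply: mx_norm_lt => // i j.
by have := H (i, j); rewrite !mxE.
Qed.

Lemma differentiable_mx E m n (f : E -> 'M[R]_(m, n)) (x : E) :
  (forall i j, differentiable (fun y => f y i j : R^o) x) -> differentiable f x.
Proof.
move=> fd; rewrite (_ : f = \sum_(i < m) \sum_(j < n) (fun y => (f y i j : R^o) *: delta_mx i j)).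
  by apply: differentiable_sum => i; apply: differentiable_sum => j; exact: differentiableZl.
apply/funext => y; rewrite fct_sumE [LHS]matrix_sum_delta; apply: eq_bigr => i _.
by rewrite fct_sumE.
Qed.

Lemma derive_mxE E m n (f : E -> 'M[R]_(m, n)) (x v : E) i j :
  derivable f x v -> ('D_v f x) i j = 'D_v (fun y => f y i j : R^o) x.
Proof.
move=> fd; apply/esym/cvg_lim => //.
have H := (@cvg_comp _ _ _ _ (fun M : 'M[R]_(m, n) => M i j) _ _ _ fd (@coord_continuous _ _ _ i j _)).
apply: cvg_trans H; apply: near_eq_cvg; apply: nearW => h /=.
by rewrite !mxE.
Qed.

Lemma Cr_on_mx E m n r (U : set E) (f : E -> 'M[R]_(m, n)) : open U ->
  (forall i j, Cr_on r U (fun x => f x i j : R^o)) -> Cr_on r U f.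
Proof.
move=> oU; elim: r f => [|r IH] f fC.
  by move=> x Ux; apply: cvg_mx => i j; exact: fC.
have fd x : U x -> differentiable f x.
  by move=> Ux; apply: differentiable_mx => i j; have [H _] := fC i j; exact: H.
split=> // v; apply: IH => i j; have [_ H] := fC i j.
apply: Cr_on_eq (H v) => // x Ux; rewrite derive_mxE //; apply: diff_derivable; exact: fd.
Qed.

Lemma diff_mxE (F : normedModType R) m n (f : 'M[R]_(m, n) -> F) (x v : 'M[R]_(m, n)) :
  differentiable f x -> 'd f x v = \sum_i \sum_j v i j *: 'D_(delta_mx i j) f x.
Proof.
move=> fd; rewrite {1}[v]matrix_sum_delta linear_sum; apply: eq_bigr => i _.
by rewrite linear_sum; apply: eq_bigr => j _; rewrite linearZ /= deriveE.
Qed.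

(** An inverse function theorem with explicit radius, used both for the linear equation of
    [pert_solve] and for the quadratic one of [theta_surj]. *)
Lemma contraction_solve m n (T : 'M[R]_(m, n) -> 'M[R]_(m, n)) (r : R) : 0 <= r ->
  (forall x, `|x| <= r -> `|T x| <= r) ->
  (forall x y, `|x| <= r -> `|y| <= r -> `|T x - T y| <= 2^-1 * `|x - y|) ->
  exists2 p, `|p| <= r & p = T p.
Proof.
move=> r0 TB TL; pose B : set 'M[R]_(m, n) := [set x | `|x| <= r].
have TF : {homo T : x / B x >-> B x} by move=> x; exact: TB.
pose T' : {fun B >-> B} := mkfun_fun TF.
have cB : closed B.
  by apply: (@closed_comp _ _ (fun x : 'M[R]_(m, n) => `|x|) [set y | y <= r]) => [x _|]; [exact: norm_continuous|exact: closed_le].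
have Tc : is_contraction T'.
  exists (2^-1)%:nng; split; first by rewrite /= invf_lt1 // ltr1n.
  by move=> [x y] [/= Bx By]; exact: TL.
have [|p Bp pT] := banach_fixed_point Tc cB; first by exists 0; rewrite /B /= normr0.
by exists p.
Qed.

End Smooth.

Lemma cvg_bigsum (R : realType) (V : normedModType R) (T I : Type) (F : set_system T)
    (FF : Filter F) (r : seq I) (f : I -> T -> V) (a : I -> V) :
  (forall i, f i @ F --> a i) -> (fun x => \sum_(i <- r) f i x) @ F --> \sum_(i <- r) a i.
Proof.
move=> fa; elim: r => [|i r IH].
  rewrite big_nil (_ : (fun _ => _) = cst 0); first exact: cvg_cst.
  by apply/funext => x; rewrite big_nil.
rewrite big_cons (_ : (fun _ => _) = fun x => f i x + \sum_(j <- r) f j x).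
  by apply: cvgD.
by apply/funext => x; rewrite big_cons.
Qed.

(** * Curves in the Stiefel manifold *)

Section Cayley.
Variables (R : realType) (n l : nat).
Implicit Types (X v : 'M[R]_(n, l)) (K : 'M[R]_n).

(** This is [(1 + tK)(1 - tK)^-1 X], the Cayley transform of [tK] applied to [X]. For skew [K] it is
    defined for all [t], rational in [t], and stays in the Stiefel manifold, so it replaces the
    exponential. *)
Definition cayley K (t : R) X := 2 *: (invmx (1%:M - t *: K) *m X) - X.

Lemma rV_sqr_eq0 m (x : 'rV[R]_m) : x *m x^T = 0 -> x = 0.
Proof.
move=> /matrixP/(_ 0 0); rewrite !mxE => /eqP.
rewrite psumr_eq0 => [/allP x0|i _]; last by rewrite mxE -expr2 sqr_ge0.
apply/rowP => i; have := x0 i (mem_index_enum _); rewrite !mxE -expr2 sqrf_eq0.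
by move=> /eqP.
Qed.

(** A row [x] killed by [1 - tK] satisfies [x = t x K], hence [x x^T = t x K x^T], which vanishes
    for skew [K]. *)
Lemma skew_unitmx K (t : R) : K^T = - K -> 1%:M - t *: K \in unitmx.
Proof.
move=> KK; rewrite -row_free_unit; apply/row_freeP; exists (invmx (1%:M - t *: K)).
apply: mulmxV; rewrite unitmxE -det_tr; apply/negPn/negP => nu.
have /det0P[x x0 xK] : \det (1%:M - t *: K) == 0.
  by apply: contraNT nu => d0; rewrite det_tr unitfE.
apply/negP: x0; rewrite negbK; apply/eqP/rV_sqr_eq0.
have xE : x = t *: (x *m K).
  by apply/eqP; rewrite scalemxAr -subr_eq0 -{1}[x]mulmx1 -mulmxBr xK.
have sk : x *m K *m x^T = 0.
  have e : (x *m K *m x^T)^T = - (x *m K *m x^T).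
    by rewrite !trmx_mul trmxK KK mulNmx mulmxN mulmxA.
  move: e; move: (_ *m x^T) => s /matrixP e; apply/matrixP => i j; rewrite !ord1.
  have := e 0 0; rewrite !mxE => /eqP; rewrite -addr_eq0 -mulr2n mulrn_eq0 /=.
  by move=> /eqP.
by rewrite {1}xE -scalemxAl sk scaler0.
Qed.

Lemma cayley0 K X : cayley K 0 X = X.
Proof.
by rewrite /cayley scale0r subr0 invmx1 mul1mx scaler_nat mulr2n addrK.
Qed.

(** The implicit midpoint form of the transform: the difference quotient at 0 becomes
    [K (cayley K t X + X)], and continuity alone gives the derivative. *)
Lemma cayleyE K (t : R) X : K^T = - K -> cayley K t X = X + t *: (K *m (cayley K t X + X)).
Proof.
move=> KK; have u := skew_unitmx t KK.
have : (1%:M - t *: K) *m (cayley K t X + X) = 2 *: X.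
  by rewrite /cayley subrK -scalemxAr mulmxA mulmxV // mul1mx.
rewrite mulmxBl mul1mx -scalemxAl => /eqP; rewrite subr_eq => /eqP e.
by apply: (addIr X); rewrite {1}e scaler_nat mulr2n addrAC.
Qed.

Lemma cayley_stiefel K (t : R) X : K^T = - K -> (cayley K t X)^T *m cayley K t X = X^T *m X.
Proof.
move=> KK; have u := skew_unitmx t KK; set M := 1%:M - t *: K in u *.
have MT : M^T = 1%:M + 1%:M - M.
  by rewrite /M linearB /= trmx1 linearZ /= KK; apply/matrixP => i j; rewrite !mxE; ring.
have cE : cayley K t X = M^T *m (invmx M *m X).
  by rewrite MT mulmxBl mulmxDl mul1mx mulmxA mulmxV // mul1mx /cayley scaler_nat mulr2n.
have MC : M *m M^T = M^T *m M.
  rewrite MT; move: M {u MT cE} => M.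
  by rewrite mulmxBl mulmxBr mulmxDl mulmxDr mul1mx mulmx1.
rewrite cE !trmx_mul trmxK -!mulmxA (mulmxA M) MC -!mulmxA (mulmxA M) mulmxV // mul1mx.
by rewrite trmx_inv (mulmxA (invmx _)) mulVmx ?unitmx_tr // mul1mx.
Qed.

Lemma cayley_smooth K X : K^T = - K -> smooth_on setT (fun t : R^o => cayley K t X).
Proof.
move=> KK r; have oT : open (@setT R^o) := openT.
have entryC i j : Cr_on r setT (fun t : R^o => (1%:M - t *: K) i j : R^o).
  apply: (Cr_on_eq oT (f := cst ((1%:M : 'M[R]_n) i j) + (fun t : R^o => (- K i j) *: t))).
    move=> t _; rewrite [RHS]mxE [(- (t *: K)) i j]mxE [(t *: K) i j]mxE.
    by rewrite fctE -[_ *: t]/(- K i j * t) mulNr mulrC.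
  apply: Cr_onD => //; first exact: Cr_on_cst.
  apply: (@Cr_on_linear _ _ _ r setT (GRing.scale (- K i j) : {linear R^o -> R^o})).
  exact: scaler_continuous.
have detC := Cr_on_det oT entryC.
have detV : Cr_on r setT (fun t : R^o => (\det (1%:M - t *: K))^-1 : R^o).
  apply: Cr_onV => // t _; have := skew_unitmx t KK; by rewrite unitmxE unitfE.
apply: Cr_on_mx => // i j.
apply: (Cr_on_eq oT (f := cst 2 * (fun t : R^o => \sum_k ((\det (1%:M - t *: K))^-1 *
   cofactor (1%:M - t *: K) k i * X k j)) + cst (- X i j))).
  move=> t _; rewrite !mxE !fctE; congr (_ * _ - _); apply: eq_bigr => k _.
  by rewrite /invmx skew_unitmx // !mxE.
apply: Cr_onD => //; last exact: Cr_on_cst.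
apply: Cr_onM => //; first exact: Cr_on_cst.
apply: Cr_on_sum => // k.
apply: (Cr_onM (f := (fun t : R^o => (\det (1%:M - t *: K))^-1) * (fun t : R^o => cofactor (1%:M - t *: K) k i))
   (g := cst (X k j))) => //; last exact: Cr_on_cst.
apply: Cr_onM => //.
rewrite /cofactor; apply: (Cr_onM (f := cst ((-1) ^+ (k + i)))
  (g := fun t : R^o => \det (row' k (col' i (1%:M - t *: K))))) => //; first exact: Cr_on_cst.
apply: Cr_on_det => // a b.
by apply: (Cr_on_eq oT _ (entryC (lift k a) (lift i b))) => t _; rewrite [RHS]mxE [RHS]mxE.
Qed.

Lemma cayley_derive K X : K^T = - K ->
  is_derive (0 : R^o) 1 (fun t : R^o => cayley K t X) (2 *: (K *m X)).
Proof.
move=> KK; have [cD _] := cayley_smooth X KK 1.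
have cc : {for (0 : R^o), continuous (fun t : R^o => cayley K t X)}.
  by apply: differentiable_continuous; exact: cD.
split; first by apply: diff_derivable; exact: cD.
apply: cvg_lim => //.
have H : (fun t : R^o => K *m (cayley K t X + X)) @ (0 : R^o)^' --> 2 *: (K *m X).
  have -> : 2 *: (K *m X) = K *m (cayley K 0 X + X).
    by rewrite cayley0 mulmxDr scaler_nat mulr2n.
  apply: cvg_mx => i j; rewrite mxE.
  rewrite (_ : (fun _ => _) = fun t : R^o => \sum_k K i k * (cayley K t X k j + X k j)); last first.
    by apply/funext => t; rewrite mxE; apply: eq_bigr => k _; rewrite mxE.
  apply: (@cvg_bigsum _ R^o) => k; apply: (@cvgM _ R^o); first exact: cvg_cst.
  rewrite mxE; apply: cvgD; last exact: cvg_cst.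
  apply: (@cvg_comp _ _ _ (fun t : R^o => cayley K t X) (fun M : 'M[R]_(n, l) => M k j) _
    (nbhs (cayley K 0 X))); last exact: coord_continuous.
  by apply: cvg_trans cc; apply: cvg_app; exact: cvg_within.
apply: cvg_trans H; apply: near_eq_cvg.
near=> h; have h0 : h != 0 by near: h; exact: nbhs_dnbhs_neq.
rewrite /= addr0 cayley0 [h *: 1]mulr1 [X in h^-1 *: (X - _)]cayleyE //.
by rewrite [X in X - _]addrC addrK scalerA mulVf // scale1r.
Unshelve. all: by end_near. Qed.

Definition tangent X v := X^T *m v + v^T *m X = 0.

(** Chosen so that [2 K X = v] for tangent [v]. The first two terms give [v - X v^T X], and the
    third contributes [- X X^T v], which cancels the excess because [X^T v] is skew. *)
Definition generator X v := 2^-1 *: (v *m X^T - X *m v^T - X *m (X^T *m v) *m X^T).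

Definition curve X v (t : R) := cayley (generator X v) t X.

Lemma generator_skew X v : tangent X v -> (generator X v)^T = - generator X v.
Proof.
move=> /eqP; rewrite addr_eq0 => /eqP tv; rewrite /generator linearZ /= -scalerN; congr (_ *: _).
have e1 : (v *m X^T)^T = X *m v^T by rewrite trmx_mul trmxK.
have e2 : (X *m v^T)^T = v *m X^T by rewrite trmx_mul trmxK.
have e3 : (X *m (X^T *m v) *m X^T)^T = X *m (v^T *m X) *m X^T.
  by rewrite !trmx_mul !trmxK -!mulmxA.
rewrite [LHS]linearB /= [X in X - _]linearB /= e1 e2 e3 tv mulmxN mulNmx opprK.
by rewrite opprD opprB.
Qed.

Lemma generatorE X v : X^T *m X = 1%:M -> tangent X v -> 2 *: (generator X v *m X) = v.
Proof.
move=> XX /eqP; rewrite addr_eq0 => /eqP tv.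
rewrite /generator -scalemxAl scalerA mulfV // scale1r !mulmxBl -!mulmxA XX !mulmx1.
by rewrite tv mulmxN opprK subrK.
Qed.

Lemma tangent_curve X v : X^T *m X = 1%:M -> tangent X v ->
  [/\ smooth_on setT (curve X v : R^o -> _), curve X v 0 = X,
      forall t, (curve X v t)^T *m curve X v t = 1%:M &
      is_derive (0 : R^o) 1 (curve X v : R^o -> _) v].
Proof.
move=> XX tv; have gs := generator_skew tv; split.
- exact: cayley_smooth.
- exact: cayley0.
- by move=> t; rewrite cayley_stiefel.
- by rewrite -{2}(generatorE XX tv); exact: cayley_derive.
Qed.

Lemma tangent_tangent_vectors X v : X^T *m X = 1%:M -> tangent X v ->
  tangent_vectors (stiefel R n l) X v.
Proof.
move=> XX tv; have [cs c0 cS cd] := tangent_curve XX tv.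
by exists (curve X v); split=> //; rewrite derive1E (@derive_val _ _ _ _ _ _ _ cd).
Qed.

End Cayley.

(** * Charts of the quotient *)

Section Rotations.
Variables (R : realType) (k : nat).
Local Notation l := (2 * k)%N.

Definition j2 : 'M[R]_2 := \matrix_(i, j) (i%:R - j%:R).
Definition J : 'M[R]_l := diagSO2 k j2.
Definition rot (a b : R) : 'M[R]_l := a%:M + b *: J.

Lemma j2_sqr : j2 *m j2 = - 1%:M.
Proof.
apply/matrixP => i j; rewrite !mxE !big_ord_recl big_ord0 !mxE.
case: i => [[|[|]]] // ?; case: j => [[|[|]]] // ?; rewrite -?val_eqE /= ?/bump /= ?mulr1n ?mulr0n; try ring.
Qed.

Lemma j2_tr : j2^T = - j2.
Proof. by apply/matrixP => i j; rewrite !mxE opprB. Qed.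

Lemma diagSO2D (A B : 'M[R]_2) : diagSO2 k (A + B) = diagSO2 k A + diagSO2 k B.
Proof. by apply/matrixP => i j; rewrite !mxE; case: ifP => _; rewrite ?addr0. Qed.

Lemma diagSO2Z (a : R) (A : 'M[R]_2) : diagSO2 k (a *: A) = a *: diagSO2 k A.
Proof. by apply/matrixP => i j; rewrite !mxE; case: ifP => _; rewrite ?mulr0 ?mxE. Qed.

Lemma diagSO2_tr (A : 'M[R]_2) : diagSO2 k A^T = (diagSO2 k A)^T.
Proof. by apply/matrixP => i j; rewrite !mxE eq_sym; case: ifP. Qed.

Lemma diagSO2_rot (a b : R) : diagSO2 k (a%:M + b *: j2) = rot a b.
Proof. by rewrite diagSO2D diagSO2Z -[a%:M]scalemx1 diagSO2Z diagSO2_1 scalemx1. Qed.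

Lemma J_sqr : J *m J = - 1%:M.
Proof. by rewrite /J diagSO2M j2_sqr -scaleN1r diagSO2Z diagSO2_1 scaleN1r. Qed.

Lemma J_tr : J^T = - J.
Proof. by rewrite /J -diagSO2_tr j2_tr -scaleN1r diagSO2Z scaleN1r. Qed.

Lemma rotM a b c d : rot a b *m rot c d = rot (a * c - b * d) (a * d + b * c).
Proof.
rewrite /rot mulmxDl !mulmxDr -scalar_mxM mul_scalar_mx mul_mx_scalar.
rewrite -scalemxAl -scalemxAr J_sqr !scalerA scalerN scalerDl scalemx1 raddfB /=.
by rewrite [c * b]mulrC; apply/matrixP => i j; rewrite !mxE; ring.
Qed.

Lemma rot_tr a b : (rot a b)^T = rot a (- b).
Proof. by rewrite /rot linearD /= tr_scalar_mx linearZ /= J_tr scalerN scaleNr. Qed.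

Lemma rot10 : rot 1 0 = 1%:M.
Proof. by rewrite /rot scale0r addr0. Qed.

Lemma rotZ (c a b : R) : c *: rot a b = rot (c * a) (c * b).
Proof. by rewrite /rot scalerDr scalerA scale_scalar_mx. Qed.

Lemma rotN a b : rot (- a) (- b) = - rot a b.
Proof. by rewrite -[in RHS]scaleN1r rotZ !mulN1r. Qed.

Lemma det2 (A : 'M[R]_2) : \det A = A 0 0 * A 1 1 - A 0 1 * A 1 0.
Proof.
have o2 : lift ord0 ord0 = 1 :> 'I_2 by exact: val_inj.
have o0 : lift 1 ord0 = 0 :> 'I_2 by exact: val_inj.
rewrite (expand_det_row _ 0) !big_ord_recl big_ord0 /cofactor !det_mx11 !mxE !o2 !o0.
by rewrite /= expr0 expr1 mul1r addr0 mulN1r mulrN.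
Qed.

Lemma SO2P (A : 'M[R]_2) : SO R 2 A <-> exists a b, a ^+ 2 + b ^+ 2 = 1 /\ A = a%:M + b *: j2.
Proof.
have o2 : lift ord0 ord0 = 1 :> 'I_2 by exact: val_inj.
have m2 (C B : 'M[R]_2) i j : (C^T *m B) i j = C 0 i * B 0 j + C 1 i * B 1 j.
  by rewrite !mxE !big_ord_recl big_ord0 !mxE addr0 o2.
split=> [[AA dA]|[a [b [ab ->]]]]; last first.
  split.
    apply/matrixP => i j; rewrite m2 !mxE.
    case: i => [[|[|]]] // i_lt; case: j => [[|[|]]] // j_lt; rewrite -?val_eqE /= ?mulr1n ?mulr0n;
      first [ring | rewrite -[RHS]ab; ring].
  by rewrite det2 !mxE -[RHS]ab /= ?mulr1n ?mulr0n; ring.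
move: dA; rewrite det2 => dA.
have := congr1 (fun M : 'M[R]_2 => M 0 0) AA; have := congr1 (fun M : 'M[R]_2 => M 0 1) AA.
have := congr1 (fun M : 'M[R]_2 => M 1 1) AA; rewrite !m2 !mxE /= => e11 e01 e00.
have e1 : A 1 1 = A 0 0.
  transitivity (A 1 1 * (A 0 0 * A 0 0 + A 1 0 * A 1 0)); first by rewrite e00 mulr1.
  transitivity (A 0 0 * (A 0 0 * A 1 1 - A 0 1 * A 1 0) + A 1 0 * (A 0 0 * A 0 1 + A 1 0 * A 1 1)); first by ring.
  by rewrite dA e01; ring.
have e2 : A 0 1 = - A 1 0.
  transitivity (A 0 1 * (A 0 0 * A 0 0 + A 1 0 * A 1 0)); first by rewrite e00 mulr1.
  transitivity (- A 1 0 * (A 0 0 * A 1 1 - A 0 1 * A 1 0) + A 0 0 * (A 0 0 * A 0 1 + A 1 0 * A 1 1)); first by ring.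
  by rewrite dA e01; ring.
exists (A 0 0), (A 1 0); split; first by rewrite !expr2.
have I2 (i : 'I_2) : i = 0 \/ i = 1.
  by case: i => [[|[|]]] // ?; [left|right]; exact: val_inj.
apply/matrixP => i j; rewrite !mxE.
by case: (I2 i) => ->; case: (I2 j) => ->; rewrite /= ?e1 ?e2 ?mulr1n ?mulr0n; ring.
Qed.

Definition inner m (A B : 'M[R]_(m, l)) : R := \tr (A^T *m B).

Lemma innerC m (A B : 'M[R]_(m, l)) : inner A B = inner B A.
Proof. by rewrite /inner -mxtrace_tr trmx_mul trmxK. Qed.

Lemma innerDl m (A A' B : 'M[R]_(m, l)) : inner (A + A') B = inner A B + inner A' B.
Proof. by rewrite /inner linearD /= mulmxDl linearD. Qed.

Lemma innerZl m a (A B : 'M[R]_(m, l)) : inner (a *: A) B = a * inner A B.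
Proof. by rewrite /inner linearZ /= -scalemxAl linearZ. Qed.

Lemma innerNl m (A B : 'M[R]_(m, l)) : inner (- A) B = - inner A B.
Proof. by rewrite -scaleN1r innerZl mulN1r. Qed.

Lemma innerMr m (A B : 'M[R]_(m, l)) (Q : 'M[R]_l) : inner (A *m Q) B = inner A (B *m Q^T).
Proof. by rewrite /inner trmx_mul -mulmxA mxtrace_mulC mulmxA. Qed.

Lemma inner_sum m (A B : 'M[R]_(m, l)) : inner A B = \sum_j \sum_i A i j * B i j.
Proof. by apply: eq_bigr => j _; rewrite mxE; apply: eq_bigr => i _; rewrite mxE. Qed.

Lemma tr_sym_J (S : 'M[R]_l) : S^T = S -> \tr (S *m J) = 0.
Proof.
move=> SS; have : \tr (S *m J) = - \tr (S *m J).
  by rewrite -[LHS]mxtrace_tr trmx_mul SS J_tr mulNmx linearN /= mxtrace_mulC.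
by move/eqP; rewrite -addr_eq0 -mulr2n mulrn_eq0 /= => /eqP.
Qed.

Lemma inner_sym_J m (X : 'M[R]_(m, l)) (S : 'M[R]_l) : X^T *m X = 1%:M -> S^T = S ->
  inner (X *m S) (X *m J) = 0.
Proof. by move=> XX SS; rewrite /inner trmx_mul SS -mulmxA (mulmxA X^T) XX mul1mx tr_sym_J. Qed.

Lemma inner_stiefel m (X : 'M[R]_(m, l)) : X^T *m X = 1%:M -> inner X X = l%:R.
Proof. by move=> XX; rewrite /inner XX mxtrace1. Qed.

Lemma inner_XJ m (X : 'M[R]_(m, l)) : inner X X = inner (X *m J) (X *m J).
Proof. by rewrite innerMr J_tr -mulmxA mulmxN J_sqr opprK mulmx1. Qed.

Lemma inner_XJ0 m (X Y : 'M[R]_(m, l)) : inner (X *m J) Y = - inner X (Y *m J).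
Proof. by rewrite innerMr J_tr mulmxN innerC innerNl innerC. Qed.

End Rotations.

(** * Linear coordinates orthogonal to the circle orbit *)

Definition upper (l : nat) := {p : 'I_l * 'I_l | (p.1 <= p.2)%N}.

Lemma card_upper l : (#|{: upper l}|.*2 = l * l.+1)%N.
Proof.
rewrite card_sig /=; set U := #|_|.
pose S := #|[pred p : 'I_l * 'I_l | (p.1 < p.2)%N]|.
have SC : S = #|[pred p : 'I_l * 'I_l | (p.2 < p.1)%N]|.
  have swK : injective (fun p : 'I_l * 'I_l => (p.2, p.1)) by move=> [a b] [c d] [-> ->].
  rewrite /S -(fintype.card_image swK); apply: eq_card => -[a b]; rewrite !inE /=.
  apply/fintype.imageP/idP => [[[c d] /= cd [-> ->]] //|ba].
  by exists (b, a).
have US : (U = S + l)%N.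
  have -> : (l = #|[pred p : 'I_l * 'I_l | p.1 == p.2]|)%N.
    have dg : injective (fun i : 'I_l => (i, i)) by move=> i j [].
    rewrite -[LHS](card_ord l) -(fintype.card_codom dg); apply: eq_card => -[a b]; rewrite !inE /=.
    apply/fintype.codomP/eqP => [[i [-> ->]] //|->]; by exists b.
  rewrite /U -(cardID [pred p : 'I_l * 'I_l | (p.1 < p.2)%N]); congr (_ + _)%N; apply: eq_card => -[a b]; rewrite !inE /=.
    by case: ltngtP.
  by rewrite -val_eqE /=; case: ltngtP.
have USl : (U + S = l * l)%N.
  rewrite -[in RHS](card_ord l) -card_prod -(cardC [pred p : 'I_l * 'I_l | (p.1 <= p.2)%N]) SC.
  by congr (_ + _)%N; apply: eq_card => -[a b]; rewrite !inE /= ltnNge.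
by rewrite -addnn mulnS; move: US USl; move: (l * l)%N => q; lia.
Qed.

Section Coordinates.
Variables (R : realType) (n k : nat).
Hypotheses (k_gt0 : (0 < k)%N) (k_le : (2 * k <= n)%N).
Local Notation l := (2 * k)%N.
Local Notation J := (J R k).
Variable X0 : 'M[R]_(n, l).
Hypothesis X0_stiefel : X0^T *m X0 = 1%:M.
Implicit Type h : 'M[R]_(n, l).

Definition sym2 h : 'M[R]_l := X0^T *m h + h^T *m X0.

Definition horizontal h := sym2 h = 0 /\ inner h (X0 *m J) = 0.

(** Orthogonal projection: the matrices [X0 S] with [S] symmetric form the normal space at [X0], and
    [X0 J], orthogonal to all of them, is the direction of the orbit. *)
Definition horizontal_part h : 'M[R]_(n, l) :=
  h - 2^-1 *: (X0 *m sym2 h) - (inner h (X0 *m J) / l%:R) *: (X0 *m J).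

Lemma sym2_tr h : (sym2 h)^T = sym2 h.
Proof. by rewrite /sym2 linearD /= !trmx_mul !trmxK addrC. Qed.

Lemma sym2D h h' : sym2 (h + h') = sym2 h + sym2 h'.
Proof. by rewrite /sym2 mulmxDr linearD /= mulmxDl addrACA. Qed.

Lemma sym2Z a h : sym2 (a *: h) = a *: sym2 h.
Proof. by rewrite /sym2 -scalemxAr [(a *: h)^T]linearZ /= -scalemxAl scalerDr. Qed.

Lemma sym2_X0 (S : 'M[R]_l) : sym2 (X0 *m S) = S + S^T.
Proof. by rewrite /sym2 trmx_mul -mulmxA X0_stiefel mulmxA X0_stiefel mul1mx mulmx1. Qed.

Lemma l_neq0 : l%:R != 0 :> R.
Proof. by rewrite pnatr_eq0 muln_eq0 /= -lt0n. Qed.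

Lemma inner_X0_J : inner (X0 *m J) (X0 *m J) = l%:R.
Proof. by rewrite -inner_XJ inner_stiefel. Qed.

Lemma horizontal_part_horizontal h : horizontal (horizontal_part h).
Proof.
have -> : horizontal_part h = h + (- 2^-1) *: (X0 *m sym2 h) +
    (- (inner h (X0 *m J) / l%:R)) *: (X0 *m J) by rewrite /horizontal_part !scaleNr.
split.
  rewrite !sym2D !sym2Z !sym2_X0 sym2_tr J_tr subrr scaler0 addr0.
  by rewrite -mulr2n -[sym2 h *+ 2]scaler_nat scalerA mulNr mulVf ?pnatr_eq0 // scaleN1r subrr.
rewrite !innerDl !innerZl inner_sym_J ?sym2_tr // mulr0 addr0 inner_X0_J.
by rewrite mulNr divfK ?l_neq0 // subrr.
Qed.

Lemma horizontal_part_id h : horizontal h -> horizontal_part h = h.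
Proof. by case=> s i; rewrite /horizontal_part s i mulmx0 scaler0 mul0r scale0r !subr0. Qed.

Lemma horizontal_part_is_linear : linear horizontal_part.
Proof.
move=> a h h'; rewrite /horizontal_part sym2D sym2Z innerDl innerZl.
rewrite mulmxDr -scalemxAr mulrDl scalerDl !scalerDr !scalerN !opprD !scalerA.
by apply/matrixP => i j; rewrite !mxE; ring.
Qed.

(** Rank and nullity: a suitable [X0 S / 2 + c X0 J] attains any prescribed values, so the
    [k(2k + 1) + 1] linear conditions for being horizontal are independent and leave a space of
    dimension [dimY]. *)
Lemma horizontal_coordinates : exists (p : {linear 'M[R]_(n, l) -> 'rV[R]_(dimY n k)})
    (j : {linear 'rV[R]_(dimY n k) -> 'M[R]_(n, l)}),
  [/\ forall w, horizontal (j w), forall w, p (j w) = w & forall h, j (p h) = horizontal_part h].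
Proof.
pose I := (upper l + unit)%type.
pose cons h (a : I) : R := match a with
  | inl q => sym2 h (val q).1 (val q).2 | inr _ => inner h (X0 *m J) end.
pose f h : 'rV[R]_(#|{: I}|) := \row_a cons h (enum_val a).
have f_lin : linear f.
  move=> a h h'; apply/rowP => b; rewrite !mxE; case: (enum_val b) => [q|[]] /=.
    by rewrite sym2D sym2Z !mxE.
  by rewrite innerDl innerZl.
pose F : {linear 'M[R]_(n, l) -> 'rV[R]_(#|{: I}|)} := HB.pack f (GRing.isLinear.Build _ _ _ _ f f_lin).
pose U := lker (linfun F).
have UP h : reflect (horizontal h) (h \in U).
  rewrite memv_ker lfunE /=; apply: (iffP eqP) => [fh|[s i]].
    have ch a : cons h a = 0.
      by have := congr1 (fun r : 'rV[R]_(#|{: I}|) => r 0 (enum_rank a)) fh; rewrite !mxE enum_rankK.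
    split; last exact: (ch (inr tt)).
    apply/matrixP => i j; rewrite [RHS]mxE; have [ij|/ltnW ij] := leqP i j.
      exact: (ch (inl (exist _ (i, j) ij))).
    by rewrite -sym2_tr [LHS]mxE; exact: (ch (inl (exist _ (j, i) ij))).
  by apply/rowP => b; rewrite !mxE; case: (enum_val b) => [q|[]] //=; rewrite s mxE.
have full : limg (linfun F) = fullv.
  apply/vspaceP => r; rewrite memvf; apply/memv_imgP.
  pose S := \matrix_(i, j) (match @insub _ _ (upper l) (if (i <= j)%N then (i, j) else (j, i)) with
    | Some q => r 0 (enum_rank (inl q)) | None => 0 end).
  have SS : S^T = S.
    apply/matrixP => i j; rewrite !mxE; case: (ltngtP i j) => // /val_inj->; by rewrite ?leqnn.
  exists (2^-1 *: (X0 *m S) + (r 0 (enum_rank (inr tt)) / l%:R) *: (X0 *m J)); first exact: memvf.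
  rewrite lfunE; apply/rowP => b; rewrite mxE -[b in LHS]enum_valK; case: (enum_val b) => [q|[]] /=.
    rewrite sym2D !sym2Z !sym2_X0 SS J_tr subrr scaler0 addr0 -mulr2n -[S *+ 2]scaler_nat scalerA mulVf // scale1r.
    rewrite mxE (valP q); case: q => -[i j] ij /=.
    by rewrite insubT.
  by rewrite innerDl !innerZl inner_sym_J // mulr0 add0r inner_X0_J divfK // l_neq0.
have dimU : \dim U = dimY n k.
  have cI : #|{: I}| = (#|{: upper l}| + 1)%N by rewrite card_sum card_unit.
  have cu : (#|{: upper l}| = k * (2 * k + 1))%N.
    by apply: double_inj; rewrite card_upper; lia.
  have := limg_ker_dim (linfun F) fullv; rewrite capfv full !dimvf /dim /= mul1n -/U => e.
  have nl : (l * l <= n * l)%N by rewrite leq_mul2r k_le orbT.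
  rewrite /dimY; move: e nl; rewrite [#|_|]cI cu; move: (\dim U) => u; nia.
have [b bU] : exists b : (dimY n k).-tuple 'M[R]_(n, l), basis_of U b.
  by rewrite -dimU; exists (vbasis U); exact: vbasisP.
pose hp : {linear 'M[R]_(n, l) -> 'M[R]_(n, l)} :=
  HB.pack horizontal_part (GRing.isLinear.Build _ _ _ _ _ horizontal_part_is_linear).
pose p h : 'rV[R]_(dimY n k) := \row_i coord b i (hp h).
have p_lin : linear p by move=> a h h'; apply/rowP => i; rewrite !mxE !linearP.
pose j (w : 'rV[R]_(dimY n k)) : 'M[R]_(n, l) := \sum_i w 0 i *: b`_i.
have j_lin : linear j.
  move=> a w w'; rewrite /j scaler_sumr -big_split; apply: eq_bigr => i _.
  by rewrite !mxE scalerDl scalerA.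
have jU w : j w \in U.
  by apply: memv_suml => i _; apply: memvZ; apply: (basis_mem bU); rewrite mem_nth ?size_tuple.
pose P : {linear 'M[R]_(n, l) -> 'rV[R]_(dimY n k)} := HB.pack p (GRing.isLinear.Build _ _ _ _ p p_lin).
pose Q : {linear 'rV[R]_(dimY n k) -> 'M[R]_(n, l)} := HB.pack j (GRing.isLinear.Build _ _ _ _ j j_lin).
exists P, Q.
split=> /= [w|w|h]; first exact/UP.
  apply/rowP => i; rewrite mxE /= horizontal_part_id; last exact/UP.
  by rewrite /j coord_sum_free ?(basis_free bU).
have hU : hp h \in U by apply/UP; exact: horizontal_part_horizontal.
rewrite [RHS](coord_basis bU hU) /j; apply: eq_bigr => i _.
by rewrite mxE.
Qed.
End Coordinates.

Lemma stiefel_norm (R : realType) n l (X : 'M[R]_(n, l)) : X^T *m X = 1%:M -> `|X| <= 1.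
Proof.
move=> XX; apply: mx_norm_le => // i j.
have := congr1 (fun M : 'M[R]_l => M j j) XX; rewrite !mxE eqxx mulr1n (bigD1 i) //= mxE => e.
rewrite -(@ler_pXn2r _ 2) ?nnegrE // expr1n real_normK ?num_real // expr2 -e lerDl.
by apply: sumr_ge0 => a _; rewrite mxE -expr2 sqr_ge0.
Qed.

Lemma mx_linear_continuous (R : realType) m n (V : normedModType R)
  (f : {linear 'M[R]_(m, n) -> V}) : continuous f.
Proof.
move=> x; have fE y : f y = \sum_i \sum_j y i j *: f (delta_mx i j).
  rewrite {1}[y]matrix_sum_delta linear_sum; apply: eq_bigr => i _.
  by rewrite linear_sum; apply: eq_bigr => j _; rewrite linearZ.
rewrite /continuous_at fE.
have H : (fun y : 'M[R]_(m, n) => \sum_i \sum_j y i j *: f (delta_mx i j)) @ x -->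
    \sum_i \sum_j x i j *: f (delta_mx i j).
  by apply: (@cvg_bigsum R V _ _ _ (nbhs_filter x)) => i; apply: (@cvg_bigsum R V _ _ _ (nbhs_filter x)) => j; apply: cvgZr_tmp; exact: coord_continuous.
have e : (fun y : 'M[R]_(m, n) => f y) = fun y => \sum_i \sum_j y i j *: f (delta_mx i j).
  by apply/funext => y; exact: fE.
by rewrite -e in H.
Qed.

Lemma subrBB (V : zmodType) (h a b : V) : (h - a) - (h - b) = - (a - b).
Proof. by rewrite !opprB addrC addrA subrK. Qed.

(** * Straightening the Stiefel manifold near a frame *)

Section LocalInverse.
Variables (R : realType) (n k : nat).
Hypotheses (k_gt0 : (0 < k)%N) (k_le : (2 * k <= n)%N).
Local Notation l := (2 * k)%N.
Local Notation J := (J R k).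
Variable X0 : 'M[R]_(n, l).
Hypothesis X0_stiefel : X0^T *m X0 = 1%:M.
Implicit Types (D v h X Y : 'M[R]_(n, l)).

(** For [|D| <= rad] the map [pert D] has norm at most 1/2 in the sup norm: multiplying by [X0]
    costs a factor [l] and multiplying by [D^T] a factor [n]. *)
Definition rad : R := (2 * (l * n))%:R^-1.

Lemma ln_gt0 : (0 < l * n)%N.
Proof. by move: k_gt0 k_le; case: n => [|m]; lia. Qed.

Lemma rad_gt0 : 0 < rad.
Proof. by rewrite invr_gt0 ltr0n muln_gt0 ln_gt0. Qed.

Lemma ln_rad : (l * n)%:R * rad = 2^-1.
Proof.
have ln0 : (l * n)%:R != 0 :> R by rewrite pnatr_eq0 -lt0n ln_gt0.
by rewrite /rad [X in X^-1]natrM invfM mulrCA mulfV // mulr1.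
Qed.

Lemma mul_X0_norm (A : 'M[R]_l) : `|X0 *m A| <= l%:R * `|A|.
Proof.
apply: le_trans (mulmx_norm _ _) _; rewrite -mulrA ler_wpM2l // ler_piMl //.
exact: stiefel_norm.
Qed.

(* The derivative of theta at D is v + pert D v. *)
Definition pert D v := 2^-1 *: (X0 *m (D^T *m v + v^T *m D)).

Lemma pert_norm D v : `|D| <= rad -> `|pert D v| <= 2^-1 * `|v|.
Proof.
move=> Dr; rewrite /pert normrZ ger0_norm ?invr_ge0 // ler_pM2l ?invr_gt0 //.
apply: le_trans (mul_X0_norm _) _.
have H : `|D^T *m v + v^T *m D| <= 2 * (n%:R * `|D| * `|v|).
  rewrite mulr2n mulrDl !mul1r (le_trans (ler_normD _ _)) // lerD //.
    by apply: le_trans (mulmx_norm _ _) _; rewrite trmx_norm.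
  by apply: le_trans (mulmx_norm _ _) _; rewrite trmx_norm mulrAC.
apply: le_trans (ler_wpM2l _ H) _ => //.
rewrite (_ : l%:R * (2 * (n%:R * `|D| * `|v|)) = 2 * ((l * n)%:R * `|D|) * `|v|); last first.
  by rewrite natrM; ring.
have : (l * n)%:R * `|D| <= 2^-1 by rewrite -ln_rad ler_wpM2l.
move=> H'; rewrite -[leRHS]mul1r ler_wpM2r //; move: H'; move: (_ * `|D|) => a; lra.
Qed.

Lemma pert_inj D v : `|D| <= rad -> v + pert D v = 0 -> v = 0.
Proof.
move=> Dr /eqP; rewrite addr_eq0 => /eqP e; have := pert_norm v Dr.
rewrite -normrN -e => H; apply/eqP; rewrite -normr_eq0.
have := normr_ge0 v; move: H; move: `|v| => a; lra.
Qed.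

Lemma pertB D v v' : pert D v - pert D v' = pert D (v - v').
Proof.
rewrite /pert -scalerBr -mulmxBr; congr (_ *: (_ *m _)).
by rewrite mulmxBr [(v - v')^T]linearB /= mulmxBl opprD addrACA.
Qed.

Lemma pert_solve D h : `|D| <= rad -> exists v, v + pert D v = h.
Proof.
move=> Dr; have [||x y|v _ vE] := @contraction_solve _ _ _ (fun v => h - pert D v) (2 * `|h|).
- by rewrite mulr_ge0.
- move=> x xh; apply: le_trans (ler_normB _ _) _; have := pert_norm x Dr; move: xh.
  by move: `|x| `|h| `|pert _ _| => a b c; lra.
- by move=> _ _; rewrite subrBB normrN pertB; exact: pert_norm.
- by exists v; rewrite {1}vE subrK.
Qed.

(* X0 + D is orthonormal iff the symmetric part of X0^T (theta D) vanishes, so that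
   theta straightens the Stiefel manifold near X0. *)
Definition theta D := D + 2^-1 *: (X0 *m (D^T *m D)).

(** Since [theta] is quadratic, its increment is exactly the mean of its derivatives at the two
    ends, so the bound on [pert] yields Lipschitz bounds at once. *)
Lemma thetaB D D' : theta D - theta D' =
  (D - D') + 2^-1 *: (pert D (D - D') + pert D' (D - D')).
Proof.
rewrite /theta opprD addrACA; congr (_ + _); rewrite /pert -scalerDr -mulmxDr -scalerBr -mulmxBr scalerA.
rewrite -[2^-1 * 2^-1]mulrC -scalerA; congr (_ *: _); rewrite scalemxAr; congr (_ *m _).
rewrite [(D - D')^T]linearB /=; move: D^T D'^T => E E'.
rewrite (mulmxBr E) (mulmxBr E') (mulmxBl E E' D) (mulmxBl E E' D').
move: (E *m D) (E *m D') (E' *m D) (E' *m D') => a b c d.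
by apply/matrixP => i i'; rewrite !mxE; lra.
Qed.

Lemma theta0 : theta 0 = 0.
Proof. by rewrite /theta trmx0 mul0mx mulmx0 scaler0 addr0. Qed.

Lemma quad_lip D D' : `|D| <= rad -> `|D'| <= rad ->
  `|2^-1 *: (pert D (D - D') + pert D' (D - D'))| <= 2^-1 * `|D - D'|.
Proof.
move=> Dr D'r; rewrite normrZ ger0_norm ?invr_ge0 // ler_pM2l ?invr_gt0 //.
apply: le_trans (ler_normD _ _) _.
have := pert_norm (D - D') Dr; have := pert_norm (D - D') D'r.
by move: `|D - D'| `|pert _ _| `|pert D' _| => a b c; lra.
Qed.

Lemma theta_inj_norm D D' : `|D| <= rad -> `|D'| <= rad ->
  `|D - D'| <= 2 * `|theta D - theta D'|.
Proof.
move=> Dr D'r; have := quad_lip Dr D'r; rewrite thetaB; set q := 2^-1 *: _.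
have : `|D - D'| <= `|D - D' + q| + `|q|.
  by rewrite -{1}(addrK q (D - D')) ler_normB.
by move: `|q| `|D - D' + q| `|D - D'| => a b c; lra.
Qed.

(** A fixed point of [D -> h - q D], where [q] is the quadratic part. The strict bound follows from
    [|D| <= 2 |h|]. *)
Lemma theta_surj h : `|h| < rad / 2 -> exists2 D, `|D| < rad & theta D = h.
Proof.
move=> hr; have r0 := ltW rad_gt0.
pose q D := 2^-1 *: (X0 *m (D^T *m D)).
have qB D D' : q D - q D' = 2^-1 *: (pert D (D - D') + pert D' (D - D')).
  by have := thetaB D D'; rewrite /theta opprD addrACA => /addrI.
have q0 : q 0 = 0 by rewrite /q trmx0 mul0mx mulmx0 scaler0.
have [//|x xr|x y xr yr|D Dr DE] := @contraction_solve _ _ _ (fun D => h - q D) rad.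
- apply: le_trans (ler_normB _ _) _.
  have := quad_lip (D' := 0) xr; rewrite normr0 => /(_ r0); rewrite -qB q0 !subr0.
  by move: hr xr; move: `|h| `|q x| `|x| => a b c; lra.
- by rewrite subrBB normrN qB; exact: quad_lip.
have thD : theta D = h by rewrite /theta {1}DE subrK.
exists D => //; have := theta_inj_norm (D' := 0) Dr; rewrite normr0 => /(_ r0).
by rewrite theta0 !subr0 thD; move: hr; move: `|h| `|D| => a b; lra.
Qed.

End LocalInverse.

Lemma is_derive_along (R : realType) (E F : normedModType R) (G : E -> F) (c : R^o -> E) (t : R^o) (v : E) :
  differentiable G (c t) -> is_derive t 1 c v -> is_derive t 1 (G \o c) ('d G (c t) v).
Proof.
move=> dG [cD cv]; have dc : differentiable c t by apply/derivable1_diffP.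
have dGc := differentiable_comp dc dG.
split; first by apply/derivable1_diffP.
by rewrite deriveE // diff_comp //= -(deriveE (1 : R^o) dc) cv.
Qed.

(** * A slice of the circle action *)

Section Slice.
Variables (R : realType) (n k : nat).
Hypotheses (k_gt0 : (0 < k)%N) (k_le : (2 * k <= n)%N).
Local Notation l := (2 * k)%N.
Local Notation J := (J R k).
Variable X0 : 'M[R]_(n, l).
Hypothesis X0_stiefel : X0^T *m X0 = 1%:M.
Variable p : {linear 'M[R]_(n, l) -> 'rV[R]_(dimY n k)}.
Variable j : {linear 'rV[R]_(dimY n k) -> 'M[R]_(n, l)}.
Hypothesis j_horizontal : forall w, horizontal X0 (j w).
Hypothesis jK : forall w, p (j w) = w.
Hypothesis pK : forall h, j (p h) = horizontal_part X0 h.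
Implicit Types (D v h X Y : 'M[R]_(n, l)) (w : 'rV[R]_(dimY n k)).
Local Notation rad := (rad R n k).
Local Notation rot := (rot k).
Local Notation theta := (theta X0).
Local Notation pert := (pert X0).

(** [zeta1 + i zeta2] is a complex-valued product of [Y] with [X0]; the action of [rot a b]
    multiplies it by [a + i b], so a nonzero value can be rotated to a positive real one. *)
Definition zeta1 Y := inner Y X0.
Definition zeta2 Y := inner Y (X0 *m J).
Definition zeta_sqr Y := zeta1 Y ^+ 2 + zeta2 Y ^+ 2.
Definition rho Y := Num.sqrt (zeta_sqr Y).
Definition phase Y := rot (zeta1 Y / rho Y) (- zeta2 Y / rho Y).
(* The representative of the circle orbit of Y with <Y, X0 J> = 0 < <Y, X0>. *)
Definition nrm Y := Y *m phase Y.
Definition G Y := p (nrm Y).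

Lemma mul_rot Y a b : Y *m rot a b = a *: Y + b *: (Y *m J).
Proof. by rewrite mulmxDr mul_mx_scalar scalemxAr. Qed.

Lemma zeta1_rot Y a b : zeta1 (Y *m rot a b) = a * zeta1 Y - b * zeta2 Y.
Proof. by rewrite /zeta1 mul_rot innerDl !innerZl inner_XJ0 mulrN. Qed.

Lemma zeta2_rot Y a b : zeta2 (Y *m rot a b) = a * zeta2 Y + b * zeta1 Y.
Proof.
rewrite /zeta2 mul_rot innerDl !innerZl inner_XJ0 -mulmxA J_sqr mulmxN mulmx1.
by rewrite [inner Y (- X0)]innerC innerNl opprK [inner X0 Y]innerC.
Qed.

Lemma zeta_sqr_rot Y a b : zeta_sqr (Y *m rot a b) = (a ^+ 2 + b ^+ 2) * zeta_sqr Y.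
Proof. by rewrite /zeta_sqr zeta1_rot zeta2_rot; ring. Qed.

Lemma nrm_rot Y a b : a ^+ 2 + b ^+ 2 = 1 -> nrm (Y *m rot a b) = nrm Y.
Proof.
move=> ab; rewrite /nrm /phase /rho zeta_sqr_rot ab mul1r zeta1_rot zeta2_rot -mulmxA rotM.
congr (_ *m rot _ _).
  by rewrite -[RHS]mul1r -ab; ring.
by rewrite -[RHS]mul1r -ab; ring.
Qed.

Lemma G_rot Y a b : a ^+ 2 + b ^+ 2 = 1 -> G (Y *m rot a b) = G Y.
Proof. by move=> ab; rewrite /G nrm_rot. Qed.

Lemma phase_unit Y : 0 < zeta_sqr Y -> (zeta1 Y / rho Y) ^+ 2 + (- zeta2 Y / rho Y) ^+ 2 = 1.
Proof.
move=> z0; rewrite !expr_div_n sqrrN -mulrDl sqr_sqrtr ?ltW // divff // gt_eqF //.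
Qed.

Lemma rho_gt0 Y : 0 < zeta_sqr Y -> 0 < rho Y.
Proof. by rewrite sqrtr_gt0. Qed.

Lemma rot_stiefel Y a b : a ^+ 2 + b ^+ 2 = 1 -> Y^T *m Y = 1%:M ->
  (Y *m rot a b)^T *m (Y *m rot a b) = 1%:M.
Proof.
move=> ab YY; rewrite trmx_mul mulmxA -[_ *m Y]mulmxA YY.
by rewrite mulmx1 rot_tr rotM -rot10 -ab; congr rot; ring.
Qed.

Lemma nrm_stiefel Y : 0 < zeta_sqr Y -> Y^T *m Y = 1%:M -> (nrm Y)^T *m nrm Y = 1%:M.
Proof. by move=> z0; apply: rot_stiefel; exact: phase_unit. Qed.

Lemma zeta1_nrm Y : 0 < zeta_sqr Y -> zeta1 (nrm Y) = rho Y.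
Proof.
move=> z0; have r0 := rho_gt0 z0; rewrite /nrm zeta1_rot.
have : rho Y ^+ 2 = zeta_sqr Y by rewrite sqr_sqrtr // ltW.
rewrite /zeta_sqr; move: r0; move: (rho Y) (zeta1 Y) (zeta2 Y) => r a b r0 e.
have r1 : r != 0 by rewrite gt_eqF.
apply: (mulIf r1); rewrite -expr2 e; field.
exact: r1.
Qed.

Lemma zeta2_nrm Y : zeta2 (nrm Y) = 0.
Proof. by rewrite /nrm zeta2_rot; ring. Qed.

Lemma nrm_id Y : zeta2 Y = 0 -> 0 < zeta1 Y -> nrm Y = Y.
Proof.
move=> z2 z1; rewrite /nrm /phase /rho /zeta_sqr z2 expr0n addr0 sqrtr_sqr gtr0_norm //.
by rewrite oppr0 mul0r divff ?gt_eqF // rot10 mulmx1.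
Qed.

Lemma rot_sym_J a b : rot a b *m J = J *m rot a b.
Proof. by rewrite mulmxDl mulmxDr mul_scalar_mx mul_mx_scalar -scalemxAl scalemxAr. Qed.

Lemma p_X0_sym (S : 'M[R]_l) : S^T = S -> p (X0 *m S) = 0.
Proof.
move=> SS; rewrite -[LHS]jK pK /horizontal_part sym2_X0 // SS inner_sym_J //.
by rewrite mul0r scale0r subr0 -mulr2n -[S *+ 2]scaler_nat -scalemxAr scalerA mulVf // scale1r subrr linear0.
Qed.

Lemma p_X0 : p X0 = 0.
Proof. by rewrite -[X0]mulmx1 p_X0_sym // trmx1. Qed.

Lemma theta_horizontal D : (X0 + D)^T *m (X0 + D) = 1%:M -> zeta2 (X0 + D) = 0 ->
  horizontal X0 (theta D).
Proof.
have tD : (D^T *m D)^T = D^T *m D by rewrite trmx_mul trmxK.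
move=> DD z2; split.
  rewrite sym2D sym2Z sym2_X0 // tD -mulr2n -[(D^T *m D) *+ 2]scaler_nat scalerA mulVf // scale1r.
  move: DD; rewrite [(X0 + D)^T]linearD /= mulmxDl !mulmxDr X0_stiefel -!addrA.
  by rewrite -[X in _ = X -> _]addr0 => /addrI; rewrite /sym2 addrA.
move: z2; have z0 : inner X0 (X0 *m J) = 0 by rewrite -{1}[X0]mulmx1 inner_sym_J // trmx1.
rewrite /zeta2 !innerDl z0 add0r innerZl => ->.
by rewrite inner_sym_J // mulr0 addr0.
Qed.

Lemma p_theta D : p (theta D) = p (X0 + D).
Proof.
rewrite /theta !linearD linearZ /= p_X0_sym; last by rewrite trmx_mul trmxK.
by rewrite p_X0 scaler0 addr0 add0r.
Qed.

(** The difference [nrm Y - X0] becomes horizontal after [theta], while [p] does not see the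
    quadratic term. Thus [G] gives the coordinates in which [theta] straightens the slice. *)
Lemma theta_G Y : Y^T *m Y = 1%:M -> 0 < zeta_sqr Y -> theta (nrm Y - X0) = j (G Y).
Proof.
move=> YY z0; have e : X0 + (nrm Y - X0) = nrm Y by rewrite addrC subrK.
have -> : G Y = p (theta (nrm Y - X0)) by rewrite p_theta e.
rewrite pK horizontal_part_id //; apply: theta_horizontal.
  by rewrite e; exact: nrm_stiefel.
by rewrite e zeta2_nrm.
Qed.

(** [<X0, X0> = l >= 1], whereas [D] changes the product by at most [l n rad = 1/2]. *)
Lemma zeta1_gt0 D : `|D| < rad -> 0 < zeta1 (X0 + D).
Proof.
move=> Dr; rewrite /zeta1 innerDl inner_stiefel //.
have H : `|inner D X0| <= 2^-1.
  rewrite inner_sum (le_trans (ler_norm_sum _ _ _)) // -(ln_rad R k_gt0 k_le).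
  have Hj (b : 'I_l) : `|\sum_i D i b * X0 i b| <= n%:R * rad.
    rewrite (le_trans (ler_norm_sum _ _ _)) //.
    rewrite mulr_natl -[X in _ *+ X]card_ord -sumr_const ler_sum // => i _.
    rewrite normrM -[leRHS]mulr1 ler_pM //.
      by apply: le_trans (entry_le_norm _ _ _) (ltW Dr).
    by apply: le_trans (entry_le_norm _ _ _) (stiefel_norm X0_stiefel).
  apply: le_trans (ler_sum (index_enum _) (fun b _ => Hj b)) _.
  rewrite sumr_const card_ord.
  by rewrite -[(n%:R * rad) *+ l]mulr_natl [(l * n)%:R]natrM mulrA.
have : 1 <= l%:R :> R by rewrite ler1n; move: k_gt0; lia.
by move: H => /ler_normlP[]; move: (inner D X0) (l%:R : R) => a b; lra.
Qed.

(** The section of [G] over the slice; if no [D] exists the default 0 gives [X0]. *)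
Definition lift w := X0 + xget 0 [set D | `|D| < rad /\ theta D = j w].

Lemma lift_theta w : `|j w| < rad / 2 -> `|lift w - X0| < rad /\ theta (lift w - X0) = j w.
Proof.
move=> wr; have [D Dr De] := theta_surj k_gt0 k_le X0_stiefel wr.
rewrite /lift [X0 + _]addrC addrK.
by apply: (@xgetPex _ 0 [set D | `|D| < rad /\ theta D = j w]); exists D.
Qed.

Lemma theta_eq D D' : `|D| < rad -> `|D'| < rad -> theta D = theta D' -> D = D'.
Proof.
move=> Dr D'r e; have := theta_inj_norm k_gt0 k_le X0_stiefel (ltW Dr) (ltW D'r).
by rewrite e subrr normr0 mulr0 normr_le0 subr_eq0 => /eqP.
Qed.

Lemma theta_stiefel D : horizontal X0 (theta D) -> (X0 + D)^T *m (X0 + D) = 1%:M /\ zeta2 (X0 + D) = 0.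
Proof.
have tD : (D^T *m D)^T = D^T *m D by rewrite trmx_mul trmxK.
have z0 : inner X0 (X0 *m J) = 0 by rewrite -{1}[X0]mulmx1 inner_sym_J // trmx1.
case; rewrite sym2D sym2Z sym2_X0 // tD -mulr2n -[(D^T *m D) *+ 2]scaler_nat scalerA mulVf // scale1r => s.
rewrite innerDl innerZl inner_sym_J // mulr0 addr0 => z; split.
  by rewrite [(X0 + D)^T]linearD /= mulmxDl !mulmxDr X0_stiefel -!addrA (addrA (X0^T *m D)) s addr0.
by rewrite /zeta2 innerDl z0 z addr0.
Qed.

Section Lift.
Variable w : 'rV[R]_(dimY n k).
Hypothesis w_small : `|j w| < rad / 2.

Let liftE : lift w = X0 + (lift w - X0). Proof. by rewrite addrC subrK. Qed.

Lemma lift_stiefel : (lift w)^T *m lift w = 1%:M.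
Proof.
have [_ e] := lift_theta w_small.
by rewrite liftE; have [] := @theta_stiefel (lift w - X0); rewrite // e.
Qed.

Lemma zeta2_lift : zeta2 (lift w) = 0.
Proof.
have [_ e] := lift_theta w_small.
by rewrite liftE; have [] := @theta_stiefel (lift w - X0); rewrite // e.
Qed.

Lemma zeta1_lift : 0 < zeta1 (lift w).
Proof. by rewrite liftE; apply: zeta1_gt0; have [] := lift_theta w_small. Qed.

Lemma zeta_sqr_lift : 0 < zeta_sqr (lift w).
Proof. by rewrite /zeta_sqr zeta2_lift expr0n addr0 exprn_gt0 // zeta1_lift. Qed.

Lemma nrm_lift : nrm (lift w) = lift w.
Proof. by apply: nrm_id; [exact: zeta2_lift|exact: zeta1_lift]. Qed.

Lemma G_lift : G (lift w) = w.
Proof.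
by rewrite /G nrm_lift liftE -p_theta; have [_ ->] := lift_theta w_small; rewrite jK.
Qed.

End Lift.

Definition slice_dom Y := [/\ 0 < zeta_sqr Y, `|nrm Y - X0| < rad & `|j (G Y)| < rad / 2].

Lemma lift_slice_dom w : `|j w| < rad / 2 -> slice_dom (lift w).
Proof.
move=> wr; split; rewrite ?G_lift ?nrm_lift //; first exact: zeta_sqr_lift.
by have [] := lift_theta wr.
Qed.

Lemma lift_G Y : Y^T *m Y = 1%:M -> slice_dom Y -> lift (G Y) = nrm Y.
Proof.
move=> YY [z0 nr Gr]; have [lr le] := lift_theta Gr.
by apply: (addIr (- X0)); apply: theta_eq => //; rewrite le theta_G.
Qed.

Lemma lift_lipschitz w w' : `|j w| < rad / 2 -> `|j w'| < rad / 2 ->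
  `|lift w - lift w'| <= 2 * `|j w - j w'|.
Proof.
move=> /lift_theta[wr <-] /lift_theta[wr' <-].
have -> : lift w - lift w' = (lift w - X0) - (lift w' - X0) by rewrite opprB addrA subrK.
exact: (theta_inj_norm k_gt0 k_le X0_stiefel (ltW wr) (ltW wr')).
Qed.

Lemma rad_half_gt0 : 0 < rad / 2.
Proof. by rewrite divr_gt0 // rad_gt0. Qed.

Lemma slice_dom_X0 : slice_dom X0.
Proof.
have z0 : zeta2 X0 = 0 by rewrite /zeta2 -{1}[X0]mulmx1 inner_sym_J // trmx1.
have z1 : 0 < zeta1 X0 by rewrite -[X0]addr0 zeta1_gt0 // normr0 rad_gt0.
have e : nrm X0 = X0 by exact: nrm_id.
split; rewrite /G ?e ?p_X0 ?linear0 ?subrr ?normr0; [|exact: rad_gt0|exact: rad_half_gt0].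
by rewrite /zeta_sqr z0 expr0n addr0 exprn_gt0.
Qed.

Lemma slice_dom_rot Y a b : a ^+ 2 + b ^+ 2 = 1 -> slice_dom (Y *m rot a b) <-> slice_dom Y.
Proof.
move=> ab; have e1 : zeta_sqr (Y *m rot a b) = zeta_sqr Y by rewrite zeta_sqr_rot ab mul1r.
by rewrite /slice_dom e1 (G_rot Y ab) (nrm_rot Y ab).
Qed.
End Slice.

Lemma Cr_on_linear_comp (R : realType) (E F F' : normedModType R) (L : {linear F -> F'}) r
    (U : set E) (f : E -> F) : open U -> continuous L -> Cr_on r U f -> Cr_on r U (L \o f).
Proof.
move=> oU Lc; have dL x : differentiable L x by exact: linear_differentiable.
elim: r f => [|r IH] f /=.
  by move=> fc x Ux; apply: continuous_comp; [exact: fc|exact: Lc].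
move=> [df Df]; split=> [x Ux|v]; first by apply: differentiable_comp => //; exact: df.
apply: (Cr_on_eq oU _ (IH _ (Df v))) => x Ux.
have dfx := df x Ux.
rewrite [RHS]deriveE; last exact: differentiable_comp.
by rewrite diff_comp //= (diff_lin _ Lc) -[in RHS]deriveE.
Qed.

Lemma Cr_on_coord (R : realType) m n r (U : set 'M[R]_(m, n)) a b :
  Cr_on r U (fun Y : 'M[R]_(m, n) => Y a b : R^o).
Proof.
pose f (Y : 'M[R]_(m, n)) : R^o := Y a b.
have f_lin : linear f by move=> c Y Y'; rewrite /f !mxE.
pose F : {linear 'M[R]_(m, n) -> R^o} := HB.pack f (GRing.isLinear.Build _ _ _ _ f f_lin).
apply: (@Cr_on_linear _ _ _ r U F); exact: coord_continuous.
Qed.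

Lemma is_derive_line (R : realType) (V : normedModType R) (x v : V) :
  is_derive (0 : R^o) 1 (fun t : R^o => x + t *: v) v.
Proof.
have H : (fun h : R^o => h^-1 *: ((x + (h *: (1 : R^o) + 0) *: v) - (x + (0 : R) *: v))) @ 0^' --> v.
  apply: cvg_near_cst; near=> h; have h0 : h != 0 by near: h; exact: nbhs_dnbhs_neq.
  by rewrite scale0r addr0 [h *: 1]mulr1 addr0 [X in X - _]addrC addrK scalerA mulVf // scale1r.
by split; [apply/cvg_ex; exists v|apply: cvg_lim].
Unshelve. all: by end_near. Qed.

Lemma diff_line (R : realType) (E F : normedModType R) (G : E -> F) (x v : E) :
  differentiable G x -> 'd G x v = 'D_1 (fun t : R^o => G (x + t *: v)) (0 : R^o).
Proof.
move=> dG; have dG' : differentiable G (x + (0 : R) *: v) by rewrite scale0r addr0.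
have [_ e] := is_derive_along dG' (is_derive_line x v).
by rewrite -[RHS]/('D_1 (G \o (fun t : R^o => x + t *: v)) 0) e scale0r addr0.
Qed.

Section SliceCalculus.
Variables (R : realType) (n k : nat).
Hypotheses (k_gt0 : (0 < k)%N) (k_le : (2 * k <= n)%N).
Local Notation l := (2 * k)%N.
Local Notation J := (J R k).
Variable X0 : 'M[R]_(n, l).
Hypothesis X0_stiefel : X0^T *m X0 = 1%:M.
Variable p : {linear 'M[R]_(n, l) -> 'rV[R]_(dimY n k)}.
Variable j : {linear 'rV[R]_(dimY n k) -> 'M[R]_(n, l)}.
Hypothesis j_horizontal : forall w, horizontal X0 (j w).
Hypothesis jK : forall w, p (j w) = w.
Hypothesis pK : forall h, j (p h) = horizontal_part X0 h.
Implicit Types (D v h X Y : 'M[R]_(n, l)) (w : 'rV[R]_(dimY n k)).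
Local Notation rad := (rad R n k).
Local Notation rot := (rot k).
Local Notation theta := (theta X0).
Local Notation pert := (pert X0).
Local Notation zeta1 := (zeta1 X0).
Local Notation zeta2 := (zeta2 X0).
Local Notation zeta_sqr := (zeta_sqr X0).
Local Notation rho := (rho X0).
Local Notation nrm := (nrm X0).
Local Notation G := (G X0 p).
Local Notation slice_dom := (slice_dom X0 p j).

Lemma Cr_on_inner r (U : set 'M[R]_(n, l)) Z : open U -> Cr_on r U (fun Y => inner Y Z : R^o).
Proof.
move=> oU; apply: (Cr_on_eq oU (f := fun Y => \sum_b \sum_a Y a b * Z a b)) => [Y _|].
  by rewrite inner_sum.
apply: Cr_on_sum => // b; apply: Cr_on_sum => // a.
apply: (Cr_onM (f := fun Y => Y a b) (g := cst (Z a b))) => //; first exact: Cr_on_coord.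
exact: Cr_on_cst.
Qed.

Lemma Cr_on_zeta_sqr r (U : set 'M[R]_(n, l)) : open U -> Cr_on r U (zeta_sqr : _ -> R^o).
Proof.
move=> oU; have z1 := Cr_on_inner r X0 oU; have z2 := Cr_on_inner r (X0 *m J) oU.
exact: (Cr_onD oU (Cr_onM oU z1 z1) (Cr_onM oU z2 z2)).
Qed.

Lemma open_zeta_sqr : open [set Y | 0 < zeta_sqr Y].
Proof.
apply: (@open_comp _ _ zeta_sqr [set x | 0 < x]); last exact: open_gt.
by move=> Y _; exact: (@Cr_on_zeta_sqr 0 setT openT).
Qed.

Lemma nrm_smooth : smooth_on [set Y | 0 < zeta_sqr Y] nrm.
Proof.
move=> r; have oU := open_zeta_sqr; set U := [set Y | _] in oU *.
have zC := Cr_on_zeta_sqr r oU.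
have rC : Cr_on r U (rho : _ -> R^o) by apply: Cr_on_sqrt.
have rV : Cr_on r U (fun Y => (rho Y)^-1 : R^o).
  by apply: Cr_onV => // Y z0; rewrite gt_eqF // sqrtr_gt0.
have z1 := Cr_onM oU (Cr_on_inner r X0 oU) rV.
have z2 := Cr_onM oU (Cr_on_inner r (X0 *m J) oU) rV.
apply: Cr_on_mx => // a b.
apply: (Cr_on_eq oU (f := (fun Y => zeta1 Y / rho Y : R^o) * (fun Y => Y a b : R^o) +
   (cst (-1 : R^o) * (fun Y => zeta2 Y / rho Y : R^o)) * (fun Y => \sum_c Y a c * J c b))).
  move=> Y _; rewrite /nrm /phase mul_rot [RHS]mxE [X in _ = X + _]mxE [X in _ = _ + X]mxE [(Y *m _) a b]mxE.
  by rewrite !fctE mulN1r !mulNr.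
apply: Cr_onD => //; apply: Cr_onM => //; first exact: Cr_on_coord.
  by apply: Cr_onM => //; exact: Cr_on_cst.
apply: Cr_on_sum => // c.
apply: (Cr_onM (f := fun Y => Y a c) (g := cst (J c b))) => //; first exact: Cr_on_coord.
exact: Cr_on_cst.
Qed.

Lemma G_smooth : smooth_on [set Y | 0 < zeta_sqr Y] G.
Proof.
move=> r; apply: (Cr_on_linear_comp (L := p) (f := nrm)); [exact: open_zeta_sqr| |exact: nrm_smooth].
exact: mx_linear_continuous.
Qed.

Lemma G_differentiable Y : 0 < zeta_sqr Y -> differentiable G Y.
Proof. by move=> z0; have [+ _] := G_smooth 1; apply. Qed.

(** On the line [X + t v] the product with [X0] stays real, and positive for small [t]. There [nrm]
    is the identity and [G] is linear. *)
Lemma diff_G_slice X v : zeta2 X = 0 -> 0 < zeta1 X -> zeta2 v = 0 -> 'd G X v = p v.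
Proof.
move=> z2 z1 vz; have z0 : 0 < zeta_sqr X by rewrite /zeta_sqr z2 expr0n addr0 exprn_gt0.
rewrite (diff_line _ (G_differentiable z0)).
rewrite -[RHS](@derive_val _ _ _ _ _ _ _ (is_derive_line (p X) (p v))).
apply: near_eq_derive => //.
have zE (t : R^o) : zeta1 (X + t *: v) = zeta1 X + t * zeta1 v by rewrite /zeta1 innerDl innerZl.
have z1c : {for (0 : R^o), continuous (fun t : R^o => zeta1 X + t * zeta1 v)}.
  by apply: continuousD; [exact: cst_continuous|apply: continuousM; [exact: cvg_id|exact: cst_continuous]].
near=> t; rewrite /G nrm_id; first by rewrite linearD linearZ.
  by rewrite /zeta2 innerDl innerZl -!/(zeta2 _) z2 vz mulr0 addr0.
rewrite zE; near: t; apply: (z1c [set x | 0 < x]); apply: open_nbhs_nbhs; split; first exact: open_gt.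
by rewrite /= mul0r addr0.
Unshelve. all: by end_near. Qed.

Lemma diff_G_rot X Y a b : a ^+ 2 + b ^+ 2 = 1 -> 0 < zeta_sqr X ->
  'd G (X *m rot a b) (Y *m rot a b) = 'd G X Y.
Proof.
move=> ab z0; have z0' : 0 < zeta_sqr (X *m rot a b) by rewrite zeta_sqr_rot ab mul1r.
have e1 := diff_line (Y *m rot a b) (G_differentiable z0').
have e2 := diff_line Y (G_differentiable z0).
refine (etrans e1 (etrans _ (esym e2))).
congr ('D_(1 : R^o) _ (0 : R^o)); apply/funext => t.
by rewrite scalemxAl -mulmxDl G_rot.
Qed.

(* G (X + t X J) is even in t. *)
Lemma diff_G_J X : 0 < zeta_sqr X -> 'd G X (X *m J) = 0.
Proof.
move=> z0; have dG := G_differentiable z0.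
have e : 'd G X (- (X *m J)) = 'd G X (X *m J).
  have e1 := diff_line (X *m J) dG; have e2 := diff_line (- (X *m J)) dG.
  refine (etrans e2 (etrans _ (esym e1))); congr ('D_(1 : R^o) _ (0 : R^o)); apply/funext => t.
  have t0 : 1 + t ^+ 2 != 0 by rewrite gt_eqF // ltr_wpDr // sqr_ge0.
  have -> : X + t *: - (X *m J) = (X + t *: (X *m J)) *m
      rot ((1 - t ^+ 2) / (1 + t ^+ 2)) (- 2 * t / (1 + t ^+ 2)).
    have -> : X + t *: (X *m J) = X *m rot 1 t by rewrite mul_rot scale1r.
    rewrite -mulmxA rotM scalerN -scaleNr -[X in X + _]scale1r -mul_rot; congr (_ *m rot _ _); field; exact: t0.
  by apply: G_rot; field; exact: t0.
move/eqP: e; rewrite linearN eq_sym -addr_eq0 -mulr2n -scaler_nat scaler_eq0 pnatr_eq0 /=.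
by move=> /eqP.
Qed.

Lemma tangent_rot X Y a b : tangent X Y -> tangent (X *m rot a b) (Y *m rot a b).
Proof.
rewrite /tangent => XY; rewrite !trmx_mul !mulmxA -!(mulmxA _ X^T) -!(mulmxA _ Y^T) -mulmxDl -mulmxDr.
by rewrite XY mulmx0 mul0mx.
Qed.

Lemma tangent_XJ X : X^T *m X = 1%:M -> tangent X (X *m J).
Proof. by move=> XX; rewrite /tangent trmx_mul -[J^T *m _ *m X]mulmxA mulmxA XX mul1mx mulmx1 J_tr subrr. Qed.

Lemma tangentD X v v' : tangent X v -> tangent X v' -> tangent X (v + v').
Proof.
rewrite /tangent mulmxDr [(v + v')^T]linearD /= mulmxDl addrACA => -> ->; exact: addr0.
Qed.

Lemma tangentZ X c v : tangent X v -> tangent X (c *: v).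
Proof. by rewrite /tangent -scalemxAr [(c *: v)^T]linearZ /= -scalemxAl -scalerDr => ->; rewrite scaler0. Qed.

Lemma nrmK X : 0 < zeta_sqr X -> exists a b, [/\ a ^+ 2 + b ^+ 2 = 1, nrm X = X *m rot a b,
  X = nrm X *m rot a (- b) & forall Y : 'M[R]_(n, l), Y *m rot a b *m rot a (- b) = Y /\ Y *m rot a (- b) *m rot a b = Y].
Proof.
move=> z0; have ab := phase_unit z0; exists (zeta1 X / rho X), (- zeta2 X / rho X).
move: ab; rewrite /nrm /phase; move: (_ / _) (_ / _) => b a ab.
have e1 : rot a b *m rot a (- b) = 1%:M by rewrite rotM -rot10 -ab; congr rot; ring.
have e2 : rot a (- b) *m rot a b = 1%:M by rewrite rotM -rot10 -ab; congr rot; ring.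
split=> //; first by rewrite -mulmxA e1 mulmx1.
by move=> Y; split; rewrite -mulmxA ?e1 ?e2 mulmx1.
Qed.

(** The derivative of [theta] turns tangency at [X] into the vanishing of the symmetric part at the
    fixed frame [X0]. *)
Lemma tangent_pert X v : tangent X v <-> sym2 X0 (v + pert (X - X0) v) = 0.
Proof.
set D := X - X0; have -> : X = X0 + D by rewrite addrC subrK.
have S : (D^T *m v + v^T *m D)^T = D^T *m v + v^T *m D.
  by rewrite [LHS]linearD /= !trmx_mul !trmxK addrC.
rewrite sym2D sym2Z sym2_X0 // S -mulr2n -[(_ + _) *+ 2]scaler_nat scalerA mulVf // scale1r.
rewrite /tangent [(X0 + D)^T]linearD /= mulmxDl mulmxDr addrACA.
by [].
Qed.

Lemma zeta2_pert D v : zeta2 (v + pert D v) = zeta2 v.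
Proof.
rewrite /zeta2 innerDl innerZl inner_sym_J //; first by rewrite mulr0 addr0.
by rewrite [LHS]linearD /= !trmx_mul !trmxK addrC.
Qed.

Lemma p_pert D v : p (v + pert D v) = p v.
Proof.
rewrite linearD linearZ /= (p_X0_sym X0_stiefel jK pK) ?scaler0 ?addr0 //.
by rewrite [LHS]linearD /= !trmx_mul !trmxK addrC.
Qed.

(** At [nrm X] the differential is [p] on vectors with [zeta2 = 0]; a preimage is found there with
    [pert_solve] and rotated back. *)
Lemma diff_G_surj X w : X^T *m X = 1%:M -> 0 < zeta_sqr X -> `|nrm X - X0| < rad ->
  exists2 v, tangent X v & 'd G X v = w.
Proof.
move=> XX z0 Xr; have [v ve] := pert_solve k_gt0 k_le X0_stiefel (j w) (ltW Xr).
have [sj ij] := j_horizontal w.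
have tv : tangent (nrm X) v by apply/tangent_pert; rewrite ve.
have zv : zeta2 v = 0 by rewrite -(zeta2_pert (nrm X - X0)) ve.
have [a [b [ab _ XE Q]]] := nrmK z0.
have ab' : a ^+ 2 + (- b) ^+ 2 = 1 by rewrite sqrrN.
have zn : 0 < zeta_sqr (nrm X).
  by rewrite /zeta_sqr zeta2_nrm zeta1_nrm // expr0n addr0 exprn_gt0 // rho_gt0.
exists (v *m rot a (- b)); first by rewrite XE; exact: tangent_rot.
have e := diff_G_rot v ab' zn; rewrite -XE in e; rewrite e diff_G_slice //; first by rewrite -(p_pert (nrm X - X0)) ve jK.
  exact: zeta2_nrm.
by rewrite zeta1_nrm // rho_gt0.
Qed.

(** After rotating to the slice, a multiple of the orbit direction is subtracted to make [zeta2]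
    vanish. The derivative of [theta] sends the remainder to a horizontal vector with [p = 0], hence
    to 0, and this derivative is injective. *)
Lemma diff_G_kernel X v : X^T *m X = 1%:M -> 0 < zeta_sqr X -> `|nrm X - X0| < rad -> tangent X v ->
  'd G X v = 0 -> exists c, v = c *: (X *m J).
Proof.
move=> XX z0 Xr tv dv.
have [a [b [ab X'E XE Q]]] := nrmK z0.
have zn : 0 < zeta_sqr (nrm X).
  by rewrite /zeta_sqr zeta2_nrm zeta1_nrm // expr0n addr0 exprn_gt0 // rho_gt0.
have z1 : 0 < zeta1 (nrm X) by rewrite zeta1_nrm // rho_gt0.
set v' := v *m rot a b; set Y := nrm X in X'E XE Q zn z1 Xr.
have YY : Y^T *m Y = 1%:M by exact: nrm_stiefel.
have tv' : tangent Y v' by rewrite X'E; exact: tangent_rot.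
have dv' : 'd G Y v' = 0 by rewrite X'E diff_G_rot.
pose c := zeta2 v' / zeta1 Y.
pose u := v' + (- c) *: (Y *m J).
have zJ : zeta2 (Y *m J) = zeta1 Y.
  have := zeta2_rot X0 Y 0 1; rewrite mul_rot scale0r scale1r add0r mul0r add0r mul1r; exact.
have zu : zeta2 u = 0.
  by rewrite /zeta2 innerDl innerZl -!/(zeta2 _) zJ /c mulNr divfK ?subrr // gt_eqF.
have tu : tangent Y u by apply: tangentD => //; apply: tangentZ; exact: tangent_XJ.
have pu : p u = 0.
  rewrite -(diff_G_slice (X := Y)) //; last exact: zeta2_nrm.
  by rewrite linearD linearZ /= dv' diff_G_J // scaler0 addr0.
have u0 : u = 0.
  apply: (pert_inj k_gt0 k_le X0_stiefel (ltW Xr)).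
  have hu : horizontal X0 (u + pert (Y - X0) u).
    split; first exact: (proj1 (tangent_pert _ _) tu).
    by have := zeta2_pert (Y - X0) u; rewrite zu.
  by rewrite -(horizontal_part_id hu) -pK p_pert pu linear0.
exists c; have [<- _] := Q v; rewrite -/v'.
have -> : v' = c *: (Y *m J) by apply/eqP; rewrite -subr_eq0 -scaleNr -/u u0.
by rewrite -scalemxAl -mulmxA -rot_sym_J mulmxA -XE.
Qed.
End SliceCalculus.

(** * Slice charts of the orbit space *)

Section Quotient.
Local Open Scope quotient_scope.
Variables (R : realType) (n k : nat).
Local Notation l := (2 * k)%N.
Local Notation V := (stiefel R n l).
Local Notation Y := (circleStiefel R n k).
Definition piY : V -> Y := \pi_(quotient_topology {eq_quot circle_equiv R n k}).

Lemma piY_eq (X Z : V) : piY X = piY Z <->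
  exists a b, a ^+ 2 + b ^+ 2 = 1 /\ \val Z = \val X *m rot k a b.
Proof.
split.
  move=> /(@eqmodP _ (circle_equiv R n k) X Z)/asboolP[A /SO2P[a [b [ab ->]]] ->].
  by exists a, b; rewrite diagSO2_rot.
move=> [a [b [ab ZX]]]; apply/(@eqmodP _ (circle_equiv R n k) X Z)/asboolP.
by exists (a%:M + b *: j2 R); rewrite ?diagSO2_rot //; apply/SO2P; exists a, b.
Qed.

Lemma piY_surj (y : Y) : exists X, piY X = y.
Proof. by exists (generic_quotient.repr (y : quotient_topology {eq_quot circle_equiv R n k})); exact: reprK. Qed.

Definition reprY (y : Y) : V := sval (cid (piY_surj y)).

Lemma reprYK y : piY (reprY y) = y.
Proof. by rewrite /reprY; case: cid. Qed.

Lemma valV_stiefel (X : V) : (\val X)^T *m \val X = 1%:M.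
Proof. by case: X => X /= /set_mem. Qed.

Lemma openY_val (U : set Y) (O : set 'M[R]_(n, l)) : open O ->
  (forall X : V, U (piY X) <-> O (\val X)) -> open U.
Proof.
move=> oO UO; rewrite /open /=; exists O => //; apply/seteqP; split=> X /=; first by move/UO.
by move=> h; apply/UO.
Qed.

Lemma openY_preimage (U : set Y) : open U ->
  exists2 O : set 'M[R]_(n, l), open O & forall X : V, U (piY X) <-> O (\val X).
Proof.
rewrite {1}/open /= => -[A oA e]; exists A => // X.
by rewrite -[U (piY X)]/((piY @^-1` U) X) -e.
Qed.
End Quotient.

Section SliceChart.
Variables (R : realType) (n k : nat).
Hypotheses (k_gt0 : (0 < k)%N) (k_le : (2 * k <= n)%N).
Local Notation l := (2 * k)%N.
Local Notation V := (stiefel R n l).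
Local Notation Y := (circleStiefel R n k).
Local Notation piY := (@piY R n k).
Variable X0 : 'M[R]_(n, l).
Hypothesis X0_stiefel : X0^T *m X0 = 1%:M.
Variable p : {linear 'M[R]_(n, l) -> 'rV[R]_(dimY n k)}.
Variable j : {linear 'rV[R]_(dimY n k) -> 'M[R]_(n, l)}.
Hypothesis j_horizontal : forall w, horizontal X0 (j w).
Hypothesis jK : forall w, p (j w) = w.
Hypothesis pK : forall h, j (p h) = horizontal_part X0 h.
Local Notation rad := (rad R n k).
Local Notation G := (G X0 p).
Local Notation slice_dom := (slice_dom X0 p j).
Local Notation lift := (lift X0 j).

Lemma open_slice_domI (W : set 'rV[R]_(dimY n k)) : open W ->
  open [set Z | slice_dom Z /\ W (G Z)].
Proof.
move=> oW; rewrite openE => Z [[z0 nr Gr] WG].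
have oz := @open_zeta_sqr _ _ _ X0.
have nC := @nrm_smooth _ _ _ X0 0%N Z z0.
have GC : {for Z, continuous G} := @G_smooth _ _ _ X0 p 0%N Z z0.
have jC := @mx_linear_continuous _ _ _ _ j.
have N1 : \forall x \near Z, 0 < zeta_sqr X0 x by exact: open_nbhs_nbhs.
have N2 : \forall x \near Z, `|nrm X0 x - X0| < rad.
  have C : (fun x => `|nrm X0 x - X0|) @ Z --> `|nrm X0 Z - X0|.
    have C0 : {for Z, continuous (nrm X0 - cst X0)} by apply: continuousB; [exact: nC|exact: cst_continuous].
    exact: (cvg_norm C0).
  by apply: (C [set x | x < rad]); apply: open_nbhs_nbhs; split => //; exact: open_lt.
have N3 : \forall x \near Z, `|j (G x)| < rad / 2.
  have C : (fun x => `|j (G x)|) @ Z --> `|j (G Z)|.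
    have C0 : {for Z, continuous (j \o G)} by apply: continuous_comp; [exact: GC|exact: jC].
    exact: (cvg_norm C0).
  by apply: (C [set x | x < rad / 2]); apply: open_nbhs_nbhs; split => //; exact: open_lt.
have N4 : \forall x \near Z, W (G x) by apply: GC; exact: open_nbhs_nbhs.
by near=> x; split; [split; near: x|near: x].
Unshelve. all: by end_near. Qed.

Let X0V : V := SigSub (mem_set (X0_stiefel : stiefel R n l X0)).

(** Everything is read off an arbitrary representative, which is harmless as [slice_dom] and [G] are
    invariant under rotations. The default frame in [insubd] is reached only if [lift w] is not
    orthonormal. *)
Definition slice_chart : chart R (dimY n k) Y :=
  @Chart R (dimY n k) Y (fun y => slice_dom (\val (reprY y))) (fun y => G (\val (reprY y)))
    (fun w => piY (insubd X0V (lift w))).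

Lemma slice_chart_dom (X : V) : cdom slice_chart (piY X) <-> slice_dom (\val X).
Proof.
have /piY_eq[a [b [ab e]]] := reprYK (piY X); rewrite [cdom _ _]/= e; split.
  by move=> h; exact/(slice_dom_rot X0 p j _ ab).
by move=> /(slice_dom_rot X0 p j _ ab).
Qed.

Lemma slice_chart_map (X : V) : cmap slice_chart (piY X) = G (\val X).
Proof.
by have /piY_eq[a [b [ab e]]] := reprYK (piY X); rewrite [cmap _ _]/= e G_rot.
Qed.

Lemma val_lift w : `|j w| < rad / 2 -> \val (insubd X0V (lift w)) = lift w.
Proof.
move=> wr; apply: insubdK; apply: mem_set.
exact: (lift_stiefel k_gt0 k_le X0_stiefel j_horizontal wr).
Qed.

Lemma slice_chart_range : crange slice_chart = [set w | `|j w| < rad / 2].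
Proof.
apply/seteqP; split=> [w [y]|w /= wr].
  have [X <-] := piY_surj y; move=> /slice_chart_dom[_ _ h] <- /=.
  by rewrite -[G _]/(cmap slice_chart (piY X)) slice_chart_map.
exists (piY (insubd X0V (lift w))).
  by apply/slice_chart_dom; rewrite val_lift //; exact: lift_slice_dom.
by rewrite slice_chart_map val_lift // G_lift.
Qed.

Lemma open_crange : open (crange slice_chart).
Proof.
rewrite slice_chart_range; apply: (@open_comp _ _ (fun w => `|j w|) [set x | x < rad / 2]); last exact: open_lt.
by move=> w _; have C := @mx_linear_continuous _ _ _ _ j w; exact: (cvg_norm C).
Qed.

Lemma open_cdom : open (cdom slice_chart).
Proof.
apply: (openY_val (open_slice_domI openT)) => X.
have [d1 d2] := slice_chart_dom X; split=> [h|[h _]]; [exact: (conj (d1 h) I)|exact: (d2 h)].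
Qed.

Lemma slice_chart_homeo : chart_homeo slice_chart.
Proof.
split.
- exact: open_cdom.
- exact: open_crange.
- move=> y; have [X <-] := piY_surj y => /slice_chart_dom Xd.
  have [z0 _ jr] := Xd; rewrite slice_chart_map /=.
  have [a [b [ab e _ _]]] := nrmK z0.
  apply/esym/piY_eq; exists a, b; split=> //.
  rewrite val_lift // lift_G // valV_stiefel //.
- rewrite continuous_open_subspace; last exact: open_cdom.
  apply/(continuous_inP _ open_cdom) => W oW.
  apply: (openY_val (open_slice_domI oW)) => X.
  have e := slice_chart_map X; have [d1 d2] := slice_chart_dom X.
  split=> [[h WX]|[h WX]]; split; [exact: (d1 h)|rewrite -e; exact: WX|exact: (d2 h)|].
  by move: WX; rewrite -e.
- rewrite continuous_open_subspace; last exact: open_crange.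
  apply/(continuous_inP _ open_crange) => U /openY_preimage[A oA UA].
  rewrite slice_chart_range openE => w [/= wr /UA]; rewrite val_lift // => Aw.
  have N1 : \forall x \near w, `|j x| < rad / 2.
    have := open_crange; rewrite slice_chart_range openE; exact.
  have lC : lift x @[x --> w] --> lift w.
    apply/(@cvgrPdist_lt _ _ _ _ (nbhs_filter w)) => e e0; have e2 : 0 < e / 2 by rewrite divr_gt0.
    have jC := @mx_linear_continuous _ _ _ _ j w.
    have N2 : \forall x \near w, `|j w - j x| < e / 2 by move/(@cvgrPdist_lt _ _ _ _ (nbhs_filter w)): jC; apply.
    near=> x; have xr : `|j x| < rad / 2 by near: x.
    apply: le_lt_trans (lift_lipschitz k_gt0 k_le X0_stiefel wr xr) _.
    by rewrite mulrC -ltr_pdivlMr //; near: x.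
  have N3 : \forall x \near w, A (lift x) by apply: lC; exact: open_nbhs_nbhs.
  near=> x; have xr : `|j x| < rad / 2 by near: x.
  split => //=; apply/UA; rewrite val_lift //; near: x; exact: N3.
Unshelve. all: by end_near. Qed.

Lemma slice_chart_atlas : circleStiefel_atlas R n k slice_chart.
Proof.
split; first exact: slice_chart_homeo.
move=> X /slice_chart_dom[z0 nr jr].
exists [set Z | 0 < zeta_sqr X0 Z], G; split.
- exact: open_zeta_sqr.
- exact: z0.
- exact: G_smooth.
- by move=> Z _ _; exact: slice_chart_map.
- apply/seteqP; split=> // w _.
  have XX := valV_stiefel X.
  have [v tv <-] := diff_G_surj k_gt0 k_le X0_stiefel j_horizontal jK pK w XX z0 nr.
  by exists v => //; exact: tangent_tangent_vectors.
Qed.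
End SliceChart.

(** The atlas is given by a property, so a chart around each point has to be exhibited before an
    immersion says anything there. The kernel of ['d G] is recorded because it decides where the
    derivative of an immersion may vanish. *)
Lemma chart_exists (R : realType) (n k : nat) (X0 : stiefel R n (2 * k)) : (0 < k)%N -> (2 * k <= n)%N ->
  exists (c : chart R (dimY n k) (circleStiefel R n k)) (U : set 'M[R]_(n, 2 * k)) (G : 'M[R]_(n, 2 * k) -> 'rV[R]_(dimY n k)),
  [/\ circleStiefel_atlas R n k c, open U, U (\val X0) & smooth_on U G] /\
  (forall X : stiefel R n (2 * k), U (\val X) -> cdom c (piY X) /\ cmap c (piY X) = G (\val X)) /\
  (forall (X : stiefel R n (2 * k)) v, U (\val X) -> tangent (\val X) v -> 'd G (\val X) v = 0 ->
     exists a, v = a *: (\val X *m J R k)).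
Proof.
move=> k_gt0 k_le; have XX := valV_stiefel X0.
have [p [j [j_hor jK pK]]] := horizontal_coordinates k_gt0 k_le XX.
exists (slice_chart XX p j), (slice_dom (\val X0) p j), (G (\val X0) p); split; last split.
- split.
  + exact: slice_chart_atlas.
  + have := @open_slice_domI R n k (\val X0) p j _ (@openT 'rV[R]_(dimY n k)).
    by congr open; apply/seteqP; split=> Z //= -[].
  + exact: slice_dom_X0.
  + by move=> r; apply: Cr_on_sub (@G_smooth _ _ _ _ _ r) => Z [].
- by move=> X Xd; split; [exact/slice_chart_dom|exact: slice_chart_map].
- by move=> X v [z0 nr _] tv; apply: diff_G_kernel => //; exact: valV_stiefel.
Qed.

(** * Derivatives of immersions *)

Section CurveDerivative.
Variables (R : realType) (n k : nat).
Hypotheses (k_gt0 : (0 < k)%N) (k_le : (2 * k <= n)%N).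
Local Notation l := (2 * k)%N.
Local Notation V := (stiefel R n l).
Local Notation Y := (circleStiefel R n k).
Local Notation piY := (@piY R n k).
Variables (N : nat) (f : Y -> 'rV[R]_N).
Implicit Types (X v U : 'M[R]_(n, l)).

(* Junk value 0 outside of the Stiefel manifold. *)
Definition ambient X : 'rV[R]_N := oapp (fun Z : V => f (piY Z)) 0 (insub X).

Lemma ambient_val (Z : V) : ambient (\val Z) = f (piY Z).
Proof. by rewrite /ambient valK. Qed.

Definition toV X (XX : X^T *m X = 1%:M) : V := SigSub (mem_set (XX : stiefel R n l X)).

Lemma ambientE X (XX : X^T *m X = 1%:M) : ambient X = f (piY (toV XX)).
Proof. exact: (ambient_val (toV XX)). Qed.

(** Defined along the Cayley curve rather than through a chart: no choice is involved, so the sign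
    rule under [X -> -X] and the continuity concern one global function. *)
Definition dF X v : 'rV[R]_N := 'D_(1 : R^o) (fun t : R^o => ambient (curve X v t)) (0 : R^o).

Lemma ambientN X : X^T *m X = 1%:M -> ambient (- X) = ambient X.
Proof.
move=> XX; have XX' : (- X)^T *m (- X) = 1%:M by rewrite [(- X)^T]linearN /= mulNmx mulmxN opprK.
rewrite (ambientE XX) (ambientE XX'); congr f; apply/piY_eq; exists (-1), (- 0); split.
  by rewrite oppr0 expr0n addr0 sqrrN expr1n.
by rewrite rotN rot10 /= mulmxN mulmx1 opprK.
Qed.

Lemma curveN X v t : curve (- X) (- v) t = - curve X v t.
Proof.
have g : generator (- X) (- v) = generator X v.
  by rewrite /generator [(- X)^T]linearN [(- v)^T]linearN /= !(mulNmx, mulmxN, opprK).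
by rewrite /curve g /cayley mulmxN scalerN opprB opprK addrC.
Qed.

Lemma dFN X v : X^T *m X = 1%:M -> tangent X v -> dF (- X) (- v) = dF X v.
Proof.
move=> XX tv; congr ('D_(1 : R^o) _ (0 : R^o)); apply/funext => t.
by have [_ _ c1 _] := tangent_curve XX tv; rewrite curveN ambientN.
Qed.

Hypothesis f_imm : immersion (circleStiefel_atlas R n k) f.

Lemma dF_local X0 : X0^T *m X0 = 1%:M ->
  exists (c : chart R (dimY n k) Y) (U : set 'M[R]_(n, l)) (G : 'M[R]_(n, l) -> 'rV[R]_(dimY n k)),
  [/\ circleStiefel_atlas R n k c, open U, U X0 & smooth_on U G] /\
  forall X (XX : X^T *m X = 1%:M), U X ->
    [/\ cdom c (piY (toV XX)), cmap c (piY (toV XX)) = G X &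
        forall v, tangent X v ->
          dF X v = 'd (f \o cinv c) (G X) ('d G X v) /\
          ('d G X v = 0 -> exists a, v = a *: (X *m J R k))].
Proof.
move=> XX0; have [c [U [G [[cA oU UX0 GC] [cU kerU]]]]] := chart_exists (toV XX0) k_gt0 k_le.
exists c, U, G; split=> // X XX UX; have [cX mX] := cU (toV XX) UX; split=> // v tv; split; last first.
  exact: (kerU (toV XX)).
have [[_ _ cinvK _ _] _] := cA.
have [fsm _] := f_imm cA; have [fs _] := fsm 1%N.
have [cs c0 cS cd] := tangent_curve XX tv.
have cc : {for (0 : R^o), continuous (curve X v : R^o -> _)} := cs 0%N (0 : R^o) I.
have dG : differentiable G (curve X v 0) by rewrite c0; have [+ _] := GC 1%N; apply.
have e1 := is_derive_along dG cd.
have dg : differentiable (f \o cinv c) ((G \o (curve X v : R^o -> _)) (0 : R^o)).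
  by rewrite /= c0; apply: fs; exists (piY (toV XX)).
have [_ e2] := is_derive_along dg e1.
rewrite /= c0 in e2; rewrite -e2; apply: near_eq_derive => //.
have oU' : \forall t \near (0 : R^o), U (curve X v t).
  by apply: cc; apply: open_nbhs_nbhs; split=> //; rewrite c0.
near=> t; have Ut : U (curve X v t) by near: t.
have [ct mt] := cU (toV (cS t)) Ut.
by rewrite (ambientE (cS t)) /= -mt cinvK.
Unshelve. all: by end_near. Qed.

Lemma dF_linear X a v v' : X^T *m X = 1%:M -> tangent X v -> tangent X v' ->
  dF X (a *: v + v') = a *: dF X v + dF X v'.
Proof.
move=> XX tv tv'; have [c [U [G [[cA oU UX _] H]]]] := dF_local XX; have [_ _ h] := H X XX UX.
have tw : tangent X (a *: v + v') by apply: tangentD => //; exact: tangentZ.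
by have [-> _] := h _ tw; have [-> _] := h _ tv; have [-> _] := h _ tv'; rewrite !linearP.
Qed.

Lemma dF_kernel X v : X^T *m X = 1%:M -> tangent X v -> dF X v = 0 -> exists a, v = a *: (X *m J R k).
Proof.
move=> XX tv; have [c [U [G [[cA oU UX _] H]]]] := dF_local XX; have [cX mX h] := H X XX UX.
have [-> ker] := h _ tv; have [_ inj] := f_imm cA => e; apply: ker.
by apply: (inj _ cX); rewrite mX e linear0.
Qed.

Lemma dF_affine_tangent X (XX : X^T *m X = 1%:M) v : tangent X v ->
  affine_tangent (circleStiefel_atlas R n k) f (piY (toV XX)) (ambient X + dF X v).
Proof.
move=> tv; have [c [U [G [[cA oU UX _] H]]]] := dF_local XX; have [cX mX h] := H X XX UX.
exists c; split=> //; exists ('d G X v); rewrite mX (ambientE XX).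
by have [-> _] := h _ tv.
Qed.

(** Stated for arbitrary filters in order to apply to neighbourhoods within a closed set of test
    matrices, where the frames are orthonormal and [ambient] is meaningful. *)
Lemma dF_cvg (T : Type) (F : set_system T) (FF : Filter F) (X v : T -> 'M[R]_(n, l)) X0 v0 :
  X0^T *m X0 = 1%:M -> tangent X0 v0 -> X @ F --> X0 -> v @ F --> v0 ->
  (\forall t \near F, (X t)^T *m X t = 1%:M /\ tangent (X t) (v t)) ->
  (fun t => dF (X t) (v t)) @ F --> dF X0 v0.
Proof.
move=> XX0 tv0 XC vC Xt; have [c [U [G [[cA oU UX0 GC] H]]]] := dF_local XX0.
have [cX0 mX0 h0] := H X0 XX0 UX0; have [-> _] := h0 _ tv0.
have [[_ ocr _ _ _] _] := cA.
have [fs _] := f_imm cA.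
pose g := f \o cinv c.
have XU : \forall t \near F, U (X t) by apply: XC; exact: open_nbhs_nbhs.
(* The composed differential in terms of partial derivatives, each of which is continuous because
   [G] and [f \o cinv c] are C^1. *)
pose L Z w := \sum_a (\sum_i \sum_j w i j *: 'D_(delta_mx i j) G Z) 0 a *: 'D_(delta_mx 0 a) g (G Z).
have LE Z w : differentiable G Z -> differentiable g (G Z) -> 'd g (G Z) ('d G Z w) = L Z w.
  by move=> dG dg; rewrite diff_mxE // big_ord1 diff_mxE.
have dG Z : U Z -> differentiable G Z by have [+ _] := GC 1%N; apply.
have dg Z (ZZ : Z^T *m Z = 1%:M) : U Z -> differentiable g (G Z).
  move=> UZ; have [cZ mZ _] := H Z ZZ UZ; have [+ _] := fs 1%N; apply.
  by exists (piY (toV ZZ)).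
rewrite LE; [|exact: dG|exact: dg].
have GX : (fun t => G (X t)) @ F --> G X0.
  apply: (cvg_comp X G XC); exact: (GC 0%N X0 UX0).
have LC : (fun t => L (X t) (v t)) @ F --> L X0 v0.
  apply: (@cvg_bigsum R _ _ _ F FF) => a; apply: cvgZ.
    rewrite (_ : (fun x => _) = fun t => (\sum_i \sum_j v t i j *: 'D_(delta_mx i j) G (X t)) 0 a) //.
    apply: (@cvg_comp _ _ _ (fun t => \sum_i \sum_j v t i j *: 'D_(delta_mx i j) G (X t))
      (fun M : 'rV[R]_(dimY n k) => M 0 a) F (nbhs (\sum_i \sum_j v0 i j *: 'D_(delta_mx i j) G X0))); last exact: coord_continuous.
    apply: (@cvg_bigsum R _ _ _ F FF) => i; apply: (@cvg_bigsum R _ _ _ F FF) => j; apply: cvgZ.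
      apply: (@cvg_comp _ _ _ v (fun M : 'M[R]_(n, l) => M i j) F (nbhs v0)) => //; exact: coord_continuous.
    apply: (cvg_comp X ('D_(delta_mx i j) G) XC).
    by have [_ D] := GC 1%N; exact: (D (delta_mx i j) X0 UX0).
  apply: (cvg_comp (fun t => G (X t)) ('D_(delta_mx 0 a) g) GX).
  have [_ D] := fs 1%N; apply: (D (delta_mx 0 a) (G X0)).
  by exists (piY (toV XX0)).
apply: cvg_trans LC; apply: near_eq_cvg.
near=> t; have [XXt tt] : (X t)^T *m X t = 1%:M /\ tangent (X t) (v t) by near: t.
have Ut : U (X t) by near: t.
have [_ _ ht] := H _ XXt Ut; have [-> _] := ht _ tt; rewrite -/g LE //; [exact: dG|exact: dg].
Unshelve. all: by end_near. Qed.

Lemma ambient_cvg (T : Type) (F : set_system T) (FF : Filter F) (X : T -> 'M[R]_(n, l)) X0 :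
  X0^T *m X0 = 1%:M -> X @ F --> X0 -> (\forall t \near F, (X t)^T *m X t = 1%:M) ->
  (fun t => ambient (X t)) @ F --> ambient X0.
Proof.
move=> XX0 XC Xt; have [c [U [G [[cA oU UX0 GC] H]]]] := dF_local XX0.
have [cX0 mX0 _] := H X0 XX0 UX0; have [[_ _ cinvK _ _] _] := cA.
have [fs _] := f_imm cA.
have XU : \forall t \near F, U (X t) by apply: XC; exact: open_nbhs_nbhs.
have GX : (fun t => G (X t)) @ F --> G X0 by apply: (cvg_comp X G XC); exact: (GC 0%N X0 UX0).
have E Z (ZZ : Z^T *m Z = 1%:M) : U Z -> ambient Z = (f \o cinv c) (G Z).
  by move=> UZ; have [cZ mZ _] := H Z ZZ UZ; rewrite (ambientE ZZ) /= -mZ cinvK.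
have C : (fun t => (f \o cinv c) (G (X t))) @ F --> (f \o cinv c) (G X0).
  apply: (cvg_comp (fun t => G (X t)) (f \o cinv c) GX); apply: (fs 0%N (G X0)).
  by exists (piY (toV XX0)).
rewrite (E X0 XX0 UX0); apply: cvg_trans C; apply: near_eq_cvg.
near=> t; apply/esym/E; by near: t.
Unshelve. all: by end_near. Qed.

End CurveDerivative.

(** * Compactness and conclusion *)

Lemma compact_ball_mx (R : realType) m n (r : R) : 0 <= r -> compact [set M : 'M[R]_(m, n) | `|M| <= r].
Proof.
move=> r0; have cK : compact [set v : 'rV[R]_(m * n) | forall i, `[- r, r]%classic (v ord0 i)].
  by apply: (@rV_compact _ _ (fun=> `[- r, r]%classic)) => i; exact: segment_compact.
pose g : {linear 'rV[R]_(m * n) -> 'M[R]_(m, n)} := vec_mx.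
have gC : continuous g by exact: mx_linear_continuous.
have := @continuous_compact _ _ g _ (continuous_subspaceT gC) cK.
congr compact; apply/seteqP; split=> [_ [v /= vr <-]|M /= Mr].
  apply: mx_norm_le => // i j; rewrite mxE ler_norml.
  by have := vr (mxvec_index i j); rewrite in_itv.
exists (mxvec M); last exact: mxvecK.
move=> i /=; rewrite in_itv /= -ler_norml; case/mxvec_indexP: i => a b.
by rewrite mxvecE; exact: le_trans (entry_le_norm _ _ _) Mr.
Qed.

(** Passage from local to uniform: by compactness of a ball, a single radius works for all points of
    [K], and the Lipschitz constant of [kap] carries it back to the cube as the [d] of
    [borsuk_ulam]. Signs are compared only inside [K], where the functions [psi] are controlled. *)
Lemma equivariant_zero (R : realType) (O : gluing) (T : finType) a b
    (kap : (O -> R) -> 'M[R]_(a, b)) (K : set 'M[R]_(a, b)) (psi : T -> 'M[R]_(a, b) -> R) :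
  good O -> #|T| = #|O| -> mblip kap -> (forall z, K (kap z)) -> closed K ->
  (forall i, equivariant (fun z => psi i (kap z) : R^o)) ->
  ~ forall x, K x -> exists i, \forall y \near x, K y -> 0 < psi i x * psi i y.
Proof.
move=> gO cT kapL Kk clK psiE loc.
have [e [e0 kapB kapE]] : exists e, [/\ 0 <= e, forall z, `|kap z| <= e &
    forall z z' d, 0 <= d -> (forall v, `|z v - z' v| <= d) -> `|kap z - kap z'| <= e * d].
  have {}kapL (q : 'I_a * 'I_b) : exists e, [/\ 0 <= e, forall z, `|kap z q.1 q.2| <= e &
    forall z z' d, 0 <= d -> (forall v, `|z v - z' v| <= d) -> `|kap z q.1 q.2 - kap z' q.1 q.2| <= e * d].
    exact: kapL.
  have [e He] := choice kapL.
  have e0 q : 0 <= e q by have [] := He q.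
  have le q : e q <= \sum_p e p by rewrite (bigD1 q) //= lerDl sumr_ge0.
  exists (\sum_p e p); split; first exact: sumr_ge0.
    move=> z; apply: mx_norm_le => [|i j]; first exact: sumr_ge0.
    by have [_ h _] := He (i, j); exact: le_trans (h z) (le (i, j)).
  move=> z z' d d0 zz'; apply: mx_norm_le => [|i j]; first by rewrite mulr_ge0 ?sumr_ge0.
  have [_ _ h] := He (i, j); rewrite !mxE; apply: le_trans (h z z' d d0 zz') _.
  by rewrite ler_wpM2r.
have cB := @compact_ball_mx R a b e e0.
pose P (d : R) (x : 'M[R]_(a, b)) := K x -> exists i, forall y y', K y -> K y' -> `|y - x| <= d -> `|y' - x| <= d ->
  0 < psi i y * psi i y'.
have : \forall d \near (0 : R)^'+, [set M : 'M[R]_(a, b) | `|M| <= e] `<=` P d.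
  apply: (proj1 (compact_near_coveringP _) cB) => x _.
  have [Kx|nKx] := pselect (K x); last first.
    have oC : \forall y \near x, ~ K y by apply: open_nbhs_nbhs; split => //; exact: closed_openC.
    exists (~` K, setT); first by split => //=; exact: filterT.
    by move=> [y d] [/= nKy _] /nKy.
  have [i /nbhs_ballP[s s0 hs]] := loc x Kx.
  exists (ball x (s / 2), [set d | d < s / 2]).
    split => /=; first by apply: nbhsx_ballx; rewrite divr_gt0.
    by apply: nbhs_right_lt; rewrite divr_gt0.
  move=> [y d] [/= xy ds] Ky; exists i => z z' Kz Kz' zd z'd.
  have near_x w : `|w - y| <= d -> ball x s w.
    move: xy; rewrite -!ball_normE /= => xy wd.
    rewrite (_ : x - w = (x - y) - (w - y)); last by rewrite opprB addrA subrK.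
    by apply: le_lt_trans (ler_normB _ _) _; move: xy wd ds; lra.
  have h1 := hs z (near_x z zd) Kz; have h2 := hs z' (near_x z' z'd) Kz'.
  have : 0 < (psi i x * psi i x) * (psi i z * psi i z').
    by rewrite mulrACA; exact: mulr_gt0.
  rewrite pmulr_rgt0 // -expr2 lt_def sqr_ge0 andbT sqrf_eq0.
  by apply: contraTneq h1 => ->; rewrite mul0r ltxx.
case=> d0 /= d0p hd0.
pose d := Num.min (d0 / 2) 1.
have dp : 0 < d by rewrite lt_min ltr01 divr_gt0.
have hd : [set M : 'M[R]_(a, b) | `|M| <= e] `<=` P d.
  apply: hd0 => //=; rewrite sub0r normrN gtr0_norm //.
  by rewrite gt_min ltr_pdivrMr // mulr_natr mulr2n ltrDl d0p.
pose hs := [seq (fun z => psi i (kap z) : R^o) | i <- enum T].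
have inhs i : List.In (fun z => psi i (kap z) : R^o) hs.
  rewrite /hs; have : i \in enum T by rewrite mem_enum.
  by elim: (enum T) => //= j s IH; rewrite inE => /predU1P[->|/IH]; [left|right].
have hsP h : List.In h hs -> exists i, h = fun z => psi i (kap z).
  by rewrite /hs; elim: (enum T) => //= j s IH [<-|/IH//]; exists j.
have e1 : 0 < e + 1 by rewrite ltr_wpDl.
apply: (@borsuk_ulam R O hs (d / (e + 1)) gO).
- by rewrite size_map -cardE.
- by move=> h /hsP[i ->]; exact: psiE.
- by rewrite divr_gt0.
move=> z; have [i hi] := hd _ (kapB z) (Kk z).
exists (fun z => psi i (kap z)); first exact: inhs.
have small q : (forall v, `|q v - z v| <= d / (e + 1)) -> `|kap q - kap z| <= d.
  move=> qz; have de : 0 <= d / (e + 1) by rewrite divr_ge0 // ltW.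
  apply: le_trans (kapE q z _ de qz) _.
  by rewrite mulrCA ler_piMr ?(ltW dp) // ler_pdivrMr // mul1r lerDl.
by move=> q q' /small qz /small q'z; exact: hi.
Qed.

Section MatrixLimits.
Variables (R : realType) (T : Type) (F : set_system T) (FF : Filter F).

Lemma cvg_entry m n (A : T -> 'M[R]_(m, n)) (A0 : 'M[R]_(m, n)) i j : A @ F --> A0 -> (fun t => A t i j) @ F --> A0 i j.
Proof.
move=> cA; apply: (@cvg_comp _ _ _ A (fun M : 'M[R]_(m, n) => M i j) F (nbhs A0)) => //.
exact: coord_continuous.
Qed.

Lemma cvg_linear_mx m n (W : normedModType R) (g : {linear 'M[R]_(m, n) -> W}) (A : T -> 'M[R]_(m, n)) (A0 : 'M[R]_(m, n)) :
  A @ F --> A0 -> (fun t => g (A t)) @ F --> g A0.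
Proof. move=> cA; apply: (cvg_comp A g cA); exact: mx_linear_continuous. Qed.

Lemma cvg_mulmx m n p (A : T -> 'M[R]_(m, n)) (B : T -> 'M[R]_(n, p))
    (A0 : 'M[R]_(m, n)) (B0 : 'M[R]_(n, p)) :
  A @ F --> A0 -> B @ F --> B0 -> (fun t => A t *m B t) @ F --> A0 *m B0.
Proof.
move=> cA cB; apply: cvg_mx => i j; rewrite mxE.
rewrite (_ : (fun x => _) = fun t => \sum_c A t i c * B t c j); last by apply/funext => t; rewrite mxE.
apply: (@cvg_bigsum R R^o _ _ F FF) => c; apply: cvgM; exact: cvg_entry.
Qed.

Lemma cvg_trmx m n (A : T -> 'M[R]_(m, n)) (A0 : 'M[R]_(m, n)) : A @ F --> A0 -> (fun t => (A t)^T) @ F --> A0^T.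
Proof.
move=> cA; apply: cvg_mx => i j; rewrite mxE.
rewrite (_ : (fun x => _) = fun t => A t j i); last by apply/funext => t; rewrite mxE.
exact: cvg_entry.
Qed.

Lemma cvg_same_sign (g : T -> R) c : g @ F --> c -> c != 0 -> \forall t \near F, 0 < c * g t.
Proof.
move=> gC c0; have cc : 0 < c * c by rewrite -expr2 lt_def sqr_ge0 andbT sqrf_eq0.
have C : (fun t => c * g t) @ F --> c * c by apply: cvgM => //; exact: cvg_cst.
by apply: (C [set x | 0 < x]); apply: open_nbhs_nbhs; split => //; exact: open_gt.
Qed.
End MatrixLimits.

Lemma closed_eq_cst (R : realType) (E W : normedModType R) (g : E -> W) c : continuous g -> closed [set x | g x = c].
Proof.
move=> gC; apply: (@closed_comp _ _ g [set c]) => [x _|]; first exact: gC.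
apply: compact_closed; [exact: norm_hausdorff|exact: compact_set1].
Qed.

(** * The linear map Phi at a frame *)

Section Sides.
Variables (R : realType) (n k : nat).
Local Notation l := (2 * k)%N.
Local Notation J := (J R k).
Implicit Types (X U : 'M[R]_(n, l)).

Definition gram X U : 'M[R]_l := X^T *m U + U^T *m X.

(** The orthogonal projection to the tangent space at an orthonormal [X]. It extends the derivative
    linearly to all matrices [U], so that the directions can range over a full sphere. *)
Definition tan_part X U := U - 2^-1 *: (X *m gram X U).

Definition side X U (q : upper l + unit) : R :=
  match q with inl q => gram X U (val q).1 (val q).2 | inr _ => inner U (X *m J) end.

Lemma gram_tr X U : (gram X U)^T = gram X U.
Proof. by rewrite /gram linearD /= !trmx_mul !trmxK addrC. Qed.

Lemma gramP X a U U' : gram X (a *: U + U') = a *: gram X U + gram X U'.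
Proof.
rewrite /gram mulmxDr -scalemxAr [(a *: U + U')^T]linearP /= mulmxDl -scalemxAl.
by rewrite scalerDr addrACA.
Qed.

Lemma gramN X U : gram (- X) U = - gram X U.
Proof. by rewrite /gram [(- X)^T]linearN /= mulNmx mulmxN opprD. Qed.

Lemma tan_partP X a U U' : tan_part X (a *: U + U') = a *: tan_part X U + tan_part X U'.
Proof.
rewrite /tan_part gramP mulmxDr -scalemxAr scalerDr.
by rewrite scalerBr opprD addrACA !scalerA [a / 2]mulrC.
Qed.

Lemma tan_partN X U : tan_part (- X) U = tan_part X U.
Proof. by rewrite /tan_part gramN mulNmx mulmxN opprK. Qed.

Lemma tan_part_id X U : tangent X U -> tan_part X U = U.
Proof. by rewrite /tangent /tan_part /gram => ->; rewrite mulmx0 scaler0 subr0. Qed.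

Lemma tan_part_tangent X U : X^T *m X = 1%:M -> tangent X (tan_part X U).
Proof.
move=> XX; rewrite /tangent -/(gram X (tan_part X U)) /tan_part -scaleNr addrC gramP.
have -> : gram X (X *m gram X U) = gram X U *+ 2.
  by rewrite {1}/gram trmx_mul gram_tr mulmxA XX mul1mx -mulmxA XX mulmx1 mulr2n.
by rewrite -[gram X U *+ 2]scaler_nat scalerA mulNr mulVf // scaleN1r addNr.
Qed.

Lemma sideP X a U U' q : side X (a *: U + U') q = a * side X U q + side X U' q.
Proof. by case: q => [q|[]] /=; [rewrite gramP !mxE|rewrite innerDl innerZl]. Qed.

Lemma sideN X U q : side (- X) U q = - side X U q.
Proof.
case: q => [q|[]] /=; first by rewrite gramN mxE.
by rewrite mulNmx innerC innerNl innerC.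
Qed.

Lemma side0 X q : side X 0 q = 0.
Proof. by have := sideP X (-1) 0 0 q; rewrite scaler0 addr0 mulN1r addNr. Qed.

Lemma side_eq0 X U : (forall q, side X U q = 0) -> tangent X U /\ inner U (X *m J) = 0.
Proof.
move=> s0; split; last exact: (s0 (inr tt)).
apply/matrixP => i j; rewrite [RHS]mxE; have [ij|/ltnW ij] := leqP i j.
  exact: (s0 (inl (exist _ (i, j) ij))).
by rewrite -/(gram X U) -gram_tr mxE; exact: (s0 (inl (exist _ (j, i) ij))).
Qed.

Lemma tangent_XJ_eq0 X U : (0 < k)%N -> X^T *m X = 1%:M -> inner U (X *m J) = 0 ->
  (exists a, U = a *: (X *m J)) -> U = 0.
Proof.
move=> k0 XX + [a Ua]; rewrite Ua innerZl inner_X0_J // => /eqP; rewrite mulf_eq0 => /orP[/eqP->|].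
  by rewrite scale0r.
by rewrite pnatr_eq0 muln_eq0 /= => k00; rewrite lt0n k00 in k0.
Qed.

Section Limits.
Variables (T : Type) (F : set_system T) (FF : Filter F) (A B : T -> 'M[R]_(n, l)) (A0 B0 : 'M[R]_(n, l)).
Hypotheses (cA : A @ F --> A0) (cB : B @ F --> B0).

Lemma cvg_gram : (fun t => gram (A t) (B t)) @ F --> gram A0 B0.
Proof. by apply: cvgD; apply: cvg_mulmx => //; exact: cvg_trmx. Qed.

Lemma cvg_tan_part : (fun t => tan_part (A t) (B t)) @ F --> tan_part A0 B0.
Proof.
apply: cvgB => //; apply: cvgZ; first exact: cvg_cst.
by apply: cvg_mulmx => //; exact: cvg_gram.
Qed.

Lemma cvg_inner : (fun t => inner (A t) (B t)) @ F --> inner A0 B0.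
Proof.
apply: (@cvg_bigsum R R^o _ _ F FF) => i; apply: (cvg_entry (A := fun t => (A t)^T *m B t)).
by apply: cvg_mulmx => //; exact: cvg_trmx.
Qed.
End Limits.

Lemma cvg_side (T : Type) (F : set_system T) (FF : Filter F) (A B : T -> 'M[R]_(n, l)) (A0 B0 : 'M[R]_(n, l)) q :
  A @ F --> A0 -> B @ F --> B0 -> (fun t => side (A t) (B t) q) @ F --> side A0 B0 q.
Proof.
move=> cA cB; case: q => [q|[]] /=.
  by apply: (cvg_entry (A := fun t => gram (A t) (B t))); exact: cvg_gram.
by apply: cvg_inner => //; apply: cvg_mulmx => //; exact: cvg_cst.
Qed.

Lemma card_sides : #|{: upper l + unit}| = (k * (2 * k + 1) + 1)%N.
Proof.
have cu : (#|{: upper l}| = k * (2 * k + 1))%N.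
  by apply: double_inj; rewrite card_upper; lia.
by rewrite card_sum card_unit cu.
Qed.
End Sides.

Section TangentDerivative.
Variables (R : realType) (n k : nat).
Hypotheses (k_gt0 : (0 < k)%N) (k_le : (2 * k <= n)%N).
Local Notation l := (2 * k)%N.
Variables (N : nat) (f : circleStiefel R n k -> 'rV[R]_N).
Hypothesis f_imm : immersion (circleStiefel_atlas R n k) f.
Implicit Types (X U : 'M[R]_(n, l)).

Definition dT X U := dF f X (tan_part X U).

Lemma dTP X a U U' : X^T *m X = 1%:M -> dT X (a *: U + U') = a *: dT X U + dT X U'.
Proof. by move=> XX; rewrite /dT tan_partP dF_linear //; exact: tan_part_tangent. Qed.

Lemma dT0 X : X^T *m X = 1%:M -> dT X 0 = 0.
Proof. by move=> XX; have := dTP (-1) 0 0 XX; rewrite scaler0 addr0 scaleN1r addNr. Qed.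

Lemma dTZ X a U : X^T *m X = 1%:M -> dT X (a *: U) = a *: dT X U.
Proof. by move=> XX; have := dTP a U 0 XX; rewrite dT0 // !addr0. Qed.

Lemma dTN X U : X^T *m X = 1%:M -> dT (- X) U = - dT X U.
Proof.
move=> XX; rewrite -[RHS]scaleN1r -(dTZ _ _ XX) scaleN1r /dT tan_partN.
have -> : tan_part X (- U) = - tan_part X U.
  by have := tan_partP X (-1) U 0; rewrite addr0 {3}/tan_part /gram mulmx0 trmx0 mul0mx addr0 mulmx0 scaler0 subr0 addr0 !scaleN1r.
rewrite -{1}[tan_part X U]opprK dFN // -scaleN1r; apply: tangentZ.
exact: tan_part_tangent.
Qed.

Lemma cvg_dT (T : Type) (F : set_system T) (FF : Filter F) (A B : T -> 'M[R]_(n, l)) (A0 B0 : 'M[R]_(n, l)) :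
  A0^T *m A0 = 1%:M -> A @ F --> A0 -> B @ F --> B0 ->
  (\forall t \near F, (A t)^T *m A t = 1%:M) -> (fun t => dT (A t) (B t)) @ F --> dT A0 B0.
Proof.
move=> AA cA cB At; apply: dF_cvg => //; first exact: tan_part_tangent.
  exact: cvg_tan_part.
by apply: filterS At => t tt; split=> //; exact: tan_part_tangent.
Qed.

(** Injectivity of [Phi_X]: vanishing sides make [U] tangent and orthogonal to [X J], while the
    derivative of an immersion kills only multiples of [X J]. *)
Lemma dT_sides_eq0 X U : X^T *m X = 1%:M -> dT X U = 0 -> (forall q, side X U q = 0) -> U = 0.
Proof.
move=> XX + /side_eq0[tU iU]; rewrite /dT tan_part_id // => dU.
exact: (tangent_XJ_eq0 k_gt0 XX iU (dF_kernel k_gt0 k_le f_imm XX tU dU)).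
Qed.
End TangentDerivative.

(** * Test families of frames and directions *)

Record probe (R : realType) n k (Y : gluing) (X W : (Y -> R) -> 'M[R]_(n, 2 * k)) := Probe {
  probe_orthonormal : forall z, (X z)^T *m X z = 1%:M;
  probe_unit : forall z, inner (W z) (W z) = 1;
  probe_mblip : mblip X;
  probe_mblip_dir : mblip W;
  probe_sign : forall v z, z v = 0 -> exists a b : bool,
    [/\ X (rflip v z) = (-1) ^+ a *: X z, W (rflip v z) = (-1) ^+ b *: W z & sgn v = a (+) b] }.

Lemma inner_vec_mx (R : realType) n k (w : 'rV[R]_(n * (2 * k))) :
  inner (vec_mx w) (vec_mx w) = (w *m w^T) 0 0.
Proof.
rewrite inner_sum exchange_big pair_big mxE /=.
rewrite [RHS](reindex _ (curry_mxvec_bij _ _)) /=.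
by apply: eq_bigr => -[i j] _; rewrite !mxE.
Qed.

(** The frame and the direction may change sign independently, but [Phi] is odd in each, so only the
    product of the two signs matters. This is the character of [tensor], and [odd_bin_tensor] makes
    its top power nonzero. *)
Lemma probe_exists (R : realType) n k m J : (1 <= k)%N -> (2 * k <= n)%N ->
  is_min (fun r => odd 'C(k + r - 1, k - 1) /\
          (n%:Z - 2 * k%:Z <= 2 * r%:Z - 1 <= n%:Z - 1)%R) J ->
  ('C(n * k + m - 1, n * k - 1) <> 0 %[mod 2])%N -> (0 <= m <= J - 1)%N ->
  exists (Y : gluing) (X W : (Y -> R) -> 'M[R]_(n, 2 * k)),
    [/\ good Y, (#|Y| + 1 = 2 * m + n * (2 * k))%N, probe X W &
        forall z z', conformal ((X z)^T *m X z')].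
Proof.
move=> k1 kn hJ hm mJ.
have q0 : (0 < n * (2 * k))%N by rewrite muln_gt0; move: k1 kn; lia.
have [Z [gZ cZ [A [A1 A2 A3 A4]]]] := stiefel_family R k1 kn hJ mJ.
have [S [gS cS [u [u1 u2 u3 _]]]] := sphere_family R q0.
exists (tensor Z S), (fun z => A (z \o inl)), (fun z => vec_mx (u (z \o inr))^T); split.
- apply: good_tensor => //; rewrite cZ cS; apply: odd_bin_tensor => //; move: k1 kn; lia.
- by rewrite card_sum cZ cS -addnA addn1 prednK.
- split.
  + by move=> z; exact: A1.
  + by move=> z; rewrite inner_vec_mx trmxK u1 mxE eqxx.
  + exact: mblip_comp.
  + move=> i j; rewrite (_ : (fun _ => _) = fun z => u (z \o inr) (mxvec_index i j) 0).
      exact: (mblip_comp inr u2).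
    by apply/funext => z; rewrite !mxE.
  + move=> [v|v] z zv.
      exists (sgn v), false; rewrite expr0 scale1r addbF; split=> //.
      have -> : rflip (inl v : tensor Z S) z \o inl = rflip v (z \o inl) by apply/funext.
      exact: A3.
    exists false, (sgn v); rewrite expr0 scale1r; split=> //.
    have -> : rflip (inr v : tensor Z S) z \o inr = rflip v (z \o inr) by apply/funext.
    by rewrite u3 // !linearZ.
- by move=> z z'; exact: A4.
Qed.

Section Contradiction.
Variables (R : realType) (n k : nat).
Hypotheses (k_gt0 : (0 < k)%N) (k_le : (2 * k <= n)%N).
Local Notation l := (2 * k)%N.
Variables (N : nat) (f : circleStiefel R n k -> 'rV[R]_N).
Hypothesis f_imm : immersion (circleStiefel_atlas R n k) f.
Variables (Y : gluing) (X W : (Y -> R) -> 'M[R]_(n, l)).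
Hypothesis XW : probe X W.

Lemma probe_dT_equivariant : equivariant (fun z => dT f (X z) (W z)).
Proof.
move=> v z zv; have [a [b [-> -> ->]]] := probe_sign XW zv.
have XX := probe_orthonormal XW z.
have aX : ((-1) ^+ a *: X z)^T *m ((-1) ^+ a *: X z) = 1%:M.
  by case: (a); rewrite ?expr0 ?expr1 ?scale1r // scaleN1r [(- X z)^T]linearN /= mulNmx mulmxN opprK.
rewrite (dTZ k_gt0 k_le f_imm _ _ aX) addbC signr_addb -[RHS]scalerA; congr (_ *: _).
by case: a {aX}; rewrite ?expr0 ?expr1 ?scale1r // !scaleN1r (dTN k_gt0 k_le f_imm _ XX).
Qed.

Lemma probe_side_equivariant q : equivariant (fun z => side (X z) (W z) q : R^o).
Proof.
move=> v z zv; have [a [b [-> -> ->]]] := probe_sign XW zv.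
have := sideP ((-1) ^+ a *: X z) ((-1) ^+ b) (W z) 0 q; rewrite !addr0 side0 addr0 => ->.
rewrite signr_addb [in RHS]mulrC -[RHS]/((_ * _) * _) -mulrA; congr (_ * _).
by case: a; rewrite ?expr0 ?expr1 ?scale1r ?mul1r // scaleN1r mulN1r sideN.
Qed.

Lemma probe_ambient_invariant v z : z v = 0 -> ambient f (X (rflip v z)) = ambient f (X z).
Proof.
move=> zv; have [a [b [-> _ _]]] := probe_sign XW zv.
by case: a; rewrite ?expr0 ?expr1 ?scale1r // scaleN1r ambientN // (probe_orthonormal XW).
Qed.

Definition probe_set : set 'M[R]_(n, l + l) :=
  [set M | (lsubmx M)^T *m lsubmx M = 1%:M] `&` [set M | inner (rsubmx M) (rsubmx M) = 1].

Lemma closed_probe_set : closed probe_set.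
Proof.
pose L : {linear 'M[R]_(n, l + l) -> 'M[R]_(n, l)} := lsubmx.
pose Rt : {linear 'M[R]_(n, l + l) -> 'M[R]_(n, l)} := rsubmx.
have Lc (M : 'M[R]_(n, l + l)) : L @ M --> L M := @mx_linear_continuous _ _ _ _ L M.
have Rc (M : 'M[R]_(n, l + l)) : Rt @ M --> Rt M := @mx_linear_continuous _ _ _ _ Rt M.
apply: closedI.
  apply: (@closed_eq_cst R _ _ (fun M : 'M[R]_(n, l + l) => (L M)^T *m L M)) => M.
  have FM : Filter (nbhs M) := nbhs_filter M.
  exact: (cvg_mulmx FM (cvg_trmx FM (Lc M)) (Lc M)).
apply: (@closed_eq_cst R _ R^o (fun M : 'M[R]_(n, l + l) => inner (Rt M) (Rt M))) => M.
exact: (cvg_inner (nbhs_filter M) (Rc M) (Rc M)).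
Qed.

Lemma immersion_contradiction : good Y -> (N + (k * (2 * k + 1) + 1) = #|Y|)%N -> False.
Proof.
move=> gY cY.
pose psi (i : 'I_N + (upper l + unit)) (M : 'M[R]_(n, l + l)) : R := match i with
  | inl a => dT f (lsubmx M) (rsubmx M) 0 a
  | inr q => side (lsubmx M) (rsubmx M) q end.
pose kap z := row_mx (X z) (W z).
have [] // := @equivariant_zero R Y ('I_N + (upper l + unit))%type n (l + l) kap probe_set psi gY.
- by rewrite card_sum card_ord card_sides.
- by apply: mblip_row; [exact: probe_mblip XW|exact: probe_mblip_dir XW].
- move=> z; split; rewrite /= ?row_mxKl ?row_mxKr; first exact: probe_orthonormal XW z.
  exact: probe_unit XW z.
- exact: closed_probe_set.
- move=> [a|q] v z zv /=; rewrite !row_mxKl !row_mxKr.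
    by rewrite probe_dT_equivariant // mxE.
  exact: probe_side_equivariant.
move=> M [/= MM MU].
have [i i0] : exists i, psi i M != 0.
  apply: contrapT => h; have {}h i : psi i M = 0 by apply/eqP/negP => /negP i0; apply: h; exists i.
  have U0 : rsubmx M = 0.
    apply: (dT_sides_eq0 k_gt0 k_le f_imm MM); last by move=> q; exact: (h (inr q)).
    by apply/rowP => a; rewrite mxE; exact: (h (inl a)).
  by move: MU; rewrite U0 /inner mulmx0 linear0 => /esym/eqP; rewrite oner_eq0.
exists i.
pose L : {linear 'M[R]_(n, l + l) -> 'M[R]_(n, l)} := lsubmx.
pose Rt : {linear 'M[R]_(n, l + l) -> 'M[R]_(n, l)} := rsubmx.
(* Limits are taken inside [probe_set], since [ambient] has a junk value off the Stiefel
   manifold. *)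
pose F := within probe_set (nbhs M).
have FF : Filter F by exact: within_filter.
have idF : id @ F --> M by exact: cvg_within.
have Lc : (fun t => lsubmx t) @ F --> lsubmx M := cvg_linear_mx (g := L) idF.
have Rc : (fun t => rsubmx t) @ F --> rsubmx M := cvg_linear_mx (g := Rt) idF.
have Kt : \forall t \near F, (lsubmx t)^T *m lsubmx t = 1%:M.
  have KF : F probe_set by exact: withinT.
  by apply: filterS KF => t [].
suff C : psi i @ F --> psi i M by exact: (cvg_same_sign FF C i0).
case: i {i0} => [a|q] /=; last exact: cvg_side.
by apply: (cvg_entry (A := fun t => dT f (lsubmx t) (rsubmx t))); exact: cvg_dT.
Qed.
End Contradiction.

Section NodeFunctions.
Variables (R : realType) (O1 O2 : gluing) (V : lmodType R).
Local Notation O := (node O1 O2).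

Definition invariant (O : gluing) (g : (O -> R) -> V) := forall v z, z v = 0 -> g (rflip v z) = g z.

Lemma node_cos_equivariant (A : (O1 -> R) -> V) : equivariant A ->
  equivariant (fun z : O -> R => cos (rroot z) *: A (rleft z)).
Proof.
move=> qA v z zv; have q0 : equivariant (fun _ : O2 -> R => 0 : R^o) by move=> w y _; rewrite scaler0.
have [e1 [e2 [f [-> _ -> _ ->]]]] := node_equivariant qA q0 zv.
by rewrite signr_addb !scalerA mulrAC.
Qed.

Lemma node_sin_equivariant (A : (O2 -> R) -> V) : equivariant A ->
  equivariant (fun z : O -> R => sin (rroot z) *: A (rright z)).
Proof.
move=> qA v z zv; have q0 : equivariant (fun _ : O1 -> R => 0 : R^o) by move=> w y _; rewrite scaler0.
have [e1 [e2 [f [_ -> _ -> ->]]]] := node_equivariant q0 qA zv.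
by rewrite !scalerA mulrAC -signr_addb -addbA addbb addbF.
Qed.

Lemma node_left_invariant (g : (O1 -> R) -> V) : invariant g -> invariant (fun z : O -> R => g (rleft z)).
Proof. by move=> qg v z; have [_ -> _] := rflip_node v z; case: v => [[]|[v|v]] // zv; exact: qg. Qed.

Lemma node_right_invariant (g : (O2 -> R) -> V) : invariant g -> invariant (fun z : O -> R => g (rright z)).
Proof. by move=> qg v z; have [_ _ ->] := rflip_node v z; case: v => [[]|[v|v]] // zv; exact: qg. Qed.

End NodeFunctions.

Lemma equivariantD (R : realType) (O : gluing) (V : lmodType R) (g h : (O -> R) -> V) :
  equivariant g -> equivariant h -> equivariant (fun z => g z + h z).
Proof. by move=> qg qh v z zv; rewrite qg // qh // scalerDr. Qed.

Lemma equivariant_scale (R : realType) (O : gluing) (V : lmodType R) (c : (O -> R) -> R^o) (g : (O -> R) -> V) :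
  equivariant c -> invariant g -> equivariant (fun z => c z *: g z).
Proof. by move=> qc qg v z zv; rewrite qc // qg // scalerA. Qed.

Lemma balance (R : realType) (V : lmodType R) (c : R) (g1 g2 d1 d2 : V) : c != 0 ->
  c *: (g1 - g2) + d1 + d2 = 0 -> g1 + c^-1 *: d1 = g2 + (- c^-1) *: d2.
Proof.
move=> c0 e; apply/eqP; rewrite -subr_eq0 scaleNr opprD opprK addrACA -scalerDr.
by rewrite -[g1 - g2](scalerK c0) -scalerDr addrA e scaler0.
Qed.

(** * Two points at a time: skew embeddings *)

Section SkewContradiction.
Variables (R : realType) (n k : nat).
Hypotheses (k_gt0 : (0 < k)%N) (k_le : (2 * k <= n)%N).
Local Notation l := (2 * k)%N.
Variables (N : nat) (f : circleStiefel R n k -> 'rV[R]_N).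
Hypothesis f_skew : skew_embedding (circleStiefel_atlas R n k) f.

Let f_imm : immersion (circleStiefel_atlas R n k) f.
Proof. by have [[]] := f_skew. Qed.

(** For [c <> 0], dividing by [c] exhibits a common point of the two affine tangent spaces. For
    [c = 0] the two derivatives are opposite, and a nonzero one would span parallel lines; once both
    vanish, [dT_sides_eq0] applies to each. *)
Lemma skew_nonzero (X1 X2 xi eta : 'M[R]_(n, l)) (c : R)
    (XX1 : X1^T *m X1 = 1%:M) (XX2 : X2^T *m X2 = 1%:M) : piY (toV XX1) <> piY (toV XX2) ->
  c *: (ambient f X1 - ambient f X2) + dT f X1 xi + dT f X2 eta = 0 ->
  (forall q, side X1 xi q = 0) -> (forall q, side X2 eta q = 0) ->
  [/\ c = 0, xi = 0 & eta = 0].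
Proof.
move=> X12 e s1 s2; have [_ /(_ _ _ X12)[meet par]] := f_skew.
have [t1 _] := side_eq0 s1; have [t2 _] := side_eq0 s2.
have at1 a : affine_tangent (circleStiefel_atlas R n k) f (piY (toV XX1)) (ambient f X1 + a *: dT f X1 xi).
  rewrite -(dTZ k_gt0 k_le f_imm _ _ XX1); apply: (dF_affine_tangent k_gt0 k_le f_imm).
  exact: tan_part_tangent.
have at2 a : affine_tangent (circleStiefel_atlas R n k) f (piY (toV XX2)) (ambient f X2 + a *: dT f X2 eta).
  rewrite -(dTZ k_gt0 k_le f_imm _ _ XX2); apply: (dF_affine_tangent k_gt0 k_le f_imm).
  exact: tan_part_tangent.
have c0 : c = 0.
  apply: contrapT => /eqP c0; rewrite -[False]/(set0 (ambient f X1 + c^-1 *: dT f X1 xi)) -meet.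
  split; first exact: at1.
  have -> : ambient f X1 + c^-1 *: dT f X1 xi = ambient f X2 + (- c^-1) *: dT f X2 eta; last exact: at2.
  exact: balance.
move: e; rewrite c0 scale0r add0r => e.
have d0 : dT f X1 xi = 0.
  apply: contrapT => /eqP d0; refine (par _).
  have ed : dT f X1 xi = - dT f X2 eta by apply/eqP; rewrite -addr_eq0; apply/eqP; exact: e.
  exists (ambient f X1), (ambient f X2), (dT f X1 xi); split; [exact: d0|exact: at1|move=> t].
  rewrite ed scalerN -scaleNr; exact: at2.
split; [by []|exact: (dT_sides_eq0 k_gt0 k_le f_imm XX1 d0 s1)|].
by move: e; rewrite d0 add0r => d; exact: (dT_sides_eq0 k_gt0 k_le f_imm XX2 d s2).
Qed.

Definition anticonformal (B : 'M[R]_l) := forall i j : 'I_l, i = 0%N :> nat -> j = 1%N :> nat ->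
  B i i = - B j j /\ B i j = B j i.

Lemma anticonformal_rot a b : anticonformal (rot k a b) -> a = 0 /\ b = 0.
Proof.
have h0 : (0 < l)%N by rewrite muln_gt0.
have h1 : (1 < l)%N by move: k_gt0; lia.
move=> /(_ (Ordinal h0) (Ordinal h1) erefl erefl); rewrite !mxE -!val_eqE /= !inordK //=.
rewrite -[(0 %% 2)%N]/0%N -[(1 %% 2)%N]/1%N !mulr1n !mulr0n => -[ea eb].
by split; [move: ea; lra|move: eb; lra].
Qed.

(** If both frames lay on one orbit, [X1^T X2] would be some [rot a b], whose leading block is
    conformal; being anticonformal as well, it would force [a = b = 0]. *)
Lemma anticonformal_neq (X1 X2 : 'M[R]_(n, l)) (XX1 : X1^T *m X1 = 1%:M) (XX2 : X2^T *m X2 = 1%:M) :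
  anticonformal (X1^T *m X2) -> piY (toV XX1) <> piY (toV XX2).
Proof.
move=> aX /piY_eq[a [b [ab /= e]]]; move: aX; rewrite e mulmxA XX1 mul1mx => /anticonformal_rot[a0 b0].
by move: ab; rewrite a0 b0 expr0n addr0 => /eqP; rewrite eq_sym oner_eq0.
Qed.

Variables (Y : gluing) (X X' W W' : (Y -> R) -> 'M[R]_(n, l)).
Hypotheses (XW : probe X W) (XW' : probe X' W').
Hypothesis X_anti : forall z z', anticonformal ((X z)^T *m X' z').

Local Notation block := 'M[R]_(n, (l + l) + ((l + l) + 1)).
Implicit Type M : block.

Definition point1 M : 'M[R]_(n, l) := lsubmx (lsubmx M).
Definition point2 M : 'M[R]_(n, l) := rsubmx (lsubmx M).
Definition dir1 M : 'M[R]_(n, l) := lsubmx (lsubmx (rsubmx M)).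
Definition dir2 M : 'M[R]_(n, l) := rsubmx (lsubmx (rsubmx M)).

Lemma n_gt0 : (0 < n)%N.
Proof. by move: k_gt0 k_le; lia. Qed.

Definition weight M : R := rsubmx (rsubmx M) (Ordinal n_gt0) 0.

(** The anticonformal condition stands for the inequality of the two points of Y: unlike the latter
    it is closed, as the compactness argument requires. *)
Definition skew_set : set block :=
  [set M | (point1 M)^T *m point1 M = 1%:M] `&` [set M | (point2 M)^T *m point2 M = 1%:M] `&`
  [set M | weight M * weight M + inner (dir1 M) (dir1 M) + inner (dir2 M) (dir2 M) = 1] `&`
  [set M | anticonformal ((point1 M)^T *m point2 M)].

Lemma cvg_blocks (T : Type) (F : set_system T) (FF : Filter F) (g : T -> block) M : g @ F --> M ->
  [/\ (fun t => point1 (g t)) @ F --> point1 M, (fun t => point2 (g t)) @ F --> point2 M,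
      (fun t => dir1 (g t)) @ F --> dir1 M, (fun t => dir2 (g t)) @ F --> dir2 M &
      (fun t => weight (g t)) @ F --> weight M].
Proof.
move=> gM.
have cl p q (h : T -> 'M[R]_(n, p + q)) (H : 'M[R]_(n, p + q)) : h @ F --> H ->
    (fun t => lsubmx (h t)) @ F --> lsubmx H.
  move=> hH; pose L : {linear 'M[R]_(n, p + q) -> 'M[R]_(n, p)} := lsubmx.
  exact: (cvg_linear_mx (g := L) hH).
have cr p q (h : T -> 'M[R]_(n, p + q)) (H : 'M[R]_(n, p + q)) : h @ F --> H ->
    (fun t => rsubmx (h t)) @ F --> rsubmx H.
  move=> hH; pose L : {linear 'M[R]_(n, p + q) -> 'M[R]_(n, q)} := rsubmx.
  exact: (cvg_linear_mx (g := L) hH).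
have gl := cl _ _ _ _ gM; have gr := cr _ _ _ _ gM; have grl := cl _ _ _ _ gr.
split; [exact: cl|exact: cr|exact: cl|exact: cr|].
by apply: (cvg_entry (A := fun t => rsubmx (rsubmx (g t)))); exact: cr.
Qed.

Lemma closed_skew_set : closed skew_set.
Proof.
have H M := @cvg_blocks _ (nbhs M) (nbhs_filter M) id M (@cvg_id _ _).
apply: closedI; [apply: closedI; [apply: closedI|]|].
- apply: (@closed_eq_cst R _ _ (fun M => (point1 M)^T *m point1 M)) => M.
  have FM : Filter (nbhs M) := nbhs_filter M; have [c _ _ _ _] := H M.
  exact: (cvg_mulmx FM (cvg_trmx FM c) c).
- apply: (@closed_eq_cst R _ _ (fun M => (point2 M)^T *m point2 M)) => M.
  have FM : Filter (nbhs M) := nbhs_filter M; have [_ c _ _ _] := H M.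
  exact: (cvg_mulmx FM (cvg_trmx FM c) c).
- apply: (@closed_eq_cst R _ R^o (fun M => weight M * weight M + inner (dir1 M) (dir1 M) + inner (dir2 M) (dir2 M))) => M.
  have FM : Filter (nbhs M) := nbhs_filter M; have [_ _ c1 c2 c] := H M.
  apply: (cvgD (cvgD (cvgM c c) (cvg_inner FM c1 c1)) (cvg_inner FM c2 c2)).
rewrite (_ : [set M | _] = \bigcap_(i in [set i : 'I_l | i = 0%N :> nat]) \bigcap_(j in [set j : 'I_l | j = 1%N :> nat])
  ([set M | ((point1 M)^T *m point2 M) i i + ((point1 M)^T *m point2 M) j j = 0] `&`
   [set M | ((point1 M)^T *m point2 M) i j - ((point1 M)^T *m point2 M) j i = 0])); last first.
  apply/seteqP; split=> M /= h i.
    move=> i0 j j1; have [e1 e2] := h i j i0 j1; split => /=; first by rewrite e1 addNr.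
    by rewrite e2 subrr.
  move=> j i0 j1; have [/= e1 e2] := h i i0 j j1; split; first by apply/eqP; rewrite -addr_eq0 e1.
  by apply/eqP; rewrite -subr_eq0 e2.
have cE i j M : (fun M => ((point1 M)^T *m point2 M) i j) @ M --> ((point1 M)^T *m point2 M) i j.
  have FM : Filter (nbhs M) := nbhs_filter M; have [c1 c2 _ _ _] := H M.
  by apply: (cvg_entry (A := fun M => (point1 M)^T *m point2 M)); exact: (cvg_mulmx FM (cvg_trmx FM c1) c2).
apply: closed_bigI => i _; apply: closed_bigI => j _; apply: closedI.
  apply: (@closed_eq_cst R _ R^o (fun M => ((point1 M)^T *m point2 M) i i + ((point1 M)^T *m point2 M) j j)) => M.
  exact: (cvgD (cE i i M) (cE j j M)).
apply: (@closed_eq_cst R _ R^o (fun M => ((point1 M)^T *m point2 M) i j - ((point1 M)^T *m point2 M) j i)) => M.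
exact: (cvgB (cE i j M) (cE j i M)).
Qed.

Definition skew_map (i : 'I_N + ((upper l + unit) + (upper l + unit))) M : R := match i with
  | inl a => (weight M *: (ambient f (point1 M) - ambient f (point2 M)) +
      dT f (point1 M) (dir1 M) + dT f (point2 M) (dir2 M)) 0 a
  | inr (inl q) => side (point1 M) (dir1 M) q
  | inr (inr q) => side (point2 M) (dir2 M) q end.

Lemma skew_map_neq0 M : skew_set M -> exists i, skew_map i M != 0.
Proof.
move=> [[[/= XX1 XX2] w1] aX]; apply: contrapT => h.
have {}h i : skew_map i M = 0 by apply/eqP/negP => /negP i0; apply: h; exists i.
have [||q|q|c0 d1 d2] := @skew_nonzero (point1 M) (point2 M) (dir1 M) (dir2 M) (weight M) XX1 XX2.
- exact: anticonformal_neq.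
- by apply/rowP => a; rewrite [RHS]mxE; exact: (h (inl a)).
- exact: (h (inr (inl q))).
- exact: (h (inr (inr q))).
move: w1; rewrite c0 d1 d2 /inner !mulmx0 linear0 mulr0 !addr0 => /esym/eqP.
by rewrite oner_eq0.
Qed.

Lemma skew_map_cvg i M : skew_set M -> skew_map i @ within skew_set (nbhs M) --> skew_map i M.
Proof.
move=> [[[/= XX1 XX2] _] _]; set F := within skew_set (nbhs M).
have FF : Filter F by exact: within_filter.
have idF : id @ F --> M by exact: cvg_within.
have KF : F skew_set by exact: withinT.
have K1 : \forall t \near F, (point1 t)^T *m point1 t = 1%:M by apply: filterS KF => t [[[]]].
have K2 : \forall t \near F, (point2 t)^T *m point2 t = 1%:M by apply: filterS KF => t [[[]]].
have [c1 c2 c3 c4 c5] := cvg_blocks FF idF.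
case: i => [a|[q|q]]; [|exact: (@cvg_side _ _ _ _ F FF _ _ _ _ q c1 c3)|exact: (@cvg_side _ _ _ _ F FF _ _ _ _ q c2 c4)].
apply: (cvg_entry (A := fun M => weight M *: (ambient f (point1 M) - ambient f (point2 M)) +
      dT f (point1 M) (dir1 M) + dT f (point2 M) (dir2 M))).
have a1 := ambient_cvg k_gt0 k_le f_imm FF XX1 c1 K1.
have a2 := ambient_cvg k_gt0 k_le f_imm FF XX2 c2 K2.
have t1 := cvg_dT k_gt0 k_le f_imm FF XX1 c1 c3 K1.
have t2 := cvg_dT k_gt0 k_le f_imm FF XX2 c2 c4 K2.
exact: (cvgD (cvgD (cvgZ c5 (cvgB a1 a2)) t1) t2).
Qed.

Local Notation O := (node leaf (node Y Y)).
Local Notation zm z := (rroot (rright z)).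
Local Notation zl z := (rleft (rright z)).
Local Notation zr z := (rright (rright z)).

(** The factor [leaf] is the extra point of the join and carries the coefficient of [f y1 - f y2].
    That difference is unchanged when frames change sign, so its term follows the sign of the outer
    cosine alone. *)
Definition skew_point (z : O -> R) : block :=
  row_mx (row_mx (X (zl z)) (X' (zr z)))
    (row_mx (row_mx (sin (rroot z) *: (cos (zm z) *: W (zl z)))
                    (sin (rroot z) *: (sin (zm z) *: W' (zr z))))
            (cos (rroot z) *: const_mx 1)).

Lemma skew_pointE z :
  [/\ point1 (skew_point z) = X (zl z), point2 (skew_point z) = X' (zr z),
      dir1 (skew_point z) = sin (rroot z) *: (cos (zm z) *: W (zl z)),
      dir2 (skew_point z) = sin (rroot z) *: (sin (zm z) *: W' (zr z)) &
      weight (skew_point z) = cos (rroot z)].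
Proof.
rewrite /point1 /point2 /dir1 /dir2 /weight /skew_point.
by split; rewrite ?row_mxKl ?row_mxKr ?row_mxKl ?row_mxKr // !mxE mulr1.
Qed.

Lemma inner_scale (a : R) (U : 'M[R]_(n, l)) : inner (a *: U) (a *: U) = a ^+ 2 * inner U U.
Proof. by rewrite innerZl [inner U _]innerC innerZl mulrA. Qed.

Lemma skew_point_set z : skew_set (skew_point z).
Proof.
have [e1 e2 e3 e4 e5] := skew_pointE z; split; [split; [split|]|] => /=.
- by rewrite e1 (probe_orthonormal XW).
- by rewrite e2 (probe_orthonormal XW').
- rewrite e3 e4 e5 !inner_scale (probe_unit XW) (probe_unit XW') !mulr1 -addrA -mulrDr cos2Dsin2 mulr1.
  by rewrite -expr2 cos2Dsin2.
- by rewrite e1 e2; exact: X_anti.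
Qed.

Lemma mblip_skew_point : mblip skew_point.
Proof.
apply: mblip_row; [apply: mblip_row|apply: mblip_row; [apply: mblip_row|]].
- exact: mblip_comp (probe_mblip XW).
- exact: mblip_comp (probe_mblip XW').
- apply: mblipZ; [exact: blip_sin|apply: mblipZ; [exact: blip_cos|exact: mblip_comp (probe_mblip_dir XW)]].
- apply: mblipZ; [exact: blip_sin|apply: mblipZ; [exact: blip_sin|exact: mblip_comp (probe_mblip_dir XW')]].
- by apply: mblipZ; [exact: blip_cos|exact: mblip_cst].
Qed.

Lemma sideZ (Z U : 'M[R]_(n, l)) a q : side Z (a *: U) q = a * side Z U q.
Proof. by have := sideP Z a U 0 q; rewrite side0 !addr0. Qed.

Lemma skew_map_equivariant i : equivariant (fun z => skew_map i (skew_point z) : R^o).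
Proof.
have q1 : equivariant (fun _ : leaf -> R => 1 : R^o) by case.
case: i => [a|[q|q]].
- have E1 := node_sin_equivariant (O1 := leaf) (node_cos_equivariant (O2 := Y) (probe_dT_equivariant k_gt0 k_le f_imm XW)).
  have E2 := node_sin_equivariant (O1 := leaf) (node_sin_equivariant (O1 := Y) (probe_dT_equivariant k_gt0 k_le f_imm XW')).
  have I1 : invariant (fun z : O -> R => ambient f (X (zl z)) - ambient f (X' (zr z))).
    have J1 := node_right_invariant (O1 := leaf) (node_left_invariant (O2 := Y) (probe_ambient_invariant f XW)).
    have J2 := node_right_invariant (O1 := leaf) (node_right_invariant (O1 := Y) (probe_ambient_invariant f XW')).
    by move=> v z zv; rewrite J1 // J2.
  have E0 := equivariant_scale (node_cos_equivariant (O2 := node Y Y) q1) I1.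
  have E := equivariantD (equivariantD E0 E1) E2.
  suff e z : skew_map (inl a) (skew_point z) = (((cos (rroot z) *: (1 : R^o)) *: (ambient f (X (zl z)) - ambient f (X' (zr z))) +
      sin (rroot z) *: (cos (zm z) *: dT f (X (zl z)) (W (zl z)))) +
      sin (rroot z) *: (sin (zm z) *: dT f (X' (zr z)) (W' (zr z)))) 0 a.
    move=> v z zv; rewrite (e (rflip v z)) (e z).
    by have := congr1 (fun r : 'rV[R]_N => r 0 a) (E v z zv); rewrite [RHS]mxE.
  have [e1 e2 e3 e4 e5] := skew_pointE z; rewrite /skew_map e1 e2 e3 e4 e5.
  have XX1 := probe_orthonormal XW (zl z).
  have XX2 := probe_orthonormal XW' (zr z).
  by rewrite !(dTZ k_gt0 k_le f_imm _ _ XX1) !(dTZ k_gt0 k_le f_imm _ _ XX2) [_ *: (1 : R^o)]mulr1.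
- have E := node_sin_equivariant (O1 := leaf) (node_cos_equivariant (O2 := Y) (probe_side_equivariant XW q)).
  suff e z : skew_map (inr (inl q)) (skew_point z) =
      sin (rroot z) * (cos (zm z) * side (X (zl z)) (W (zl z)) q).
    by move=> v z zv; rewrite (e (rflip v z)) (e z); exact: (E v z zv).
  by have [e1 _ e3 _ _] := skew_pointE z; rewrite /skew_map e1 e3 !sideZ.
- have E := node_sin_equivariant (O1 := leaf) (node_sin_equivariant (O1 := Y) (probe_side_equivariant XW' q)).
  suff e z : skew_map (inr (inr q)) (skew_point z) =
      sin (rroot z) * (sin (zm z) * side (X' (zr z)) (W' (zr z)) q).
    by move=> v z zv; rewrite (e (rflip v z)) (e z); exact: (E v z zv).
  by have [_ e2 _ e4 _] := skew_pointE z; rewrite /skew_map e2 e4 !sideZ.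
Qed.

Lemma skew_contradiction : good Y -> (N + 2 * (k * (2 * k + 1) + 1) = 2 * (#|Y| + 1))%N -> False.
Proof.
move=> gY cY.
have gO : good O by exact: good_node good_leaf (good_node gY gY).
have [] // := equivariant_zero gO _ mblip_skew_point skew_point_set closed_skew_set skew_map_equivariant.
  rewrite 2!card_sum card_ord card_sides !card_node card_void.
  by move: cY; move: #|Y| (k * (2 * k + 1))%N => y q; lia.
move=> M KM; have [i i0] := skew_map_neq0 KM; exists i.
have FF : Filter (within skew_set (nbhs M)) by exact: within_filter.
exact: (cvg_same_sign FF (skew_map_cvg (i := i) KM) i0).
Qed.
End SkewContradiction.

(** * Reflected frames and the conclusion *)

Section Reflect.
Variables (R : realType) (n k : nat).
Local Notation l := (2 * k)%N.

Definition reflection : 'M[R]_l := diag_mx (\row_i (-1) ^+ (i == 1%N :> nat)).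

Lemma reflection_tr : reflection^T = reflection.
Proof. by rewrite /reflection tr_diag_mx. Qed.

Lemma reflection_sqr : reflection *m reflection = 1%:M.
Proof.
rewrite /reflection mulmx_diag -diag_const_mx; congr diag_mx.
by apply/rowP => i; rewrite !mxE -signr_addb addbb.
Qed.

Lemma probe_reflect (Y : gluing) (X W : (Y -> R) -> 'M[R]_(n, l)) :
  probe X W -> probe (fun z => X z *m reflection) W.
Proof.
move=> [X1 W1 X2 W2 s]; split=> //.
- by move=> z; rewrite trmx_mul reflection_tr -mulmxA (mulmxA (X z)^T) X1 mul1mx reflection_sqr.
- by apply: mblipM => //; exact: mblip_cst.
- by move=> v z /s[a [b [-> -> ->]]]; exists a, b; rewrite -scalemxAl.
Qed.

Lemma anticonformal_reflect (B : 'M[R]_l) : conformal B -> anticonformal (B *m reflection).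
Proof.
move=> cB i j i0 j1; have [e1 e2] := cB i j i0 j1.
rewrite /reflection mul_mx_diag !mxE i0 j1 /= expr0 expr1 !mulr1 !mulrN1 opprK.
by rewrite e1 e2 opprK.
Qed.
End Reflect.

Theorem proposition4p3 (R : realType) (n k : nat)
  (hk : (1 <= k)%N) (hn : (2 * k <= n)%N) (J m : nat)
  (hJ : is_min (fun r => odd 'C(k + r - 1, k - 1) /\
          (n%:Z - 2 * k%:Z <= 2 * r%:Z - 1 <= n%:Z - 1)%R) J)
  (hm : is_max (fun j => ('C(n * k + j - 1, n * k - 1) <> 0 %[mod 2])%N /\
          (0 <= j <= J - 1)%N) m) :
  (forall N : nat, N%:Z = (dimY n k)%:Z + 2 * m%:Z - 1 ->
     ~ exists f : circleStiefel R n k -> 'rV[R]_N,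
         immersion (circleStiefel_atlas R n k) f) /\
  ~ exists f : circleStiefel R n k -> 'rV[R]_(2 * dimY n k + 4 * m),
      skew_embedding (circleStiefel_atlas R n k) f.
Proof.
have [[bm mJ] _] := hm.
have [Y [X [W [gY cY XW cX]]]] := probe_exists R hk hn hJ bm mJ.
(* Dimension plus codimension of Y in the space of n x 2k matrices; with the size of the test space
   it yields both counts of components. *)
have dY : (dimY n k + (k * (2 * k + 1) + 1) = n * (2 * k))%N by rewrite /dimY; nia.
split=> [N NE [f f_imm]|[f f_skew]].
  apply: (immersion_contradiction hk hn f_imm XW gY).
  move: dY cY; move: (n * (2 * k))%N (k * (2 * k + 1))%N => p q; lia.
have X_anti z z' : anticonformal ((X z)^T *m (X z' *m reflection R k)).
  by rewrite mulmxA; apply: anticonformal_reflect; exact: cX.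
apply: (skew_contradiction hk hn f_skew XW (probe_reflect XW) X_anti gY).
move: dY cY; move: (n * (2 * k))%N (k * (2 * k + 1))%N => p q; lia.
Qed.
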